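(* Let $\kappa\in\mathbb Z_{\ge0}$. Assume $\overline f=\overline f(q,q')\in k[[q]][q']$, $\overline f\notin k$, is an eigenvector of all Hecke operators $nT_\kappa(n)$ ($(n,p)=1$) and ''$pT_\kappa(p)$'', with eigenvalues $\overline\lambda_n,\overline\lambda_p\in k$. Then there exist $\varphi=\varphi(q)\in qk[[q]]$ and $c,c_i\in k$, $i\ge0$, with $\overline{p^\kappa}\cdot c_{i-1}=\overline\lambda_p\cdot c_i$ for $i\gg0$, such that $\varphi$ is an eigenvector of all Hecke operators $T_{\kappa+2}(n)$ ($(n,p)=1$) and $T_{\kappa+2}(p)$, with the same eigenvalues $\overline\lambda_n,\overline\lambda_p$, and such that $$\overline f=c+\Big(\sum_{i\ge0}c_iF_{/k}^i\Big)\varphi^{\sharp,2},\qquad \varphi^{\sharp,2}:=\varphi^{(-1)}-\overline\lambda_p\cdot V(\varphi)\frac{q'}{q^p}+\overline{p^\kappa}\cdot V^2(\varphi)\left(\frac{q'}{q^p}\right)^p.$$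
   Context: **Rings.** $p\ge 5$ is a prime, $R$ is the completion of the maximal unramified extension of $\mathbb Z_p$, $k=R/pR$ (an algebraic closure of $\mathbb F_p$), $\phi:R\to R$ is the automorphism lifting Frobenius. A hat denotes $p$-adic completion; $R((q))=R[[q]][1/q]$. $\overline{p^\kappa}\in k$ is $1$ if $\kappa=0$ and $0$ if $\kappa>0$. **Operators on series.** On $k((q))$: $V(\sum a_mq^m)=\sum a_mq^{pm}$, $U(\sum a_mq^m)=\sum a_{mp}q^m$, $\varphi^{(-1)}=\sum_{(n,p)=1}\frac{a_n}{n}q^n$ for $\varphi=\sum a_nq^n$. $V$ extends to the $k$-algebra endomorphism of $k[[q]][q']$ with $V(q)=q^p$, $V(q')=0$. $F_{/k}$ is the $k$-algebra endomorphism of $k((q))[q']$ with $q\mapsto q^p$, $q'\mapsto(q')^p$ (so $F_{/k}=V$ on $k((q))$). The sum $\big(\sum_ic_iF_{/k}^i\big)\varphi^{\sharp,2}$ is understood as the formal sum, computed coefficientwise in powers of $q'/q^p$, namely $$\Big(\sum_{i\ge0}c_iV^i\Big)\varphi^{(-1)}+\sum_{i\ge0}(\overline{p^\kappa}c_{i-1}-\overline\lambda_pc_i)V^{i+1}(\varphi)\Big(\frac{q'}{q^p}\Big)^{p^i},\quad c_{-1}:=0.$$ **Hecke operators away from $p$.** $N\ge4$ is an integer coprime to $p$; $\epsilon(A)=1$ if $(A,N)=1$ and $0$ otherwise. Let $\delta:R((q))^{\wedge}\to R((q))[q']^{\wedge}$ be the $p$-derivation with $\delta x=(\phi(x)-x^p)/p$,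 where $\phi$ is the ring homomorphism extending $\phi$ on $R$ with $\phi(q)=q^p+pq'$. For $n\ge1$ coprime to $p$ fix a primitive $n$-th root of unity $\zeta_n\in R$, $\zeta_D=\zeta_n^{n/D}$ for $D\mid n$; $\delta$ extends uniquely to $R((q^{1/n}))^{\wedge}\to R((q^{1/n}))^{\wedge}[q']^{\wedge}$. For $\kappa\in\mathbb Z$, $f\in R((q))[q']^{\wedge}$: $T_\kappa(n)f=n^{\kappa-1}\sum_{A,B,D}D^{-\kappa}f(\zeta_D^Bq^{A/D},\delta(\zeta_D^Bq^{A/D}))\in R((q))[q']^{\wedge}$, sum over integers $A,B,D\ge0$ with $AD=n$, $(A,N)=1$, $B<D$. The induced operator on $k((q))[q']$ is also denoted $T_\kappa(n)$; on $k((q))$ it is $\sum a_mq^m\mapsto\sum_m\big(\sum_{A\mid(n,m)}\epsilon(A)A^{\kappa-1}a_{mn/A^2}\big)q^m$ (with $(n,0)=n$). For $\kappa\ge0$, $T_{\kappa+2}(p)$ on $k((q))$ is $U$. **The operator ''$pT_\kappa(p)$''.** Let $S_j\in\mathbb Z[q_1,\dots,q_p]$ be the $j$-th elementary symmetric polynomial and $\delta S_j=\frac1p\big(S_j(q_1^p+pq_1',\dots,q_p^p+pq_p')-S_j^p\big)$. The $k$-algebra map $k[[s_1,\dots,s_p]][s'_1,\dots,s'_p]\to k[[q_1,\dots,q_p]][q'_1,\dots,q'_p]$, $s_j\mapsto S_j$, $s'_j\mapsto\delta S_j$ (mod $p$), is injective. $f\in k[[q]][q']$ is Taylor $\delta$-$p$-symmetric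 if $\Sigma_pf=\sum_{j=1}^pf(q_j,q_j')$ is in its image, with preimage $(\Sigma_pf)_{(p)}$; then ''$pU$''$f$ is obtained from $(\Sigma_pf)_{(p)}$ by setting $s_1=\dots=s_{p-1}=0$, $s_p=q$, $s'_1=\dots=s'_{p-1}=0$, $s'_p=q'$, and ''$pT_\kappa(p)$''$f:=$''$pU$''$f+\overline{p^\kappa}\,Vf$. **Eigenvectors.** $\varphi\in qk[[q]]$ is an eigenvector of all $T_{\kappa+2}(n)$, $T_{\kappa+2}(p)$ with eigenvalues $\overline\lambda_n,\overline\lambda_p$ if $\varphi\neq0$, $T_{\kappa+2}(n)\varphi=\overline\lambda_n\varphi$ for all $(n,p)=1$, and $U\varphi=\overline\lambda_p\varphi$. $\overline f\in k[[q]][q']$ is an eigenvector of all $nT_\kappa(n)$, ''$pT_\kappa(p)$'' with eigenvalues $\overline\lambda_n,\overline\lambda_p$ if it is Taylor $\delta$-$p$-symmetric, $nT_\kappa(n)\overline f=\overline\lambda_n\overline f$ for all $(n,p)=1$, and ''$pT_\kappa(p)$''$\overline f=\overline\lambda_p\overline f$. *)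

(* Defs.v *)
From HB Require Import structures.
From mathcomp Require Import all_boot all_order all_algebra.
From mathcomp Require Import generic_quotient ring_quotient.
From mathcomp Require Import boolp classical_sets functions cardinality fsbigop.
From mathcomp Require Import mpoly.

Set Implicit Arguments.
Unset Strict Implicit.
Unset Printing Implicit Defensive.

Import Order.TTheory GRing.Theory Num.Theory.

Local Open Scope ring_scope.
Local Open Scope quotient_scope.

Section Laurent.
Variable A : comNzRingType.
Implicit Types (b m : int).

Definition lbounded b (f : int -> A) := forall m, m < b -> f m = 0.

Record laurent := Laurent {
  lcoef :> int -> A;
  lcoefP : exists b, lbounded b lcoef }.

HB.instance Definition _ := gen_eqMixin laurent.
HB.instance Definition _ := gen_choiceMixin laurent.

Implicit Types (f g h : laurent).

Lemma laurentP f g : (forall m, f m = g m) -> f = g.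
Proof.
case: f g => [f fP] [g gP] /= /funext fg; subst g.
by congr Laurent; apply: Prop_irrelevance.
Qed.

Lemma lbounded_le b b' (f : int -> A) : b <= b' -> lbounded b' f -> lbounded b f.
Proof. by move=> bb' fb m mb; apply: fb; apply: lt_le_trans bb'. Qed.

Lemma ladd_subproof f g : exists b, lbounded b (fun m => f m + g m).
Proof.
case: (lcoefP f) (lcoefP g) => [b fb] [b' gb].
exists (Num.min b b') => m mb; rewrite fb ?gb ?addr0 //.
  by apply: lt_le_trans mb _; rewrite ge_min lexx orbT.
by apply: lt_le_trans mb _; rewrite ge_min lexx.
Qed.
Definition ladd f g := Laurent (ladd_subproof f g).

Lemma lopp_subproof f : exists b, lbounded b (fun m => - f m).
Proof. by case: (lcoefP f) => b fb; exists b => m /fb ->; rewrite oppr0. Qed.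
Definition lopp f := Laurent (lopp_subproof f).

Lemma lmono_subproof (a : A) m0 :
  exists b, lbounded b (fun m => if m == m0 then a else 0).
Proof. by exists m0 => m; rewrite lt_neqAle => /andP[/negPf->]. Qed.
Definition lmono a m0 := Laurent (lmono_subproof a m0).

Definition lconst a := lmono a 0.

Lemma laddA : associative ladd.
Proof. by move=> f g h; apply: laurentP => m /=; rewrite addrA. Qed.
Lemma laddC : commutative ladd.
Proof. by move=> f g; apply: laurentP => m /=; rewrite addrC. Qed.
Lemma ladd0 : left_id (lconst 0) ladd.
Proof. by move=> f; apply: laurentP => m /=; rewrite if_same add0r. Qed.
Lemma laddN : left_inverse (lconst 0) lopp ladd.
Proof. by move=> f; apply: laurentP => m /=; rewrite if_same addNr. Qed.

HB.instance Definition _ := GRing.isZmodule.Build laurent laddA laddC ladd0 laddN.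

(* The sum has finite support because both factors are bounded below. *)
Definition lmulc (f g : int -> A) m : A :=
  \sum_(i \in [set: int]) f i * g (m - i).

Definition ltrunc b n (f : int -> A) : {poly A} :=
  \poly_(i < n.+1) f (b + i%:Z).

Lemma int_ge_nat b m : b <= m -> exists n : nat, m = b + n%:Z.
Proof.
by move=> bm; exists `|m - b|%N; rewrite gez0_abs ?subr_ge0 // [RHS]addrC subrK.
Qed.

Lemma lmulcE b b' (f g : int -> A) (n : nat) :
    lbounded b f -> lbounded b' g ->
  lmulc f g (b + b' + n%:Z) = (ltrunc b n f * ltrunc b' n g)`_n.
Proof.
move=> fb gb; rewrite /lmulc coefM.
pose s := [seq b + i%:Z | i : nat <- index_iota 0 n.+1].
have us : uniq s by rewrite map_inj_uniq ?iota_uniq // => x y /addrI [].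
rewrite (fsbigE s) //= => [|i _ si].
  rewrite (eq_bigl xpredT) => [|i]; last by rewrite in_setT.
  rewrite /s big_map big_mkord; apply: eq_bigr => i _.
  rewrite !coef_poly ltn_ord ltnS leq_subr -subzn; last by rewrite -ltnS.
  by congr (_ * g _); rewrite opprD addrACA [b + b']addrC addrK.
have [ib|bi] := ltP i b; first by rewrite fb ?mul0r.
have [k ik] := int_ge_nat bi.
rewrite ik gb ?mulr0 //; move: si; rewrite ik /s.
have [kn /negP[]|nk _] := ltnP k n.+1.
  by apply/mapP; exists k; rewrite // mem_index_iota.
by rewrite opprD addrACA [b + b']addrC addrK -ltrBrDl subrr subr_lt0 ltz_nat.
Qed.

Lemma lmulc_lt b b' (f g : int -> A) :
  lbounded b f -> lbounded b' g -> lbounded (b + b') (lmulc f g).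
Proof.
move=> fb gb m mb; apply: fsbig1 => i _.
have [ib|bi] := ltP i b; first by rewrite fb ?mul0r.
by rewrite gb ?mulr0 // ltrBlDl (lt_le_trans mb) // lerD2r.
Qed.

Lemma lmul_subproof f g : exists b, lbounded b (lmulc f g).
Proof.
case: (lcoefP f) (lcoefP g) => [b fb] [b' gb].
by exists (b + b'); apply: lmulc_lt.
Qed.
Definition lmul f g := Laurent (lmul_subproof f g).

Lemma laurent_ge b f g : lbounded b f -> lbounded b g ->
  (forall n : nat, f (b + n%:Z) = g (b + n%:Z)) -> f = g.
Proof.
move=> fb gb fg; apply: laurentP => m.
have [mb|/int_ge_nat[n ->]//] := ltP m b.
by rewrite fb // gb.
Qed.

Lemma coef_eqM n (P P' Q Q' : {poly A}) :
    (forall i : nat, (i <= n)%N -> P`_i = P'`_i) ->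
    (forall i : nat, (i <= n)%N -> Q`_i = Q'`_i) ->
  (P * Q)`_n = (P' * Q')`_n.
Proof.
move=> PP QQ; rewrite !coefM; apply: eq_bigr => i _.
by rewrite PP ?QQ ?leq_subr // -ltnS.
Qed.

Lemma coef_ltrunc b n (f : int -> A) (i : nat) : (i <= n)%N ->
  (ltrunc b n f)`_i = f (b + i%:Z).
Proof. by move=> ni; rewrite coef_poly ltnS ni. Qed.

Lemma ltruncM b b' n f g (i : nat) : lbounded b f -> lbounded b' g -> (i <= n)%N ->
  (ltrunc (b + b') n (lmul f g))`_i = (ltrunc b n f * ltrunc b' n g)`_i.
Proof.
move=> fb gb ni; rewrite coef_ltrunc //= lmulcE //.
by apply: coef_eqM => j ji; rewrite !coef_ltrunc // (leq_trans ji).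
Qed.

Lemma lmulA : associative lmul.
Proof.
move=> f g h; case: (lcoefP f) (lcoefP g) (lcoefP h) => [a fa] [b gb] [c hc].
have fg := lmulc_lt fa gb; have gh := lmulc_lt gb hc.
apply: (@laurent_ge (a + (b + c))) => [||n].
- exact: lmulc_lt.
- by rewrite addrA; apply: lmulc_lt.
rewrite [LHS](lmulcE (g := lmul g h)) // addrA [RHS](lmulcE (f := lmul f g)) //.
transitivity ((ltrunc a n f * (ltrunc b n g * ltrunc c n h))`_n).
  by apply: coef_eqM => // i ni; rewrite ltruncM.
by rewrite mulrA; apply: coef_eqM => // i ni; rewrite ltruncM.
Qed.

Lemma lmulC : commutative lmul.
Proof.
move=> f g; case: (lcoefP f) (lcoefP g) => [a fa] [b gb].
apply: (@laurent_ge (a + b)) => [||n].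
- exact: lmulc_lt.
- by rewrite addrC; apply: lmulc_lt.
by rewrite /= lmulcE // [a + b]addrC lmulcE // mulrC.
Qed.

Lemma lmonoE a m0 f m : lmul (lmono a m0) f m = a * f (m - m0).
Proof.
rewrite /= /lmulc (fsbigE [:: m0]) //= => [|i _].
  by rewrite big_cons big_nil in_setT addr0 eqxx.
by rewrite inE => /negPf->; rewrite mul0r.
Qed.

Lemma lmul1 : left_id (lconst 1) lmul.
Proof. by move=> f; apply: laurentP => m; rewrite lmonoE mul1r subr0. Qed.

Lemma lmulDl : left_distributive lmul ladd.
Proof.
move=> f g h; case: (lcoefP f) (lcoefP g) (lcoefP h) => [a fa] [b gb] [c hc].
pose d := Num.min a b.
have fd : lbounded d f by apply: lbounded_le fa; rewrite ge_min lexx.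
have gd : lbounded d g by apply: lbounded_le gb; rewrite ge_min lexx orbT.
have fgd : lbounded d (ladd f g) by move=> m md /=; rewrite fd ?gd ?addr0.
apply: (@laurent_ge (d + c)) => [||n].
- exact: lmulc_lt.
- by move=> m md /=; rewrite !(lmulc_lt _ hc md) ?addr0.
rewrite [LHS](lmulcE (f := ladd f g)) //= !lmulcE // -coefD -mulrDl.
by apply: coef_eqM => i ni //; rewrite coefD !coef_ltrunc.
Qed.

Lemma lone_neq0 : lconst 1 != 0.
Proof.
apply/eqP => /(congr1 (fun f : laurent => f 0)) /= /eqP.
by rewrite oner_eq0.
Qed.

HB.instance Definition _ := GRing.Zmodule_isComNzRing.Build laurent
  lmulA lmulC lmul1 lmulDl lone_neq0.
End Laurent.

Notation "{ 'laurent' A }" := (laurent A) (format "{ 'laurent'  A }").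

(* Congruence modulo p ^ e. *)
Definition pcong (p : nat) (V : zmodType) (e : nat) (x y : V) :=
  exists z, x - y = z *+ (p ^ e).

Section Completion.
Variables (p : nat) (A : comNzRingType).

Local Notation pcong := (pcong p).

(* The p-adic completion is the inverse limit of the quotients A / p ^ e A: its
   elements are represented by sequences x with x e determining the class
   modulo p ^ e, up to sequences with x e in p ^ e A for all e. *)
Definition coherent : {pred nat -> A} :=
  fun x => `[< forall e, pcong e (x e.+1) (x e) >].

Lemma coherent_subring : subring_closed coherent.
Proof.
split=> [|x y /asboolP xc /asboolP yc|x y /asboolP xc /asboolP yc];
  apply/asboolP => e.
- by exists 0; rewrite subrr mul0rn.
- have [[z xz] [w yw]] := (xc e, yc e).
  exists (z - w); rewrite mulrnBl -xz -yw /=.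
  by rewrite !opprD !opprK addrACA.
have [[z xz] [w yw]] := (xc e, yc e).
exists (z * y e.+1 + x e * w).
rewrite mulrnDl -mulrnAl -mulrnAr -xz -yw mulrBl mulrBr addrA subrK.
by [].
Qed.
HB.instance Definition _ :=
  GRing.isSubringClosed.Build (nat -> A) coherent coherent_subring.

Record cseq := CSeq { cseq_val :> nat -> A; _ : cseq_val \in coherent }.
HB.instance Definition _ := [isSub for cseq_val].
HB.instance Definition _ := [Choice of cseq by <:].
HB.instance Definition _ :=
  GRing.SubChoice_isSubComPzRing.Build (nat -> A) coherent cseq coherent_subring.

Definition cseq_null : {pred cseq} := fun x => `[< forall e, pcong e (x e) 0 >].

Lemma cseq_null_zmod : zmod_closed cseq_null.
Proof.
split=> [|x y /asboolP x0 /asboolP y0]; apply/asboolP => e.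
  by exists 0; rewrite subrr mul0rn.
have [[z xz] [w yw]] := (x0 e, y0 e).
by exists (z - w); rewrite mulrnBl -xz -yw !subr0.
Qed.
HB.instance Definition _ := GRing.isZmodClosed.Build cseq cseq_null cseq_null_zmod.

Lemma cseq_nullM (x y : cseq) : y \in cseq_null -> x * y \in cseq_null.
Proof.
move=> /asboolP y0; apply/asboolP => e; have [w yw] := y0 e.
by exists (x e * w); rewrite -mulrnAr -yw !subr0.
Qed.

Definition compl := Quotient.quot cseq_null.
HB.instance Definition _ := GRing.Zmodule.on compl.
HB.instance Definition _ := EqQuotient.on compl.

Definition compl_one : compl := \pi_compl (1 : cseq).
Definition compl_mul (x y : compl) : compl :=
  \pi_compl (repr x * repr y : cseq).

Lemma pi_mul (x y : cseq) : compl_mul (\pi_compl x) (\pi_compl y) = \pi_compl (x * y).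
Proof.
apply/eqP; rewrite /compl_mul -Quotient.idealrBE.
set x' := repr _; set y' := repr _.
have x'x : x' - x \in cseq_null by rewrite Quotient.idealrBE reprK.
have y'y : y' - y \in cseq_null by rewrite Quotient.idealrBE reprK.
have -> : x' * y' - x * y = x' * (y' - y) + y * (x' - x).
  by rewrite !mulrBr [y * x']mulrC [y * x]mulrC addrA subrK.
by rewrite rpredD // cseq_nullM.
Qed.

Lemma compl_ind (P : compl -> Prop) :
  (forall x : cseq, P (\pi_compl x)) -> forall x, P x.
Proof. by move=> Ppi x; rewrite -[x]reprK. Qed.

Lemma compl_mulA : associative compl_mul.
Proof.
elim/compl_ind => x; elim/compl_ind => y; elim/compl_ind => z.
by rewrite !pi_mul mulrA.
Qed.
Lemma compl_mulC : commutative compl_mul.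
Proof. by elim/compl_ind => x; elim/compl_ind => y; rewrite !pi_mul mulrC. Qed.
Lemma compl_mul1 : left_id compl_one compl_mul.
Proof. by elim/compl_ind => x; rewrite pi_mul mul1r. Qed.
Lemma compl_mulDl : left_distributive compl_mul +%R.
Proof.
elim/compl_ind => x; elim/compl_ind => y; elim/compl_ind => z.
have piD u v : \pi_compl (u + v) = \pi_compl u + \pi_compl v :> compl.
  exact: Quotient.pi_add.
by rewrite -piD !pi_mul mulrDl piD.
Qed.
HB.instance Definition _ := GRing.Zmodule_isComPzRing.Build compl
  compl_mulA compl_mulC compl_mul1 compl_mulDl.

Lemma pi_compl_zmod : zmod_morphism (\pi_compl : cseq -> compl).
Proof.
move=> x y.
exact: (etrans (Quotient.pi_add _ _ _) (congr1 _ (Quotient.pi_opp _ _))).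
Qed.
HB.instance Definition _ :=
  GRing.isZmodMorphism.Build cseq compl (\pi_compl) pi_compl_zmod.

Lemma pi_compl_eq0 (x : cseq) :
  \pi_compl x = 0 :> compl <-> forall e, pcong e (x e) 0.
Proof.
rewrite -(raddf0 (\pi_compl : {additive cseq -> compl})).
split=> [/eqP|xe].
  by rewrite -Quotient.idealrBE subr0 => /asboolP.
by apply/eqP; rewrite -Quotient.idealrBE subr0; apply/asboolP.
Qed.

Lemma cseqMn (z : cseq) n e : (z *+ n) e = z e *+ n.
Proof. by elim: n => [|n IH] //; rewrite !mulrS -IH. Qed.

Lemma compl_sep (v : compl) : (forall e, pcong e v 0) -> v = 0.
Proof.
elim/compl_ind: v => x xP; apply/pi_compl_eq0 => e.
have [z] := xP e; elim/compl_ind: z => z.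
rewrite subr0 -raddfMn => /eqP; rewrite -subr_eq0 -raddfB => /eqP.
move=> /pi_compl_eq0/(_ e)[w]; rewrite subr0 => xzw.
by exists (z e + w); rewrite mulrnDl -xzw -cseqMn subr0 addrC /= subrK.
Qed.

Lemma to_compl_subproof (a : A) : (fun=> a) \in coherent.
Proof. by apply/asboolP => e; exists 0; rewrite subrr mul0rn. Qed.
Definition to_compl (a : A) : compl :=
  \pi_compl (CSeq (to_compl_subproof a)).

Lemma to_compl_zmod : zmod_morphism to_compl.
Proof.
move=> a b; rewrite /to_compl.
set x := CSeq (to_compl_subproof a); set y := CSeq (to_compl_subproof b).
have -> : CSeq (to_compl_subproof (a - b)) = x - y by apply: val_inj.
exact: (etrans (Quotient.pi_add _ _ _) (congr1 _ (Quotient.pi_opp _ _))).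
Qed.
HB.instance Definition _ := GRing.isZmodMorphism.Build A compl to_compl to_compl_zmod.

Lemma to_compl_monoid : monoid_morphism to_compl.
Proof.
split=> [|a b]; first by congr \pi_compl; apply: val_inj.
by rewrite /to_compl [RHS]pi_mul; congr \pi_compl; apply: val_inj.
Qed.
HB.instance Definition _ := GRing.isMonoidMorphism.Build A compl to_compl to_compl_monoid.
End Completion.

Lemma pcong_to_compl (p : nat) (A : comNzRingType) e (a b : A) :
  pcong p e (to_compl p a) (to_compl p b) -> pcong p e a b.
Proof.
move=> [z]; elim/compl_ind: z => z; rewrite -raddfB -raddfMn => /eqP.
rewrite -subr_eq0 /= /to_compl -raddfB => /eqP/pi_compl_eq0/(_ e)[w].
rewrite subr0 => abzw; exists (z e + w).
rewrite mulrnDl -abzw -cseqMn [RHS]addrC; exact/esym/subrK.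
Qed.

(* The p-adically continuous extension to the completion of an additive map
   h : A -> compl p B; its value at x is the unique v such that h a tends
   p-adically to v as the element a of A tends to x. *)
Definition compl_ext (p : nat) (A B : comNzRingType)
    (h : A -> compl p B) (x : compl p A) : compl p B :=
  xget 0 [set v | forall e (a : A),
    pcong p e x (to_compl p a) -> pcong p e v (h a)].

Lemma compl_extE (p : nat) (A B : comNzRingType)
  (h : {additive A -> compl p B}) (a : A) : compl_ext h (to_compl p a) = h a.
Proof.
rewrite /compl_ext; case: xgetP => [v _ vP|/(_ (h a))[]] /=.
  apply/eqP; rewrite -subr_eq0; apply/eqP/compl_sep => e.
  have [|z vz] := vP e a; first by exists 0; rewrite subrr mul0rn.
  by exists z; rewrite subr0.
move=> e b /pcong_to_compl[z abz].
by exists (h z); rewrite -raddfB abz raddfMn.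
Qed.

Section LaurentMaps.
Variable A : comUnitRingType.

Lemma lsub_subproof (u : A) (e : nat) (f : {laurent A}) : exists b, lbounded b
  (fun m => if (e%:Z %| m)%Z then f (m %/ e%:Z)%Z * u ^ (m %/ e%:Z)%Z else 0).
Proof.
have [b fb] := lcoefP f; exists (Num.min 0 (e%:Z * b)) => m.
rewrite lt_min => /andP[m0 mb].
case: ifP => // /dvdzP[j mj]; subst m; case: e m0 mb => [|e] m0 mb.
  by rewrite mulr0 ltxx in m0.
by rewrite mulzK // fb ?mul0r // -(ltr_pM2l (x := e.+1%:Z)) // mulrC.
Qed.

(* Substitution of u q ^ e for q. *)
Definition lsub (u : A) (e : nat) (f : {laurent A}) : {laurent A} :=
  Laurent (lsub_subproof u e f).
End LaurentMaps.

Section LaurentReduction.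
Variables A B : comNzRingType.

Lemma lmap_subproof (g : A -> B) (f : {laurent A}) :
  exists b, lbounded b (fun m => if f m == 0 then 0 else g (f m)).
Proof. by have [b fb] := lcoefP f; exists b => m /fb ->; rewrite eqxx. Qed.

(* g is applied to the nonzero coefficients only, so that it need not preserve
   0. *)
Definition lmap (g : A -> B) (f : {laurent A}) : {laurent B} :=
  Laurent (lmap_subproof g f).
End LaurentReduction.

Section Operators.
Variables (p : nat) (k : fieldType).
Implicit Types f : {laurent k}.

Definition Vop f : {laurent k} := lsub 1 p f.

Lemma Uop_subproof f :
  exists b, lbounded b (fun m => if (0 < p)%N then f (p%:Z * m) else 0).
Proof.
have [b fb] := lcoefP f; exists (Num.min 0 b) => m.
rewrite lt_min => /andP[m0 mb]; case: ifP => // p0; apply: fb.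
apply: le_lt_trans mb; rewrite -subr_ge0 -{1}[m]mul1r -mulrBl.
by rewrite mulr_le0 ?subr_le0 // ?ltW // lez_nat.
Qed.
(* The test 0 < p only makes the definition total. *)
Definition Uop f : {laurent k} := Laurent (Uop_subproof f).

Lemma antiderp_subproof f :
  exists b, lbounded b (fun m => if (p%:Z %| m)%Z then 0 else f m / m%:~R).
Proof.
by have [b fb] := lcoefP f; exists b => m /fb ->; rewrite mul0r if_same.
Qed.
(* \sum_(p does not divide n) a_n / n q ^ n *)
Definition antiderp f : {laurent k} := Laurent (antiderp_subproof f).

Definition frobk (f : {poly {laurent k}}) : {poly {laurent k}} :=
  map_poly Vop f \Po 'X^p.

(* q' / q ^ p *)
Definition dq : {poly {laurent k}} := lmono 1 (- p%:Z) *: 'X.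

Definition sharp2 (lp pk : k) (phi : {laurent k}) : {poly {laurent k}} :=
  (antiderp phi)%:P - (lconst lp * Vop phi) *: dq
    + (lconst pk * Vop (Vop phi)) *: dq ^+ p.

(* V(q') = 0 *)
Definition Vpoly (f : {poly {laurent k}}) : {poly {laurent k}} := (Vop f`_0)%:P.

(* k[[q]][q'] *)
Definition is_dseries (f : {poly {laurent k}}) :=
  forall j m, m < 0 -> (f`_j : {laurent k}) m = 0.

(* q k[[q]] *)
Definition is_qseries f := forall m, m <= 0 -> f m = 0.

Definition formal_sum (F : nat -> {poly {laurent k}}) (g : {poly {laurent k}}) :=
  forall j m, exists n0 : nat, forall n : nat, (n0 <= n)%N ->
    (g`_j : {laurent k}) m = ((\sum_(i < n) F i)`_j : {laurent k}) m.
End Operators.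

Section DeltaSymmetric.
Variables (p : nat) (k : fieldType).

(* In 'X_{1..p + p} the first p variables are q_1, ..., q_p (or s_1, ..., s_p)
   and the last p ones are q'_1, ..., q'_p (or s'_1, ..., s'_p). *)
Definition symq (i : 'I_p) : {mpoly int[p + p]} :=
  mesym p int i.+1 \mPo [tuple 'X_(lshift p l) | l < p].

Definition symq_phi (i : 'I_p) : {mpoly int[p + p]} :=
  mesym p int i.+1 \mPo
    [tuple 'X_(lshift p l) ^+ p + 'X_(rshift p l) *+ p | l < p].

(* The division by p is exact. *)
Definition delta_sym (i : 'I_p) : {mpoly int[p + p]} :=
  map_mpoly (fun z => (z %/ p%:Z)%Z) (symq_phi i - symq i ^+ p).

(* The image of the monomial in the s_j and s'_j with exponent a. *)
Definition sym_monomial (a : 'X_{1..p + p}) : {mpoly k[p + p]} :=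
  \prod_(i < p) (map_mpoly intr (symq i) ^+ a (lshift p i)
                 * map_mpoly intr (delta_sym i) ^+ a (rshift p i)).

(* k[[s_1, ..., s_p]][s'_1, ..., s'_p] *)
Definition is_mdseries (h : 'X_{1..p + p} -> k) :=
  exists d : nat, forall a : 'X_{1..p + p},
    (d < \sum_(i < p) a (rshift p i))%N -> h a = 0.

(* The support is finite: S_j has no constant term, and the degree in the s'_j
   is bounded. *)
Definition sym_subst (h : 'X_{1..p + p} -> k) (m : 'X_{1..p + p}) : k :=
  \sum_(a \in [set: 'X_{1..p + p}]) h a * (sym_monomial a)@_m.

Definition Sigma_p (f : {poly {laurent k}}) (m : 'X_{1..p + p}) : k :=
  \sum_(l < p)
    if m == (U_(lshift p l) *+ m (lshift p l)
             + U_(rshift p l) *+ m (rshift p l))%MM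
    then (f`_(m (rshift p l)) : {laurent k}) (m (lshift p l))%:Z else 0.

Definition Sigma_preimage (f : {poly {laurent k}}) (h : 'X_{1..p + p} -> k) :=
  is_mdseries h /\ sym_subst h =1 Sigma_p f.

Definition taylor_sym (f : {poly {laurent k}}) :=
  exists h, Sigma_preimage f h.

(* The exponent of s_p ^ a * s'_p ^ b. *)
Definition mnm_last (a b : nat) : 'X_{1..p + p} :=
  [multinom (match fintype.split i with
             | inl l => if l.+1 == p then a else 0%N
             | inr l => if l.+1 == p then b else 0%N
             end) | i < p + p].

Definition is_pU (f g : {poly {laurent k}}) :=
  is_dseries g /\ exists2 h, Sigma_preimage f h &
    forall a b : nat, (g`_b : {laurent k}) a%:Z = h (mnm_last a b).

Definition is_pT (kappa : nat) (f g : {poly {laurent k}}) :=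
  exists2 g0, is_pU f g0 & g = g0 + lconst (p ^ kappa)%:R *: Vpoly p f.
End DeltaSymmetric.

(* R with residue map red : R -> k: an unramified complete discrete valuation
   ring with uniformizer p and residue field an algebraic closure of F_p; this
   determines (R, k, red) up to isomorphism. *)
Record is_Zp_ur_hat (p : nat) (R : idomainType) (k : closedFieldType)
    (red : {rmorphism R -> k}) : Prop := {
  ur_red_surj : forall x : k, exists a, red a = x;
  ur_red_ker : forall a, red a = 0 <-> exists b, a = b *+ p;
  ur_alg : forall x : k, algebraicOver (fun a : 'F_p => (a : nat)%:R : k) x;
  ur_char0 : p%:R != 0 :> R;
  ur_sep : forall a : R, (forall e, pcong p e a 0) -> a = 0;
  ur_complete : forall x : nat -> R, (forall e, pcong p e (x e.+1) (x e)) ->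
    exists a : R, forall e, pcong p e a (x e) }.

Definition is_frobenius_lift (p : nat) (R : idomainType) (phi : R -> R) :=
  bijective phi /\ forall a, pcong p 1 (phi a) (a ^+ p).

Section Hecke.
Variables (p N : nat) (R : idomainType) (k : closedFieldType).
Variables (red : {rmorphism R -> k}) (phi : {rmorphism R -> R}).

(* The p-adic completion of R((q^(1/n))); the variable of {laurent R} stands
   for q^(1/n). *)
Definition Lhat := compl p {laurent R}.

(* The p-adic completion of R((q^(1/n)))[q'] *)
Definition Lphat := compl p {poly {laurent R}}.

Definition Lhat_inc : Lhat -> Lphat :=
  @compl_ext p _ _ (fun a => to_compl p a%:P).

(* The inclusions R((q))^ -> R((q^(1/n)))^ and
   R((q))[q']^ -> R((q^(1/n)))[q']^ *)
Definition Lhat_root (n : nat) : Lhat -> Lhat :=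
  @compl_ext p _ _ (fun a => to_compl p (lsub 1 n a)).
Definition Lphat_root (n : nat) : Lphat -> Lphat :=
  @compl_ext p _ _ (fun a => to_compl p (map_poly (lsub 1 n) a)).

Definition p_derivation_of (Phi : {rmorphism Lhat -> Lphat})
    (delta : Lhat -> Lphat) :=
  forall x, delta x *+ p = Phi x - Lhat_inc x ^+ p.

(* The p-derivation on R((q))^ *)
Definition is_delta (delta : Lhat -> Lphat) :=
  exists Phi : {rmorphism Lhat -> Lphat}, [/\ p_derivation_of Phi delta,
    forall a, Phi (to_compl p (lconst a)) = to_compl p (lconst (phi a))%:P
  & Phi (to_compl p (lmono 1 1))
    = to_compl p ((lmono 1 p%:Z)%:P + 'X *+ p)].

(* deltan extends delta to R((q^(1/n)))^ *)
Definition extends_delta (n : nat) (delta deltan : Lhat -> Lphat) :=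
  (exists Phi, p_derivation_of Phi deltan) /\
  forall x, deltan (Lhat_root n x) = Lphat_root n (delta x).

Variables (zeta : nat -> R) (delta : nat -> Lhat -> Lphat).

Definition Lcst (a : R) : Lphat := to_compl p (lconst a)%:P.

(* f(x, delta x) for x = u q^(e/n) *)
Definition dsubst (n : nat) (u : R) (e : nat) : Lphat -> Lphat :=
  @compl_ext p _ _ (fun f : {poly {laurent R}} =>
    \sum_(j < size f) to_compl p (lsub u e f`_j)%:P
                     * delta n (to_compl p (lmono u e%:Z)) ^+ j).

(* T_kappa(n) f, in R((q^(1/n)))[q']^; here A = n / D, so that q^(A/D) is the
   A * A-th power of q^(1/n), and zeta_D = zeta_n^A. *)
Definition hecke (kappa : int) (n : nat) (f : Lphat) : Lphat :=
  Lcst (n%:R ^ (kappa - 1)) *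
  \sum_(D <- divisors n | coprime (n %/ D) N) \sum_(B < D)
    Lcst (D%:R ^ (- kappa))
    * dsubst n (zeta n ^+ (n %/ D * B)) (n %/ D * (n %/ D)) f.

Definition reduce (x : Lphat) : {poly {laurent k}} :=
  map_poly (lmap red) (repr x 1%N).

Definition lift_coef (x : k) : R := xget 0 [set a | red a = x].

Definition lift (f : {poly {laurent k}}) : Lphat :=
  to_compl p (map_poly (lmap lift_coef) f).

(* The operator induced by T_kappa(n) on k((q))[q'], with values in
   k((q^(1/n)))[q']; it does not depend on the choice of the lift. *)
Definition heckek (kappa : int) (n : nat) (f : {poly {laurent k}}) :
  {poly {laurent k}} := reduce (hecke kappa n (lift f)).

(* The inclusion k((q))[q'] -> k((q^(1/n)))[q'] *)
Definition kroot (n : nat) (f : {poly {laurent k}}) : {poly {laurent k}} :=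
  map_poly (lsub 1 n) f.

Definition eigen_dseries (kappa : nat) (lam : nat -> k)
    (f : {poly {laurent k}}) :=
  [/\ taylor_sym p f,
      forall n, coprime n p ->
        lconst n%:R *: heckek kappa%:Z n f = kroot n (lconst (lam n) *: f)
    & is_pT p kappa f (lconst (lam p) *: f)].

Definition eigen_series (kappa : nat) (lam : nat -> k) (phi : {laurent k}) :=
  [/\ is_qseries phi, phi != 0,
      forall n, coprime n p ->
        heckek (kappa + 2)%:Z n phi%:P = kroot n (lconst (lam n) * phi)%:P
    & Uop p phi = lconst (lam p) * phi].
End Hecke.

(* Main.v *)
Require Import Defs.
From HB Require Import structures.
From mathcomp Require Import all_boot all_order all_algebra.
From mathcomp Require Import generic_quotient.
From mathcomp Require Import boolp classical_sets functions cardinality fsbigop.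
From mathcomp Require Import mpoly ring zify.

Set Implicit Arguments.
Unset Strict Implicit.
Unset Printing Implicit Defensive.

Import Order.TTheory GRing.Theory Num.Theory.
Local Open Scope ring_scope.

(* Give q weight 1 and q' weight p. Since S_j and delta S_j are isobaric,
   delta-symmetry of f splits into one polynomial identity per weight w, relating
   the coefficients of q^(w - pb) q'^b in f to those of the preimage of Sigma_p f.
   Evaluate such an identity at q_l = x + l t and
   q'_l = - sum_i mu_i l^(p-1-i) t^(-pi), l in F_p. As sum_l l^s is 0 for s < p-1 and
   -1 for s = p-1, all S_j and delta S_j stay integral in t, so every pole in t on the
   side of f must cancel: this forces b = p^i and p^(i+1) | w whenever b > 0. Choosing
   the mu_i such that only S_p and delta S_p survive at t = 0 computes "pU" f, whence
   the coefficients of f satisfy U-type recursions with eigenvalue lambda_p.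

   Away from p, delta(zeta q^(A/D)) is, modulo p, (A/D) (zeta q^(A/D))^p q'/q^p, so
   nT_kappa(n) acts on the coefficient of (q'/q^p)^b through a sum over AD = n with
   weights A^kappa D (A/D)^b. For b = p^i these are the weights A^(kappa+1) of
   T_(kappa+2)(n), since A/D lies in F_p; for b = 0 they become so once the m-th
   coefficient is multiplied by m. After dividing indices by powers of p (and keeping
   only indices prime to p if b = 0) all these series are therefore eigenvectors with
   the same eigenvalues, hence multiples of one and the same phi. *)

(** * Laurent series *)

(** At t = 0 all q_l coincide with x and S_1, ..., S_(p-1) vanish, as wanted; but with finite q'_l
    every delta S_j would depend there on the single number sum_l q'_l, so these values could not be
    prescribed separately. The poles of the q'_l remove this obstacle: since l^p = l, q_l^p is x^p +
    l t^p, and the moments sum_l q_l^(pj) q'_l, j < p, can take any values at t = 0.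

    The values needed are not all 0. Besides its part linear in q', delta S_j contains (S_j(q^p) -
    S_j(q)^p)/p, which at q_l = x is (-1)^(j-1) x^(pj)/j for j < p; the moment of index j-1 must be
    -x^(pj)/j to cancel it.

    phi is written down from the eigenvalues alone; that f is not constant enters when phi is shown
    to be an eigenvector. c_i is the coefficient of q^(p^i) in f(q,0), and e_i that of q^(p^(i+1))
    (q'/q^p)^(p^i). Comparing coefficients of q^(p^i) in the eigenvalue equation at p gives e_i =
    p^kappa c_(i-1) - lambda_p c_i, which is the shape of the sharp series; as f is polynomial in
    q', e_i = 0 for large i. *)

Section LaurentTheory.
Variable A : comNzRingType.
Implicit Types (f g : {laurent A}) (m n : int).

Lemma lcoef0 m : (0 : {laurent A}) m = 0.
Proof. by rewrite /= if_same. Qed.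

Lemma lcoefD f g m : (f + g) m = f m + g m.
Proof. by []. Qed.

Lemma lcoefN f m : (- f) m = - f m.
Proof. by []. Qed.

Lemma lcoefB f g m : (f - g) m = f m - g m.
Proof. by []. Qed.

Lemma lcoef_sum (I : Type) (r : seq I) (P : pred I) (F : I -> {laurent A}) m :
  (\sum_(i <- r | P i) F i) m = \sum_(i <- r | P i) F i m.
Proof.
by rewrite (big_morph (fun f : {laurent A} => f m) (fun f g => lcoefD f g m) (lcoef0 m)).
Qed.

Lemma lcoefMn f (n : nat) m : (f *+ n) m = f m *+ n.
Proof. by elim: n => [|n IH]; rewrite ?mulr0n ?lcoef0 // !mulrS lcoefD IH. Qed.

Lemma lmono_coef (a : A) m n : lmono a m n = if n == m then a else 0.
Proof. by []. Qed.

Lemma lmono0 m : lmono 0 m = 0 :> {laurent A}.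
Proof. by apply: laurentP => i; rewrite lcoef0 /= if_same. Qed.

Lemma lmonoMl (a : A) m f n : (lmono a m * f) n = a * f (n - m).
Proof. exact: lmonoE. Qed.

Lemma lmonoM (a b : A) m n : lmono a m * lmono b n = lmono (a * b) (m + n).
Proof.
apply: laurentP => i; rewrite lmonoMl !lmono_coef subr_eq [n + m]addrC.
by case: ifP; rewrite ?mulr0.
Qed.

Lemma lconst_zmod : zmod_morphism (@lconst A).
Proof.
move=> a b; apply: laurentP => i; rewrite lcoefB !lmono_coef.
by case: ifP; rewrite ?subr0.
Qed.
HB.instance Definition _ :=
  GRing.isZmodMorphism.Build A {laurent A} (@lconst A) lconst_zmod.

Lemma lconst_monoid : monoid_morphism (@lconst A).
Proof. by split=> [//|a b]; rewrite /lconst lmonoM addr0. Qed.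
HB.instance Definition _ :=
  GRing.isMonoidMorphism.Build A {laurent A} (@lconst A) lconst_monoid.

Lemma lconstMl (a : A) f n : (lconst a * f) n = a * f n.
Proof. by rewrite lmonoMl subr0. Qed.

Lemma lmonoX (a : A) m (e : nat) : lmono a m ^+ e = lmono (a ^+ e) (m * e%:Z).
Proof.
elim: e => [|e IH]; first by rewrite mulr0.
by rewrite !exprS IH lmonoM intS mulrDr mulr1.
Qed.

(** [lbounded 0] expresses integrality in t, and the coefficient of index 0 is then the value at t =
    0. *)
Lemma lint_sum (I : Type) (r : seq I) (P : pred I) (F : I -> {laurent A}) :
  (forall i, P i -> lbounded 0 (F i)) -> lbounded 0 (\sum_(i <- r | P i) F i).
Proof. by move=> FP m m0; rewrite lcoef_sum big1 // => i /FP; apply. Qed.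

Lemma lint_mono (a : A) m : 0 <= m -> lbounded 0 (lmono a m).
Proof.
by move=> m0 n n0; rewrite lmono_coef; case: eqP n0 => // ->; rewrite ltNge m0.
Qed.

Lemma lintM f g : lbounded 0 f -> lbounded 0 g -> lbounded 0 (f * g).
Proof. by move=> f0 g0; have := lmulc_lt f0 g0; rewrite addr0. Qed.

Lemma lint_coefM f g : lbounded 0 f -> lbounded 0 g -> (f * g) 0 = f 0 * g 0.
Proof.
move=> f0 g0; have /= := lmulcE 0 f0 g0; rewrite !addr0 => ->.
by rewrite coefM big_ord1 /= !coef_poly /= !addr0.
Qed.

Lemma lintX f e : lbounded 0 f -> lbounded 0 (f ^+ e) /\ (f ^+ e) 0 = f 0 ^+ e.
Proof.
move=> f0; elim: e => [|e [IH1 IH2]]; first by split; first exact: lint_mono.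
by rewrite exprS; split; [apply: lintM | rewrite lint_coefM // IH2 exprS].
Qed.

Lemma lint_prod (I : Type) (r : seq I) (F : I -> {laurent A}) :
    (forall i, lbounded 0 (F i)) ->
  lbounded 0 (\prod_(i <- r) F i) /\ (\prod_(i <- r) F i) 0 = \prod_(i <- r) F i 0.
Proof.
move=> FP; elim: r => [|i r [IH1 IH2]].
  by rewrite !big_nil; split; first exact: lint_mono.
by rewrite !big_cons; split; [apply: lintM | rewrite lint_coefM // IH2].
Qed.

Lemma lint_mmap (K : comNzRingType) (n : nat) (c : {rmorphism K -> A}) (v : 'I_n -> {laurent A})
    (P : {mpoly K[n]}) : (forall i, lbounded 0 (v i)) ->
  lbounded 0 (mmap (@lconst A \o c) v P) /\
  mmap (@lconst A \o c) v P 0 = mmap c (fun i => v i 0) P.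
Proof.
move=> vP; rewrite /mmap.
have mP (m : 'X_{1..n}) : lbounded 0 (mmap1 v m) /\ mmap1 v m 0 = mmap1 (fun i => v i 0) m.
  rewrite /mmap1; have [|h1 h2] := @lint_prod _ (index_enum 'I_n) (fun i => v i ^+ m i).
    by move=> i; case: (lintX (m i) (vP i)).
  split=> //; rewrite h2; apply: eq_bigr => i _; by case: (lintX (m i) (vP i)).
split.
  by apply: lint_sum => m _; apply: lintM; [apply: lint_mono | case: (mP m)].
by rewrite lcoef_sum; apply: eq_bigr => m _; rewrite lconstMl; case: (mP m) => _ ->.
Qed.
End LaurentTheory.

(** * Elementary symmetric functions *)

(** The generating polynomial of the elementary symmetric functions of a; omitting a variable
    becomes division by one linear factor. *)
Definition esym_gen (C : comNzRingType) n (a : 'I_n -> C) : {poly C} :=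
  \prod_(l < n) (1 + a l *: 'X).

Lemma mmap_mesym (K C : comNzRingType) n (c : {rmorphism K -> C}) (a : 'I_n -> C) i :
  mmap c a (mesym n K i) = (esym_gen a)`_i.
Proof.
rewrite /mesym rmorph_sum /esym_gen /=.
have -> : \prod_(l < n) (1 + a l *: 'X) = \prod_(l < n) (a l *: 'X + 1) :> {poly C}.
  by apply: eq_bigr => l _; rewrite addrC.
rewrite bigA_distr coef_sum big_mkcond /=; apply: eq_bigr => J _.
rewrite rmorph_prod /= (eq_bigr a) => [|l _]; last by rewrite mmapX mmap1U.
have -> : \prod_(l < n) (if l \in J then a l *: 'X else 1)
   = (\prod_(l in J) a l) *: 'X^(#|J|) :> {poly C}.
  rewrite -big_mkcond /= -prodr_const scaler_prod //.
by rewrite coefZ coefXn eq_sym; case: eqP; rewrite ?mulr1 ?mulr0.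
Qed.

(** First-order expansion in p, applied to the factors 1 + (q_l^p + p q'_l) X: once divided by p,
    the last term is a multiple of p. *)
Lemma prod_add_sq (C : comNzRingType) (I : eqType) (s : seq I) (u v : I -> C) (p : nat) :
  uniq s -> exists w, \prod_(l <- s) (u l + v l *+ p)
    = \prod_(l <- s) u l
      + (\sum_(l <- s) v l * \prod_(m <- s | m != l) u m) *+ p + w *+ p ^ 2.
Proof.
elim: s => [|x s IH] /= => [_|/andP[xs /IH[w Ew]]].
  by exists 0; rewrite !big_nil !mul0rn !addr0.
set P := \prod_(l <- s) u l in Ew *.
set D := \sum_(l <- s) _ in Ew *.
exists (u x * w + v x * D + v x * w *+ p); rewrite !big_cons Ew -/P.
rewrite eqxx /=.
have -> : \prod_(m <- s | m != x) u m = P.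
  by rewrite big_seq_cond [RHS]big_seq_cond; apply: eq_bigl => m; case: eqP xs => [->|_];
    rewrite ?andbT // andbF => /negPf->.
have -> : \sum_(j <- s) v j * \prod_(m <- x :: s | m != j) u m = u x * D.
  rewrite mulr_sumr big_seq [RHS]big_seq; apply: eq_bigr => l ls.
  have xl : x != l by apply: contraNneq xs => ->.
  by rewrite big_cons xl mulrCA.
rewrite expnS expn1 !mulrnA; ring.
Qed.

Lemma exprD_prime (C : comNzRingType) (p : nat) (x y : C) : prime p ->
  exists w, (x + y) ^+ p = x ^+ p + y ^+ p + w *+ p.
Proof.
move=> pp; case: p pp => [//|p] pp.
exists (\sum_(i < p) (x ^+ (p.+1 - bump 0 i) * y ^+ bump 0 i) *+ ('C(p.+1, bump 0 i) %/ p.+1)).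
rewrite exprDn big_ord_recl big_ord_recr /= bin0 subn0 expr0 mulr1 mulr1n.
rewrite /bump /= !add1n binn subnn expr0 mul1r mulr1n -addrA; congr (_ + _).
rewrite addrC; congr (_ + _); rewrite -sumrMnl; apply: eq_bigr => i _.
by rewrite -mulrnA divnK // prime_dvd_bin //= add1n ltnS ltn_ord.
Qed.

Lemma sum_expr_prime (C : comNzRingType) (p : nat) (I : Type) (s : seq I) (P : pred I)
    (x : I -> C) : prime p ->
  exists w, \sum_(i <- s | P i) x i ^+ p = (\sum_(i <- s | P i) x i) ^+ p + w *+ p.
Proof.
move=> pp; elim: s => [|i s [w IH]].
  by exists 0; rewrite !big_nil expr0n eqn0Ngt prime_gt0 // mul0rn addr0.
rewrite !big_cons; case: ifP => _; last by exists w.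
have [z Ez] := exprD_prime (x i) (\sum_(j <- s | P j) x j) pp.
by exists (w - z); rewrite IH Ez mulrnBl; ring.
Qed.

Lemma map_divz_mpoly (n p : nat) (D : {mpoly int[n]}) : (0 < p)%N ->
  map_mpoly (fun z => (z %/ p%:Z)%Z) (D *+ p) = D.
Proof.
move=> p0; rewrite /map_mpoly /mmap [RHS]mpolyE.
have DE : perm_eq (msupp (D *+ p)) (msupp D).
  apply: uniq_perm => // m; rewrite !mcoeff_msupp mcoeffMn.
  by rewrite -mulr_natr mulf_eq0 pnatr_eq0 (gtn_eqF p0) orbF.
rewrite (perm_big _ DE).
apply: eq_bigr => m _; rewrite mcoeffMn -mulr_natr natz.
by rewrite /= mulzK ?mul_mpolyC ?mmap1_id ?gt_eqF.
Qed.

Lemma mmap_eq (K C : nzRingType) n (c : K -> C) (v v' : 'I_n -> C) (P : {mpoly K[n]}) :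
  v =1 v' -> mmap c v P = mmap c v' P.
Proof. by move=> vv; apply: eq_bigr => m _; congr (_ * _); apply: mmap1_eq. Qed.

Lemma comp_mpoly_mmap (K C : comNzRingType) n m (c : {rmorphism K -> C}) (v : 'I_m -> C)
    (P : {mpoly K[n]}) (t : n.-tuple {mpoly K[m]}) :
  mmap c v (P \mPo t) = mmap c (fun i => mmap c v (tnth t i)) P.
Proof.
rewrite comp_mpolyE rmorph_sum; apply: eq_bigr => u _ /=.
by rewrite mmapZ rmorph_prod; congr (_ * _); apply: eq_bigr => i _; rewrite rmorphXn.
Qed.

(** * delta S_j modulo p *)

Section DeltaSym.
Variables (p : nat) (p_prime : prime p).

(** D is the carry of S_(i+1), the failure of Frobenius on the variables to commute with the p-th
    power. It is the part of delta S_(i+1) free of q'; the linear part comes from [prod_add_sq]. *)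
Lemma delta_symP (i : 'I_p) : exists D : {mpoly int[p]},
  mesym p int i.+1 \mPo [tuple 'X_l ^+ p | l < p] = mesym p int i.+1 ^+ p + D *+ p
  /\ exists w, delta_sym i = D \mPo [tuple 'X_(lshift p l) | l < p]
    + \sum_(l < p) 'X_(rshift p l) *
        (\prod_(m < p | m != l) (1 + 'X_(lshift p m) ^+ p *: 'X))`_i
    + w *+ p.
Proof.
pose x (h : {set 'I_p}) : {mpoly int[p]} := \prod_(l in h) 'X_l.
have [D ED] := sum_expr_prime (index_enum {set 'I_p}) (fun h => #|h| == i.+1) x p_prime.
exists D.
have E1 : mesym p int i.+1 \mPo [tuple 'X_l ^+ p | l < p] = mesym p int i.+1 ^+ p + D *+ p.
  rewrite /mesym -ED rmorph_sum; apply: eq_bigr => h _ /=.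
  rewrite rmorph_prod /x -prodrXl; apply: eq_bigr => l _ /=.
  by rewrite comp_mpolyXU -tnth_nth tnth_mktuple.
split=> //.
pose a (l : 'I_p) : {mpoly int[p+p]} := 'X_(lshift p l) ^+ p.
pose b (l : 'I_p) : {mpoly int[p+p]} := 'X_(rshift p l).
pose C := [the comNzRingType of {poly {mpoly int[p+p]}}].
have [w Ew] := @prod_add_sq C _ (index_enum 'I_p)
  (fun l => 1 + a l *: 'X) (fun l => b l *: 'X) p (index_enum_uniq _).
have phiE : symq_phi i = (esym_gen (fun l => a l + b l *+ p))`_i.+1.
  rewrite /symq_phi -(mmap_mesym (@mpolyC (p+p) int)) /comp_mpoly.
  by apply: mmap_eq => l; rewrite tnth_mktuple.
have aE : (esym_gen a)`_i.+1 = symq i ^+ p + (D \mPo [tuple 'X_(lshift p l) | l < p]) *+ p.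
  rewrite -(mmap_mesym (@mpolyC (p+p) int)) /symq -rmorphXn -rmorphMn -rmorphD /= -E1.
  apply: (etrans _ (esym (comp_mpoly_mmap _ _ _ _))).
  apply: mmap_eq => l.
  by rewrite tnth_mktuple rmorphXn /= mmapX mmap1U tnth_mktuple.
exists (w`_i.+1); rewrite /delta_sym phiE.
have -> : esym_gen (fun l => a l + b l *+ p) = \prod_(l < p) (1 + a l *: 'X + b l *: 'X *+ p).
  by apply: eq_bigr => l _; rewrite scalerDl scalerMnl addrA.
rewrite Ew !coefD aE !coefMn coef_sum.
rewrite (eq_bigr (fun l => b l * (\prod_(m < p | m != l) (1 + a m *: 'X))`_i)); last first.
  by move=> l _; rewrite -scalerAl coefZ coefXM.
rewrite -/(a _) expnS expn1 mulrnA.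
set X1 := D \mPo _; set X2 := \sum_(l <- _) _; set X3 := w`_i.+1; set X4 := symq i ^+ p.
have -> : X4 + X1 *+ p + X2 *+ p + X3 *+ p *+ p - X4 = (X1 + X2 + X3 *+ p) *+ p.
  by ring.
by rewrite map_divz_mpoly ?prime_gt0.
Qed.
End DeltaSym.

Lemma esym_gen0 (C : comNzRingType) n (a : 'I_n -> C) : (esym_gen a)`_0 = 1.
Proof.
by rewrite -(mmap_mesym intr) mesym0E rmorph1.
Qed.

(** Division of [esym_gen a] by 1 + a_l X, that is, multiplication by a geometric series. *)
Lemma esym_gen_omit (C : comNzRingType) n (a : 'I_n -> C) l i :
  (\prod_(m < n | m != l) (1 + a m *: 'X))`_i
    = \sum_(j < i.+1) (- a l) ^+ j * (esym_gen a)`_(i - j).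
Proof.
set E := \prod_(m < n | _) _.
have aE : esym_gen a = (1 + a l *: 'X) * E by rewrite /esym_gen (bigD1 l).
have E0 : E`_0 = 1.
  by rewrite -(esym_gen0 a) aE mulrDl mul1r coefD -scalerAl coefZ coefXM mulr0 addr0.
elim: i => [|i IH]; first by rewrite big_ord1 subn0 expr0 mul1r esym_gen0.
rewrite big_ord_recl subn0 expr0 mul1r.
have -> : (esym_gen a)`_i.+1 = E`_i.+1 + a l * E`_i.
  by rewrite aE mulrDl mul1r coefD -scalerAl coefZ coefXM.
rewrite (eq_bigr (fun j : 'I_i.+1 => - a l * ((- a l) ^+ j * (esym_gen a)`_(i - j)))).
  by rewrite -mulr_sumr -IH mulNr addrK.
by move=> j _; rewrite lift0 exprS subSS mulrA.
Qed.

Lemma esym_gen_map (C C' : comNzRingType) n (f : {rmorphism C -> C'}) (a : 'I_n -> C) i :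
  (esym_gen (fun l => f (a l)))`_i = f (esym_gen a)`_i.
Proof.
rewrite -coef_map; suff -> : esym_gen (fun l => f (a l)) = map_poly f (esym_gen a) by [].
rewrite /esym_gen rmorph_prod; apply: eq_bigr => l _ /=.
by rewrite rmorphD rmorph1 /= map_polyZ map_polyX.
Qed.

Lemma esym_gen_exp_char (C : comNzRingType) p n (a : 'I_n -> C) i :
  p \in [pchar C] -> (esym_gen (fun l => a l ^+ p))`_i = (esym_gen a)`_i ^+ p.
Proof. by move=> pC; apply: (esym_gen_map (pFrobenius_aut pC)). Qed.

Lemma mmap_map_mpoly (K K' C : comNzRingType) n (f : {rmorphism K -> K'})
    (c : {rmorphism K' -> C}) (c' : {rmorphism K -> C}) (v : 'I_n -> C) (P : {mpoly K[n]}) :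
  (forall x, c (f x) = c' x) -> mmap c v (map_mpoly f P) = mmap c' v P.
Proof.
move=> cf; elim/mpolyind: P => [|a m P _ _ IH]; first by rewrite !rmorph0.
by rewrite !rmorphD /= IH map_mpolyZ map_mpolyX !mmapZ !mmapX cf.
Qed.

Lemma mmap_symq (p : nat) (C : comNzRingType) (v : 'I_(p + p) -> C) (i : 'I_p) :
  mmap intr v (symq i) = (esym_gen (fun l : 'I_p => v (lshift p l)))`_i.+1.
Proof.
rewrite comp_mpoly_mmap -(mmap_mesym intr); apply: mmap_eq => l.
by rewrite tnth_mktuple mmapX mmap1U.
Qed.

(* Modulo p, [delta S_i] is affine in the q'_l with linear coefficients
   (dS_i/dq_l)^p, and dS_(i+1)/dq_l = sum_j (-q_l)^j S_(i-j). *)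
Lemma mmap_delta_sym (p : nat) (i : 'I_p) : prime p -> exists D : {mpoly int[p]},
  mesym p int i.+1 \mPo [tuple 'X_l ^+ p | l < p] = mesym p int i.+1 ^+ p + D *+ p
  /\ forall (C : comNzRingType) (v : 'I_(p + p) -> C), p \in [pchar C] ->
    mmap intr v (delta_sym i) = mmap intr (fun l => v (lshift p l)) D
     + \sum_(j < i.+1) (-1) ^+ j * (esym_gen (fun l => v (lshift p l)))`_(i - j) ^+ p
        * \sum_(l < p) (v (lshift p l) ^+ p) ^+ j * v (rshift p l).
Proof.
move=> pp; have [D [ED [w Ew]]] := delta_symP pp i.
exists D; split=> // C v pC; rewrite Ew !rmorphD rmorphMn /= -mulr_natr.
rewrite (pcharf0 pC) mulr0 addr0; congr (_ + _).
  rewrite comp_mpoly_mmap; apply: mmap_eq => l.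
  by rewrite tnth_mktuple mmapX mmap1U.
rewrite rmorph_sum /=.
under eq_bigr => l _.
  rewrite rmorphM /= mmapX mmap1U esym_gen_omit rmorph_sum mulr_sumr /=.
  over.
rewrite exchange_big; apply: eq_bigr => j _ /=; rewrite mulr_sumr.
apply: eq_bigr => l _; rewrite rmorphM rmorphXn rmorphN rmorphXn /= mmapX mmap1U.
rewrite -(esym_gen_map (mmap intr v)) /=.
under [X in esym_gen X]funext => m do rewrite rmorphXn /= mmapX mmap1U.
rewrite esym_gen_exp_char // [(- v _ ^+ p) ^+ j]exprNn.
move: (_ ^+ j) (_ ^+ p) => X Y; ring.
Qed.

Lemma mmap_sym_monomial (p : nat) (C : comNzRingType) (k : fieldType) (c : {rmorphism k -> C})
    (v : 'I_(p + p) -> C) (a : 'X_{1..p + p}) :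
  mmap c v (sym_monomial k a) = \prod_(i < p)
     (mmap intr v (symq i) ^+ a (lshift p i) * mmap intr v (delta_sym i) ^+ a (rshift p i)).
Proof.
rewrite /sym_monomial rmorph_prod; apply: eq_bigr => i _.
rewrite rmorphM !rmorphXn /= !(mmap_map_mpoly (c' := intr)) // => x; exact: rmorph_int.
Qed.

(** * Weight grading *)

Section Weight.
Variable p : nat.
Implicit Types m a : 'X_{1..p + p}.

Definition qweight m : nat :=
  (\sum_(l < p) (m (lshift p l) + p * m (rshift p l)))%N.

(** s_j and s'_j get the weights j and pj that S_j and delta S_j have for [qweight]. *)
Definition sweight a : nat :=
  (\sum_(i < p) (i.+1 * a (lshift p i) + p * i.+1 * a (rshift p i)))%N.

Lemma qweight0 : qweight 0%MM = 0%N.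
Proof. by rewrite /qweight big1 // => l _; rewrite !mnm0E muln0. Qed.

Lemma qweightD : {morph qweight : m n / (m + n)%MM >-> (m + n)%N}.
Proof.
move=> m n; rewrite /qweight -big_split /=; apply: eq_bigr => l _.
by rewrite !mnmDE mulnDr addnACA.
Qed.
HB.instance Definition _ := isMeasure.Build (p + p) qweight qweight0 qweightD.

(** Leaves finitely many exponents of each weight, so that the infinite family h enters
    [weight_identity] through a finite sum. *)
Lemma mdeg_le_sweight a : (0 < p)%N -> (mdeg a <= sweight a)%N.
Proof.
move=> p0; rewrite mdegE big_split_ord /= -big_split leq_sum // => i _ /=.
by apply: leq_add; apply: leq_pmull; rewrite ?muln_gt0 ?p0.
Qed.

Lemma split_ord_neq (l l' : 'I_p) : (lshift p l == rshift p l') = false.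
Proof. by apply/eqP => /(congr1 val) /=; have := ltn_ord l; lia. Qed.

Lemma split_ord_neq' (l l' : 'I_p) : (rshift p l' == lshift p l) = false.
Proof. by rewrite eq_sym split_ord_neq. Qed.

Lemma qweight_pair (l : 'I_p) (a b : nat) :
  qweight (U_(lshift p l) *+ a + U_(rshift p l) *+ b)%MM = (a + p * b)%N.
Proof.
rewrite /qweight (bigD1 l) //= !mnmDE !mulmnE !mnm1E !eqxx !split_ord_neq !split_ord_neq' big1
  => [|i il].
  by rewrite /= !mul1n !mul0n !addn0 !add0n.
rewrite !mnmDE !mulmnE !mnm1E !split_ord_neq !split_ord_neq'
  (inj_eq (@lshift_inj _ _)) (inj_eq (@rshift_inj _ _)).
by rewrite [l == i]eq_sym (negPf il) /= !mul0n muln0.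
Qed.

Variable R : nzRingType.

Lemma dhomog_bigprod (mf : measure (p + p)) (I : Type) (r : seq I) (P : pred I)
    (F : I -> {mpoly R[p + p]}) (e : I -> nat) :
  (forall i, P i -> F i \is (e i).-homog for mf) ->
  \prod_(i <- r | P i) F i \is (\sum_(i <- r | P i) e i)%N.-homog for mf.
Proof.
move=> FP; elim: r => [|i r IH]; first by rewrite !big_nil dhomog1.
by rewrite !big_cons; case: ifP => // Pi; apply: dhomogM; rewrite // FP.
Qed.

End Weight.

Section WeightHomog.
Variables (p : nat) (p_prime : prime p) (k : fieldType).
Implicit Types m a : 'X_{1..p + p}.

Lemma dhomog_mesym_comp (t : p.-tuple {mpoly int[p + p]}) d i :
  (forall l, tnth t l \is d.-homog for (@qweight p)) ->
  mesym p int i \mPo t \is (d * i).-homog for (@qweight p).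
Proof.
move=> th; rewrite /mesym rmorph_sum; apply: rpred_sum => h /eqP hi /=.
rewrite rmorph_prod -hi mulnC -sum_nat_const; apply: dhomog_bigprod => l _ /=.
by rewrite comp_mpolyXU -tnth_nth.
Qed.

Lemma dhomog_map (K K' : nzRingType) (g : {rmorphism K -> K'}) d (P : {mpoly K[p + p]}) :
  P \is d.-homog for (@qweight p) -> map_mpoly g P \is d.-homog for (@qweight p).
Proof.
move=> /dhomogP Pd; apply/dhomogP => m; rewrite mcoeff_msupp mcoeff_map_mpoly => gm.
by apply: Pd; rewrite mcoeff_msupp; apply: contraNneq gm => ->; rewrite raddf0.
Qed.

Lemma qweightUl (l : 'I_p) : qweight U_(lshift p l)%MM = 1%N.
Proof.
have := qweight_pair l 1 0; rewrite mulm1n mulm0n addm0 => ->; lia.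
Qed.

Lemma qweightUr (l : 'I_p) : qweight U_(rshift p l)%MM = p.
Proof.
have := qweight_pair l 0 1; rewrite mulm1n mulm0n add0m => ->; lia.
Qed.

Lemma dhomog_symq (i : 'I_p) : symq i \is i.+1.-homog for (@qweight p).
Proof.
rewrite -[i.+1]mul1n; apply: dhomog_mesym_comp => l.
by rewrite tnth_mktuple dhomogX /= qweightUl.
Qed.

Lemma dhomog_delta_sym (i : 'I_p) : delta_sym i \is (p * i.+1).-homog for (@qweight p).
Proof.
have p0 := prime_gt0 p_prime.
have H : symq_phi i - symq i ^+ p \is (p * i.+1).-homog for (@qweight p).
  apply: rpredB; last by rewrite mulnC; apply/dhomogMn/dhomog_symq.
  apply: dhomog_mesym_comp => l; rewrite tnth_mktuple; apply: rpredD.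
    have := @dhomogMn _ _ (@qweight p) 1 ('X_(lshift p l) : {mpoly int[p + p]}) p.
    by rewrite mul1n; apply; rewrite dhomogX /= qweightUl.
  by apply: rpredMn; rewrite dhomogX /= qweightUr.
rewrite /delta_sym; set P := (_ - _) in H *.
(* The sum runs over the support of the undivided polynomial, where all exponents have the right
   weight. *)
rewrite /map_mpoly /mmap big_seq; apply: rpred_sum => m mP /=.
rewrite mmap1_id mul_mpolyC; apply: rpredZ; rewrite dhomogX /=.
by apply/eqP; move/dhomogP: H; apply.
Qed.

Lemma dhomog_sym_monomial a : sym_monomial k a \is (sweight a).-homog for (@qweight p).
Proof.
apply: dhomog_bigprod => i _; apply: dhomogM; apply: dhomogMn; apply: dhomog_map.
  exact: dhomog_symq.
exact: dhomog_delta_sym.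
Qed.

Variables (f : {poly {laurent k}}) (h : 'X_{1..p + p} -> k).
Hypothesis hP : sym_subst h =1 Sigma_p f.

Lemma sym_subst_weight w m : qweight m = w ->
  sym_subst h m =
    \sum_(a : 'X_{1..(p + p) < w.+1} | sweight a == w) h a * (sym_monomial k a)@_m.
Proof.
move=> mw;
pose s := map (@bmnm (p + p) w.+1) (index_enum _).
rewrite /sym_subst (fsbigE s) //=.
- rewrite big_map /= [LHS](bigID (fun a : 'X_{1..(p + p) < w.+1} => sweight a == w)) /=.
  rewrite [X in _ + X]big1 ?addr0 => [|a /andP[_ aw]].
    by apply: eq_bigl => a; rewrite in_setT.
  by rewrite (dhomog_nemf_coeff (dhomog_sym_monomial a)) ?mulr0 //= mw eq_sym.
- by rewrite map_inj_uniq ?index_enum_uniq //; apply: val_inj.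
move=> a _ /negP as_; apply/eqP; rewrite mulf_eq0; apply/orP; right; apply/eqP.
apply: (dhomog_nemf_coeff (dhomog_sym_monomial a)); apply: contra_notN as_ => /eqP /= aw.
have aw1 : (mdeg a < w.+1)%N.
  by rewrite ltnS -mw aw; apply: mdeg_le_sweight; apply: prime_gt0.
by apply/mapP; exists (BMultinom aw1); rewrite ?mem_index_enum.
Qed.

Lemma weight_identity w :
  \sum_(l < p) \sum_(b < (w %/ p).+1) (f`_b : {laurent k}) (w - p * b)%N%:Z *:
     ('X_(lshift p l) ^+ (w - p * b) * 'X_(rshift p l) ^+ b)
  = \sum_(a : 'X_{1..(p + p) < w.+1} | sweight a == w) h a *: sym_monomial k a.
Proof.
have p0 := prime_gt0 p_prime.
apply/mpolyP => m; rewrite !raddf_sum /=.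
have wb (b : 'I_(w %/ p).+1) : (p * b <= w)%N.
  by rewrite mulnC -leq_divRL // -ltnS.
have E (l : 'I_p) (a b : nat) : 'X_(lshift p l) ^+ a * 'X_(rshift p l) ^+ b
    = 'X_[U_(lshift p l) *+ a + U_(rshift p l) *+ b] :> {mpoly k[p + p]}.
  by rewrite mpolyXD -!mpolyXn.
have [mw|mw] := eqVneq (qweight m) w; last first.
  rewrite !big1 //= => [a /eqP aw|l _].
    by rewrite mcoeffZ (dhomog_nemf_coeff (dhomog_sym_monomial a)) ?mulr0 //= aw.
  rewrite raddf_sum big1 //= => b _; rewrite mcoeffZ E mcoeffX.
  case: eqP => [bm|]; rewrite ?mulr0 //; case/eqP: mw.
  by rewrite -bm qweight_pair subnK.
transitivity (Sigma_p f m); last first.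
  rewrite -hP (sym_subst_weight mw); apply: eq_bigr => a _.
  by rewrite mcoeffZ.
apply: eq_bigr => l _; rewrite raddf_sum /=.
case: eqP => [mE|mE].
  have mlw : (m (lshift p l) + p * m (rshift p l))%N = w.
    by rewrite -mw {3}mE qweight_pair.
  have mlb : (m (rshift p l) < (w %/ p).+1)%N.
    by rewrite ltnS leq_divRL // -mlw mulnC leq_addl.
  rewrite (bigD1 (Ordinal mlb)) //= big1 => [|b bm].
    by rewrite mcoeffZ E -mlw addnK mcoeffX -mE eqxx mulr1 addr0.
  rewrite mcoeffZ E mcoeffX; case: eqP => [/(congr1 (fun m : 'X_{1..p + p} => m (rshift p l)))|];
    rewrite ?mulr0 //.
  rewrite !mnmDE !mulmnE !mnm1E eqxx split_ord_neq /= mul0n mul1n add0n => bE.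
  by case/eqP: bm; apply: val_inj.
rewrite big1 // => b _; rewrite mcoeffZ E mcoeffX.
case: eqP => [bE|]; rewrite ?mulr0 //; case: mE.
rewrite -bE !mnmDE !mulmnE !mnm1E !eqxx split_ord_neq split_ord_neq' /=.
by rewrite !mul0n !mul1n addn0 add0n.
Qed.
End WeightHomog.

(** * Evaluation at arithmetic progressions *)

(** Telescoping (l+1)^(s+1) - l^(s+1) expresses p^(s+1) through the power sums of exponent at most
    s; the last one has coefficient s+1, prime to p, and the others are divisible by p by
    induction. *)
Lemma power_sum_dvdn p s : prime p -> (s < p.-1)%N -> (p %| \sum_(l < p) l ^ s)%N.
Proof.
move=> pp; elim/ltn_ind: s => s IH sp.
have E : (\sum_(i < s.+1) 'C(s.+1, i) * \sum_(l < p) l ^ i = p ^ s.+1)%N.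
  under eq_bigr do rewrite big_distrr /=.
  rewrite exchange_big /=; elim: (p) => [|n IHn]; first by rewrite big_ord0 exp0n.
  rewrite big_ord_recr /= IHn -[in RHS]add1n expnDn [in RHS]big_ord_recr /=.
  rewrite binn subnn !mul1n addnC; congr (_ + _)%N.
  by apply: eq_bigr => i _; rewrite exp1n mul1n.
have p0 := prime_gt0 pp.
have : (p %| p ^ s.+1)%N by rewrite dvdn_exp.
rewrite -E big_ord_recr /= dvdn_addr; last first.
  apply: dvdn_sum => i _; apply: dvdn_mull; apply: IH; have := ltn_ord i; lia.
rewrite binSn Euclid_dvdM // => /orP[/dvdn_leq|//]; lia.
Qed.

(** By Fermat each l other than 0 contributes 1, hence p-1 in total. *)
Lemma power_sum_pred p : prime p -> (p %| (\sum_(l < p) l ^ p.-1).+1)%N.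
Proof.
move=> pp; have p0 := prime_gt0 pp; have p1 := prime_gt1 pp.
rewrite /dvdn; apply/eqP.
rewrite -addn1 -modnDml -modn_summ.
rewrite (eq_bigr (fun l : 'I_p => (l != 0 :> nat) : nat)) => [|l _]; last first.
  have [->|l0] := eqVneq (l : nat) 0%N.
    by rewrite exp0n ?mod0n // -ltnS prednK.
  have lp : (0 < l)%N by rewrite lt0n.
  have : (p %| l ^ p - l ^ 1)%N.
    by rewrite -eqn_mod_dvd ?leq_pexp2l //; apply/eqP; rewrite expn1 fermat_little.
  have -> : (l ^ p - l ^ 1 = l * (l ^ p.-1 - 1))%N.
    by rewrite mulnBr muln1 -expnS prednK.
  rewrite Euclid_dvdM // => /orP[/(dvdn_leq lp)|]; first by have := ltn_ord l; lia.
  by rewrite -eqn_mod_dvd ?expn_gt0 ?lp // => /eqP ->; rewrite modn_small.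
have E q : (0 < q)%N -> (\sum_(l < q) ((l : nat) != 0 : nat) = q.-1)%N.
  by case: q => // q _; rewrite big_ord_recl /= add0n sum1_card card_ord.
by rewrite modnDml E // addn1 prednK // modnn.
Qed.

Section PowerSumsChar.
Variables (p : nat) (C : comNzRingType) (pC : p \in [pchar C]).

Let p_prime : prime p. Proof. by case/andP: pC. Qed.

Lemma natr_exp_char l : (l%:R : C) ^+ p = l%:R.
Proof. exact: (pFrobenius_aut_nat pC). Qed.

Lemma power_sum0 s : (s < p.-1)%N -> \sum_(l < p) (l%:R : C) ^+ s = 0.
Proof.
move=> /(power_sum_dvdn p_prime); rewrite (dvdn_pcharf pC) natr_sum => /eqP E.
by rewrite -[RHS]E; apply: eq_bigr => l _; rewrite natrX.
Qed.

Lemma power_sum1 : \sum_(l < p) (l%:R : C) ^+ p.-1 = -1.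
Proof.
have := power_sum_pred p_prime; rewrite (dvdn_pcharf pC) -addn1 natrD natr_sum.
rewrite addr_eq0 => /eqP E; rewrite -[RHS]E.
by apply: eq_bigr => l _; rewrite natrX.
Qed.
End PowerSumsChar.

Section Specialization.
Variables (p : nat) (p_prime : prime p) (p_odd : odd p).
Variables (A : idomainType) (pA : p \in [pchar A]) (x : A) (mu : nat -> A).

Lemma laurent_pchar : p \in [pchar {laurent A}].
Proof. exact: (rmorph_pchar (@lconst A) pA). Qed.

Definition spec_q (l : 'I_p) : {laurent A} := lconst x + lmono l%:R 1.

(* The variable of [{laurent A}] plays the role of t, so [spec_dq] has poles. Its
   moments [spec_moment], the only expressions in it that enter [delta S_j], do not. *)
Definition spec_dq (l : 'I_p) : {laurent A} :=
  - \sum_(i < p) lmono (mu i * l%:R ^+ (p.-1 - i)) (- (p * i)%N%:Z).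

Definition spec_pt (i : 'I_(p + p)) : {laurent A} :=
  match fintype.split i with inl l => spec_q l | inr l => spec_dq l end.

Definition spec_moment j : {laurent A} := \sum_(l < p) (spec_q l ^+ p) ^+ j * spec_dq l.

(** The binomial transform of mu with base x^p; being triangular with unit diagonal, it can be
    prescribed for j < p. *)
Definition spec_moment0 j : A := \sum_(i < p) (x ^+ p) ^+ (j - i) * mu i *+ 'C(j, i).

Lemma spec_pt_lshift l : spec_pt (lshift p l) = spec_q l.
Proof. by rewrite /spec_pt (unsplitK (inl l)). Qed.

Lemma spec_pt_rshift l : spec_pt (rshift p l) = spec_dq l.
Proof. by rewrite /spec_pt (unsplitK (inr l)). Qed.

Lemma spec_q_exp l n : spec_q l ^+ n =
  \sum_(i < n.+1) lmono (x ^+ (n - i) * l%:R ^+ i *+ 'C(n, i)) i%:Z.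
Proof.
rewrite exprDn; apply: eq_bigr => i _; rewrite /lconst !lmonoX lmonoM.
apply: laurentP => m; rewrite lcoefMn !lmono_coef mul0r add0r mul1r.
by case: ifP; rewrite ?mul0rn.
Qed.

(** As l^p = l, Frobenius turns the progression of step t into one of step t^p with the same
    multipliers. *)
Lemma spec_q_frob l : spec_q l ^+ p = lconst (x ^+ p) + lmono l%:R p.
Proof.
have := rmorphD (pFrobenius_aut laurent_pchar) (lconst x) (lmono l%:R 1).
by rewrite /= !pFrobenius_autE /lconst !lmonoX mul0r mul1r natr_exp_char.
Qed.

Lemma spec_q_expp l n : (spec_q l ^+ p) ^+ n =
  \sum_(i < n.+1) lmono ((x ^+ p) ^+ (n - i) * l%:R ^+ i *+ 'C(n, i)) (p * i)%N%:Z.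
Proof.
rewrite spec_q_frob exprDn; apply: eq_bigr => i _; rewrite /lconst !lmonoX lmonoM.
apply: laurentP => m; rewrite lcoefMn !lmono_coef mul0r add0r.
by case: ifP; rewrite ?mul0rn.
Qed.

Lemma spec_moment_coef j m : spec_moment j m = - \sum_(i < j.+1) \sum_(i' < p)
  if m == (p * i)%N%:Z - (p * i')%N%:Z then
    ((x ^+ p) ^+ (j - i) * mu i' *+ 'C(j, i)) * \sum_(l < p) l%:R ^+ (i + (p.-1 - i')) else 0.
Proof.
have E l : (spec_q l ^+ p) ^+ j * spec_dq l = - \sum_(i < j.+1) \sum_(i' < p)
    lmono (((x ^+ p) ^+ (j - i) * mu i' *+ 'C(j, i)) * l%:R ^+ (i + (p.-1 - i')))
          ((p * i)%N%:Z - (p * i')%N%:Z).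
  rewrite spec_q_expp /spec_dq mulrN mulr_suml; congr (- _); apply: eq_bigr => i _.
  rewrite mulr_sumr; apply: eq_bigr => i' _; rewrite lmonoM; congr lmono.
  rewrite exprD !mulrnAl; congr (_ *+ _); ring.
rewrite /spec_moment (eq_bigr _ (fun l _ => E l)) sumrN lcoefN; congr (- _).
rewrite exchange_big lcoef_sum; apply: eq_bigr => i _ /=.
rewrite exchange_big lcoef_sum; apply: eq_bigr => i' _ /=.
rewrite lcoef_sum; case: ifP => mE; last by rewrite big1 // => l _; rewrite lmono_coef mE.
by rewrite mulr_sumr; apply: eq_bigr => l _; rewrite lmono_coef mE.
Qed.

(** The coefficient of t^(p(i-i')) contains the power sum of exponent p-1+i-i'. It vanishes for i <
    i', which removes the poles, and is -1 for i = i', which cancels the sign in [spec_dq]. *)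
Lemma spec_momentP j : lbounded 0 (spec_moment j) /\ spec_moment j 0 = spec_moment0 j.
Proof.
have p0 := prime_gt0 p_prime.
split=> [m m0|]; rewrite spec_moment_coef.
  rewrite big1 ?oppr0 // => i _; rewrite big1 // => i' _.
  case: eqP => // mE; rewrite power_sum0 ?mulr0 //; have := ltn_ord i'.
  by move: m0; rewrite mE subr_lt0 ltz_nat ltn_pmul2l //; lia.
rewrite exchange_big -sumrN /spec_moment0; apply: eq_bigr => i' _ /=.
have E (i : 'I_j.+1) : (0 == (p * i)%N%:Z - (p * i')%N%:Z :> int) = (i == i' :> nat).
  by rewrite eq_sym subr_eq0 eqz_nat eqn_pmul2l.
have [i'j|ji'] := ltnP i' j.+1; last first.
  rewrite bin_small // mulr0n big1 ?oppr0 // => i _; rewrite E.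
  by have := ltn_ord i; case: eqP => // ->; lia.
rewrite (bigD1 (Ordinal i'j)) // E eqxx /= subnKC; last first.
  by have := ltn_ord i'; lia.
rewrite power_sum1 // mulrN1 opprD opprK -[RHS]addr0; congr (_ + _); apply/eqP.
rewrite oppr_eq0; apply/eqP; apply: big1 => i ii'; rewrite E.
by case: eqP => // iE; case/eqP: ii'; apply: val_inj.
Qed.

Lemma spec_q_int l : lbounded 0 (spec_q l).
Proof. by move=> m m0; rewrite lcoefD !(lint_mono _ _ m0) ?addr0. Qed.

Lemma spec_q0 l : spec_q l 0 = x.
Proof. by rewrite lcoefD !lmono_coef /= addr0. Qed.

Lemma esym_gen_const n (C : comNzRingType) (y : C) i :
  (esym_gen (fun _ : 'I_n => y))`_i = y ^+ i *+ 'C(n, i).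
Proof.
rewrite /esym_gen prodr_const card_ord exprDn coef_sum.
under eq_bigr => j _ do rewrite expr1n mul1r exprZn coefMn coefZ coefXn.
have [ni|ni] := ltnP i n.+1; last first.
  rewrite bin_small // mulr0n big1 // => j _.
  by have := ltn_ord j; case: eqP => [ij|]; rewrite ?mulr0 ?mul0rn //; lia.
rewrite (bigD1 (Ordinal ni)) //= eqxx mulr1 big1 ?addr0 // => j ji.
by case: eqP => [iE|]; rewrite ?mulr0 ?mul0rn //; case/eqP: ji; apply: val_inj.
Qed.

Lemma symq_spec (i : 'I_p) : lbounded 0 (mmap intr spec_pt (symq i)) /\
  mmap intr spec_pt (symq i) 0 = if i.+1 == p then x ^+ p else 0.
Proof.
have E : mmap intr spec_pt (symq i) = mmap (@lconst A \o intr) spec_q (mesym p int i.+1).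
  rewrite mmap_symq mmap_mesym; congr (esym_gen _)`_i.+1.
  by apply/funext => l; rewrite spec_pt_lshift.
have [h1 h2] := lint_mmap intr (mesym p int i.+1) spec_q_int.
rewrite E; split=> //; rewrite h2 -/(mmap _ _ _).
rewrite (mmap_eq _ _ (v' := fun=> x)) => [|l]; last exact: spec_q0.
rewrite mmap_mesym esym_gen_const; case: eqP => [->|ip]; first by rewrite binn.
apply/eqP; rewrite -mulr_natr mulf_eq0 -(dvdn_pcharf pA) prime_dvd_bin ?orbT //.
by have := ltn_ord i; lia.
Qed.

Lemma esym_gen_spec n : lbounded 0 (esym_gen spec_q)`_n /\
  (esym_gen spec_q)`_n 0 = x ^+ n *+ 'C(p, n).
Proof.
have [h1 h2] := lint_mmap intr (mesym p int n) spec_q_int.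
rewrite -(mmap_mesym (@lconst A \o intr)); split=> //; rewrite h2.
rewrite (mmap_eq _ _ (v' := fun=> x)) => [|l]; last exact: spec_q0.
by rewrite mmap_mesym esym_gen_const.
Qed.

Lemma mmap_intr_rmorph (C C' : comNzRingType) n (g : {rmorphism C -> C'}) (v : 'I_n -> C)
  (P : {mpoly int[n]}) : g (mmap intr v P) = mmap intr (fun i => g (v i)) P.
Proof.
elim/mpolyind: P => [|a m P _ _ IH]; first by rewrite !rmorph0.
rewrite !rmorphD /= IH !mmapZ !mmapX rmorphM rmorph_int rmorph_prod; congr (_ * _ + _).
by apply: eq_bigr => i _; rewrite rmorphXn.
Qed.

Lemma bin_pred_char (C : comNzRingType) i : p \in [pchar C] -> (i < p)%N ->
  'C(p.-1, i)%:R = (-1) ^+ i :> C.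
Proof.
move=> pC; elim: i => [|i IH] ip; first by rewrite bin0.
have p0 := prime_gt0 p_prime.
have : 'C(p, i.+1)%:R = 0 :> C.
  by apply/eqP; rewrite -(dvdn_pcharf pC) prime_dvd_bin.
rewrite -{1}(prednK p0) binS natrD IH 1?ltnW // => /eqP.
by rewrite addr_eq0 => /eqP ->; rewrite exprS mulN1r.
Qed.

(** With all variables equal to X, the relation defining D reads C X^(p(i+1)) = C^p X^(p(i+1)) + p
    D, where C = C(p,i+1). Over the integers p can be cancelled: if C = cp, then D is c X^(p(i+1))
    up to a multiple of p, and (i+1) c = C(p-1,i) is (-1)^i modulo p. *)
Lemma carry_spec (i : 'I_p) (D : {mpoly int[p]}) :
  mesym p int i.+1 \mPo [tuple 'X_l ^+ p | l < p] = mesym p int i.+1 ^+ p + D *+ p ->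
  ((i.+1 < p)%N ->
     i.+1%:R * mmap intr (fun=> x) D = (-1) ^+ i * x ^+ (p * i.+1)) /\
  (i.+1 = p -> mmap intr (fun=> x) D = 0).
Proof.
have p0 := prime_gt0 p_prime.
pose ev : {rmorphism {mpoly int[p]} -> {poly int}} := mmap intr (fun=> 'X).
move=> /(congr1 ev); rewrite rmorphD rmorphXn rmorphMn /=.
have -> : mmap intr (fun=> 'X) (mesym p int i.+1 \mPo [tuple 'X_l ^+ p | l < p])
    = 'X^(p * i.+1) *+ 'C(p, i.+1) :> {poly int}.
  rewrite comp_mpoly_mmap (mmap_eq _ _ (v' := fun=> 'X^p)) => [|l].
    by rewrite mmap_mesym esym_gen_const exprM.
  by rewrite tnth_mktuple rmorphXn /= mmapX mmap1U.
rewrite mmap_mesym esym_gen_const exprMn_n.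
rewrite -exprM [(i.+1 * p)%N]mulnC => /eqP.
rewrite addrC -subr_eq => /eqP/esym DE.
pose g : {rmorphism {poly int} -> A} := horner_eval x \o map_poly intr.
have DA : mmap intr (fun=> x) D = g (mmap intr (fun=> 'X) D).
  rewrite mmap_intr_rmorph; apply: mmap_eq => l.
  by rewrite /g /= map_polyX /horner_eval hornerX.
have cancel (u v : {poly int}) : u *+ p = v *+ p -> u = v.
  move=> uv; apply/polyP => n; apply/eqP.
  by rewrite -(@eqr_pMn2r _ p) // -!coefMn uv.
have gX : g 'X^(p * i.+1) = x ^+ (p * i.+1).
  by rewrite /g /= rmorphXn /= map_polyX /horner_eval hornerXn.
split=> [ip|ip]; last first.
  move: DE; rewrite ip binn exp1n mulr1n subrr => DE.
  by rewrite DA (cancel (mmap intr _ D) 0) ?rmorph0 // mul0rn.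
have [c Ec] : exists c, 'C(p, i.+1) = (c * p)%N by apply/dvdnP; rewrite prime_dvd_bin.
have Ec1 : (i.+1 * c = 'C(p.-1, i))%N.
  apply/eqP; rewrite -(eqn_pmul2r p0) -mulnA -Ec -mul_bin_diag.
  by rewrite mulnC.
have {}DE : mmap intr (fun=> 'X) D
    = 'X^(p * i.+1) *+ c - 'X^(p * i.+1) *+ (c ^ p * p ^ p.-1) :> {poly int}.
  apply: cancel; rewrite DE Ec mulrnBl -!mulrnA expnMn; congr (_ - _ *+ _).
  by rewrite -mulnA -expnSr prednK.
have z (u : A) : u *+ p ^ p.-1 = 0.
  have -> : p.-1 = p.-2.+1 by have := prime_gt1 p_prime; lia.
  by rewrite expnS mulrnA -(mulr_natr u p) (pcharf0 pA) mulr0 mul0rn.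
rewrite DA DE rmorphB !rmorphMn gX mulrnA z subr0.
by rewrite mulrnAr -mulrnAl -mulrnA Ec1 bin_pred_char // ltnW.
Qed.

(** At t = 0, S_(i-j) is C(p,i-j) x^(i-j), which vanishes for j < i, so beside the carry only the
    moment of index i remains. The factor i+1 keeps the statement free of division. *)
Lemma delta_sym_spec (i : 'I_p) : lbounded 0 (mmap intr spec_pt (delta_sym i)) /\
  let d := mmap intr spec_pt (delta_sym i) 0 in
  ((i.+1 < p)%N ->
    i.+1%:R * d = (-1) ^+ i * (x ^+ (p * i.+1) + i.+1%:R * spec_moment0 i)) /\
  (i.+1 = p -> d = spec_moment0 i).
Proof.
have [D [ED dE]] := mmap_delta_sym i p_prime.
have [D1 D2] := carry_spec ED.
have sqE : (fun l => spec_pt (lshift p l)) = spec_q by apply/funext => l; apply: spec_pt_lshift.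
rewrite (dE _ spec_pt laurent_pchar) sqE.
have -> : mmap intr spec_q D = mmap (@lconst A \o intr) spec_q D.
  by apply: eq_bigr => m _; rewrite /= rmorph_int.
have [h1 h2] := lint_mmap intr D spec_q_int.
rewrite (mmap_eq _ _ (v' := fun=> x)) in h2; last exact: spec_q0.
set S := \sum_(j < _) _.
have tP (j : 'I_i.+1) : lbounded 0 ((-1) ^+ j * (esym_gen spec_q)`_(i - j) ^+ p * spec_moment j) /\
   ((-1) ^+ j * (esym_gen spec_q)`_(i - j) ^+ p * spec_moment j) 0
     = if j == i :> nat then (-1) ^+ i * spec_moment0 i else 0.
  have [e1 e2] := esym_gen_spec (i - j); have [m1 m2] := spec_momentP j.
  have [e3 e4] := lintX p e1.
  have [s1 s2] : lbounded 0 ((-1) ^+ j : {laurent A}) /\ ((-1) ^+ j : {laurent A}) 0 = (-1) ^+ j.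
    have [|u1 u2] := @lintX _ (-1 : {laurent A}) j.
      by move=> m m0; rewrite lcoefN (lint_mono 1 (lexx 0) m0) oppr0.
    by split=> //; rewrite u2 lcoefN.
  split; first by apply: lintM => //; apply: lintM.
  rewrite lint_coefM //; last by apply: lintM.
  rewrite lint_coefM // s2 e4 e2 m2.
  have [ji|ji] := eqVneq (j : nat) i; first by rewrite ji subnn bin0 expr1n mulr1.
  have -> : x ^+ (i - j) *+ 'C(p, i - j) = 0.
    apply/eqP; rewrite -mulr_natr mulf_eq0 -(dvdn_pcharf pA) prime_dvd_bin ?orbT //.
    by have := ltn_ord i; have := ltn_ord j; lia.
  by rewrite expr0n eqn0Ngt prime_gt0 // mulr0 mul0r.
have SE : S = \sum_(j < i.+1) (-1) ^+ j * (esym_gen spec_q)`_(i - j) ^+ p * spec_moment j.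
  apply: eq_bigr => j _; congr (_ * _); apply: eq_bigr => l _.
  by rewrite spec_pt_lshift spec_pt_rshift.
have S1 : lbounded 0 S by rewrite SE; apply: lint_sum => j _; case: (tP j).
have S2 : S 0 = (-1) ^+ i * spec_moment0 i.
  rewrite SE lcoef_sum (eq_bigr _ (fun j _ => (tP j).2)) -big_mkcond /=.
  by rewrite (big_pred1 ord_max).
split.
  by move=> m m0; rewrite lcoefD h1 // S1 // addr0.
rewrite lcoefD S2 h2 /=.
split=> ip.
  by rewrite mulrDr D1 // mulrDr; congr (_ + _); rewrite mulrCA.
(* Here i = p-1, which is even because p is odd. *)
rewrite D2 // add0r -signr_odd; suff -> : odd i = false by rewrite mul1r.
by apply/negbTE; move: p_odd; rewrite -[X in odd X]ip.
Qed.
End Specialization.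

(** * Binomial coefficients in characteristic p *)

Section BinomialChar.
Variables (p : nat) (C : comNzRingType) (pC : p \in [pchar C]).

Let p_prime : prime p. Proof. by case/andP: pC. Qed.

Lemma natr_exp_charX l v : (l%:R : C) ^+ (p ^ v) = l%:R.
Proof. by elim: v => [|v IH]; rewrite ?expr1 // expnSr exprM IH natr_exp_char. Qed.

Lemma exprD_charX (x y : C) v : (x + y) ^+ (p ^ v) = x ^+ (p ^ v) + y ^+ (p ^ v).
Proof.
elim: v => [|v IH]; first by rewrite !expr1.
rewrite expnSr !exprM IH.
by have := rmorphD (pFrobenius_aut pC) (x ^+ (p ^ v)) (y ^+ (p ^ v)); rewrite /= !pFrobenius_autE.
Qed.

Lemma sum_expr_charX (I : Type) (r : seq I) (P : pred I) (F : I -> C) v :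
  (\sum_(i <- r | P i) F i) ^+ (p ^ v) = \sum_(i <- r | P i) F i ^+ (p ^ v).
Proof.
elim: r => [|i r IH]; first by rewrite !big_nil expr0n expn_eq0 eqn0Ngt prime_gt0.
by rewrite !big_cons; case: ifP => // _; rewrite exprD_charX IH.
Qed.

End BinomialChar.

(** Vandermonde convolution: C(pm,s) vanishes for 0 < s < p because s C(pm,s) is a multiple of
    pm. *)
Lemma bin_small_char (p : nat) (C : idomainType) m j i :
  p \in [pchar C] -> (i < p)%N -> 'C(p * m + j, i)%:R = 'C(j, i)%:R :> C.
Proof.
move=> pC ip; rewrite -binomial.Vandermonde natr_sum big_ord_recl bin0 mul1n subn0.
rewrite big1 ?addr0 // => s _; rewrite lift0 natrM.
suff -> : 'C(p * m, s.+1)%:R = 0 :> C by rewrite mul0r.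
have : s.+1%:R * 'C(p * m, s.+1)%:R = 0 :> C.
  by rewrite -natrM -mul_bin_diag !natrM (pcharf0 pC) !mul0r.
move/eqP; rewrite mulf_eq0 -(dvdn_pcharf pC) => /orP[/dvdn_leq|/eqP //].
by have := ltn_ord s; lia.
Qed.

(** Compare coefficients of X^(p^v) in (1 + X)^(p^v n) = (1 + X^(p^v))^n. *)
Lemma bin_prime_power (p : nat) (C : idomainType) v n : p \in [pchar C] ->
  'C(p ^ v * n, p ^ v)%:R = n%:R :> C.
Proof.
move=> pC; have p0 : (0 < p)%N by case/andP: pC => /prime_gt0.
have pX : p \in [pchar {poly C}] by apply: (rmorph_pchar (@polyC C) pC).
have coef N i : ((1 + 'X : {poly C}) ^+ N)`_i = 'C(N, i)%:R.
  rewrite exprDn coef_sum; under eq_bigr => j _ do rewrite expr1n mul1r coefMn coefXn.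
  have [ni|ni] := ltnP i N.+1; last first.
    rewrite bin_small // big1 // => j _.
    by have := ltn_ord j; case: eqP => [ij|]; rewrite ?mul0rn //; lia.
  rewrite (bigD1 (Ordinal ni)) //= eqxx big1 ?addr0 // => j ji.
  by case: eqP => [iE|]; rewrite ?mul0rn //; case/eqP: ji; apply: val_inj.
rewrite -coef exprM (exprD_charX pX) expr1n exprDn coef_sum.
under eq_bigr => j _ do rewrite expr1n mul1r -exprM coefMn coefXn
  -[X in X == _]muln1 eqn_pmul2l ?expn_gt0 ?p0 //.
case: n => [|n]; first by rewrite big_ord1.
rewrite (bigD1 (lift ord0 (ord0 : 'I_n.+1))) //= big1 ?addr0 ?bin1 // => j j1.
case: eqP => [jE|]; rewrite ?mul0rn //; case/eqP: j1; apply: val_inj; exact: esym.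
Qed.

Section SpecialIdentity.
Variables (p : nat) (p_prime : prime p) (p_odd : odd p) (k : fieldType).
Variables (f : {poly {laurent k}}) (h : 'X_{1..p + p} -> k).
Hypothesis hP : sym_subst h =1 Sigma_p f.
Variables (A : idomainType) (pA : p \in [pchar A]) (c : {rmorphism k -> A}).
Variables (x : A) (mu : nat -> A) (w : nat).

(* Meaningful for p b <= w only, because of the truncated subtraction. *)
Definition wcoef b : k := (f`_b : {laurent k}) (w - p * b)%N%:Z.

Definition spec_sum : {laurent A} :=
  \sum_(l < p) \sum_(b < (w %/ p).+1)
    lconst (c (wcoef b)) * (spec_q x l ^+ (w - p * b) * spec_dq mu l ^+ b).

(** The image of [weight_identity] under the evaluation. The side of f is a sum of terms with poles
    in t, while the other side is a polynomial in the integral values of the S_j and delta S_j. *)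
Lemma spec_sumP : lbounded 0 spec_sum /\ spec_sum 0 =
  \sum_(a : 'X_{1..(p + p) < w.+1} | sweight a == w) c (h a) *
   \prod_(i < p) ((if i.+1 == p then x ^+ p else 0) ^+ a (lshift p i) *
                  mmap intr (spec_pt x mu) (delta_sym i) 0 ^+ a (rshift p i)).
Proof.
pose ev : {rmorphism {mpoly k[p + p]} -> {laurent A}} := mmap (@lconst A \o c) (spec_pt x mu).
have -> : spec_sum = ev (\sum_(a : 'X_{1..(p + p) < w.+1} | sweight a == w)
    h a *: sym_monomial k a).
  rewrite -(weight_identity p_prime hP) rmorph_sum; apply: eq_bigr => l _.
  rewrite rmorph_sum; apply: eq_bigr => b _ /=.
  rewrite mmapZ rmorphM !rmorphXn /= !mmapX !mmap1U spec_pt_lshift spec_pt_rshift.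
  by [].
rewrite rmorph_sum lcoef_sum.
have E (a : 'X_{1..p + p}) : lbounded 0 (ev (h a *: sym_monomial k a)) /\
   ev (h a *: sym_monomial k a) 0 =  c (h a) *
   \prod_(i < p) ((if i.+1 == p then x ^+ p else 0) ^+ a (lshift p i) *
                  mmap intr (spec_pt x mu) (delta_sym i) 0 ^+ a (rshift p i)).
rewrite /ev /= mmapZ. rewrite mmap_sym_monomial.
  have P i : let F := mmap intr (spec_pt x mu) (symq i) ^+ a (lshift p i) *
        mmap intr (spec_pt x mu) (delta_sym i) ^+ a (rshift p i) in
      lbounded 0 F /\ F 0 = (if i.+1 == p then x ^+ p else 0) ^+ a (lshift p i) *
                  mmap intr (spec_pt x mu) (delta_sym i) 0 ^+ a (rshift p i).
    have [s1 s2] := symq_spec p_prime p_odd pA x mu i.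
    have [d1 _] := delta_sym_spec p_prime p_odd pA x mu i.
    have [s3 s4] := lintX (a (lshift p i)) s1.
    have [d3 d4] := lintX (a (rshift p i)) d1.
    split; first exact: (lintM s3 d3).
    by rewrite (lint_coefM s3 d3) s4 d4 s2.
have [i1 i2] := @lint_prod A _ (index_enum 'I_p) _ (fun i => (P i).1).
  split; first by apply: (lintM (lint_mono (c (h a)) (lexx 0)) i1).
  by rewrite lconstMl i2; congr (_ * _); apply: eq_bigr => i _; case: (P i).
split; first by apply: lint_sum => a _; case: (E a).
by apply: eq_bigr => a _; case: (E a).
Qed.
End SpecialIdentity.

(** * Pole cancellation and the resulting support of f *)

Section Structure.
Variables (p : nat) (p_prime : prime p) (p_odd : odd p) (k : fieldType).
Variables (pk : p \in [pchar k]).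
Variables (f : {poly {laurent k}}) (h : 'X_{1..p + p} -> k).
Hypothesis hP : sym_subst h =1 Sigma_p f.
Variable w : nat.

Local Notation A := {poly {poly k}}.

Definition cst2 : {rmorphism k -> A} := @polyC {poly k} \o @polyC k.

(** The monomial a x^e y^b, with x the outer and y the inner variable. As x and y are independent,
    the single terms of a pole can be separated. *)
Definition mon2 (a : k) (e b : nat) : A := cst2 a * ('X^e * ('X%:P) ^+ b).

Lemma pchar_poly2 : p \in [pchar A].
Proof. exact: (rmorph_pchar cst2 pk). Qed.

Lemma mon2_coef a e b e' b' :
  (mon2 a e b)`_e'`_b' = if (e == e') && (b == b') then a else 0.
Proof.
rewrite /mon2 /= -polyC_exp [X in _ * X]mulrC mulrA -polyCM coefCM coefXn eq_sym.
case: eqP => _ /=; last by rewrite mulr0 coef0.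
by rewrite mulr1 coefCM coefXn eq_sym; case: eqP; rewrite ?mulr1 ?mulr0.
Qed.

Lemma mon2M a e b a' e' b' : mon2 a e b * mon2 a' e' b' = mon2 (a * a') (e + e') (b + b').
Proof. by rewrite /mon2 rmorphM !exprD; ring. Qed.

Lemma mon2X a e b n : mon2 a e b ^+ n = mon2 (a ^+ n) (e * n) (b * n).
Proof. by rewrite /mon2 !exprMn rmorphXn !exprM. Qed.

Lemma mon2_nat n : n%:R = mon2 n%:R 0 0.
Proof. by rewrite /mon2 rmorph_nat !expr0 !mulr1. Qed.

Lemma spec_q_exp_mon2 (l : 'I_p) n : spec_q ('X : A) l ^+ n =
  \sum_(i < n.+1) lmono (mon2 (l%:R ^+ i *+ 'C(n, i)) (n - i) 0) i%:Z.
Proof.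
rewrite spec_q_exp; apply: eq_bigr => i _; congr lmono.
by rewrite /mon2 expr0 mulr1 rmorphMn rmorphXn rmorph_nat mulrnAl [in RHS]mulrC.
Qed.

(* With these [mu], the poles of [spec_sum] carry the binomials C(w - pb, i), i < pb. *)
Definition mu_one (i : nat) : A := if i == 1%N then 'X%:P else 0.

Lemma spec_dq_one (l : 'I_p) : spec_dq mu_one l = lmono (mon2 (- l%:R ^+ (p - 2)) 0 1) (- p%:Z).
Proof.
have p1 := prime_gt1 p_prime.
rewrite /spec_dq (bigD1 (Ordinal p1)) //= muln1 big1 ?addr0 => [|i i1]; last first.
  rewrite /mu_one ifF ?mul0r ?lmono0 //; apply/eqP => iE; case/eqP: i1.
  exact: val_inj.
rewrite /mu_one /=; apply: laurentP => m; rewrite lcoefN !lmono_coef; case: ifP => _;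
  rewrite ?oppr0 //.
rewrite /mon2 expr0 mul1r expr1 rmorphN rmorphXn rmorph_nat mulNr mulrC.
by congr (- (_ ^+ _ * _)); lia.
Qed.

Lemma spec_sum_one m :
  spec_sum p f cst2 'X mu_one w m = \sum_(b < (w %/ p).+1) \sum_(i < (w - p * b).+1)
    if m == i%:Z - (p * b)%N%:Z then
       mon2 (wcoef p f w b * (-1) ^+ b * 'C(w - p * b, i)%:R *
               \sum_(l < p) l%:R ^+ (i + (p - 2) * b)) (w - p * b - i) b
    else 0.
Proof.
rewrite /spec_sum exchange_big lcoef_sum; apply: eq_bigr => b _ /=.
have E (l : 'I_p) :
  lconst (cst2 (wcoef p f w b)) * (spec_q 'X l ^+ (w - p * b) * spec_dq mu_one l ^+ b)
  = \sum_(i < (w - p * b).+1) lmono (mon2 (wcoef p f w b * (-1) ^+ b * 'C(w - p * b, i)%:R *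
       l%:R ^+ (i + (p - 2) * b)) (w - p * b - i) b) (i%:Z - (p * b)%N%:Z).
  rewrite spec_q_exp_mon2 spec_dq_one lmonoX mulr_suml mulr_sumr.
  apply: eq_bigr => i _; rewrite lmonoM lmonoM add0r; congr lmono; last by lia.
  rewrite mon2X mon2M mul0n mul1n addn0 add0n /mon2 mulrA -rmorphM; congr (cst2 _ * _).
  by rewrite [(- (_ ^+ _)) ^+ _]exprNn -exprM exprD -[_ *+ 'C(_, _)]mulr_natr; ring.
rewrite (eq_bigr _ (fun l _ => E l)) exchange_big lcoef_sum; apply: eq_bigr => i _ /=.
rewrite lcoef_sum; case: ifP => mE; last by rewrite big1 // => l _; rewrite lmono_coef mE.
rewrite /mon2 mulr_sumr rmorph_sum mulr_suml; apply: eq_bigr => l _.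
by rewrite lmono_coef mE.
Qed.

(** The coefficient of x^(w-pb-i) y^b in the pole t^(i-pb): y isolates b, and x isolates i. *)
Lemma wcoef_bin_weight b i : (b <= w %/ p)%N -> (i <= w - p * b)%N -> (i < p * b)%N ->
  wcoef p f w b * 'C(w - p * b, i)%:R * \sum_(l < p) l%:R ^+ (i + (p - 2) * b) = 0.
Proof.
move=> bw iw ib.
have [H _] := spec_sumP p_prime p_odd hP pchar_poly2 cst2 'X mu_one w.
have := H (i%:Z - (p * b)%N%:Z); rewrite subr_lt0 ltz_nat => /(_ ib).
rewrite spec_sum_one => /(congr1 (fun P : A => P`_(w - p * b - i)`_b)).
rewrite !coef0 coef_sum coef_sum.
have bw1 : (b < (w %/ p).+1)%N by [].
rewrite (bigD1 (Ordinal bw1)) //= [X in _ + X = _]big1 => [|b' bb]; last first.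
  rewrite coef_sum coef_sum big1 // => i' _; case: ifP => _; rewrite ?coef0 //.
  rewrite mon2_coef; case: ifP => // /andP[_ /eqP bE]; case/eqP: bb; exact: val_inj.
have iw1 : (i < (w - p * b).+1)%N by [].
rewrite addr0 coef_sum coef_sum (bigD1 (Ordinal iw1)) //= eqxx mon2_coef !eqxx /=.
rewrite [X in _ + X = _]big1 ?addr0 => [|i' ii]; last first.
  case: ifP => iE; rewrite ?coef0 //; case/eqP: ii; apply: val_inj => /=.
  by move: iE; lia.
move=> E; apply/eqP; have /eqP := E; rewrite -!mulrA mulrCA mulf_eq0 signr_eq0 /=.
by rewrite mulrA.
Qed.

(* With these [mu], the poles of [spec_sum] carry the binomials C(b, s), 0 < s < b. *)
Definition mu_ends (i : nat) : A := if (i == 0) || (i == p.-1)%N then 'X%:P else 0.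

Lemma spec_dq_ends (l : 'I_p) : spec_dq mu_ends l =
  - (lmono (mon2 (l%:R ^+ p.-1) 0 1) 0 + lmono (mon2 1 0 1) (- (p * p.-1)%N%:Z)).
Proof.
have p1 := prime_gt1 p_prime; have p0 := prime_gt0 p_prime.
have p2 : p != 2%N by apply: contraTneq p_odd => ->.
have lp : (p.-1 < p)%N by lia.
rewrite /spec_dq (bigD1 (Ordinal p0)) //= (bigD1 (Ordinal lp)) /=; last first.
  by apply/eqP => /(congr1 val) /=; lia.
rewrite big1 => [|i /andP[i0 i1]]; last first.
  rewrite /mu_ends ifF ?mul0r ?lmono0 //; apply/negbTE; rewrite negb_or; apply/andP; split.
    by apply: contra_neq i0 => iE; apply: val_inj.
  by apply: contra_neq i1 => iE; apply: val_inj.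
rewrite addr0 /mu_ends eqxx orbT /= muln0 oppr0 subnn subn0 expr0 mulr1.
congr (- (lmono _ _ + lmono _ _)); rewrite /mon2 expr0 mul1r expr1.
  by rewrite rmorphXn rmorph_nat mulrC.
by rewrite rmorph1 mul1r.
Qed.

Lemma spec_sum_ends m :
  spec_sum p f cst2 'X mu_ends w m = \sum_(b < (w %/ p).+1) \sum_(i < (w - p * b).+1)
    \sum_(s < b.+1) if m == i%:Z - (p * p.-1 * (b - s))%N%:Z then
       mon2 (wcoef p f w b * (-1) ^+ b * 'C(w - p * b, i)%:R * 'C(b, s)%:R *
               \sum_(l < p) l%:R ^+ (i + p.-1 * s)) (w - p * b - i) b
    else 0.
Proof.
rewrite /spec_sum exchange_big lcoef_sum; apply: eq_bigr => b _ /=.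
have E (l : 'I_p) :
  lconst (cst2 (wcoef p f w b)) * (spec_q 'X l ^+ (w - p * b) * spec_dq mu_ends l ^+ b)
  = \sum_(i < (w - p * b).+1) \sum_(s < b.+1)
     lmono (mon2 (wcoef p f w b * (-1) ^+ b * 'C(w - p * b, i)%:R * 'C(b, s)%:R *
       l%:R ^+ (i + p.-1 * s)) (w - p * b - i) b) (i%:Z - (p * p.-1 * (b - s))%N%:Z).
  rewrite spec_q_exp_mon2 spec_dq_ends [(- (_ + _)) ^+ _]exprNn
    [lmono _ _ + lmono _ _]addrC exprDn mulr_suml mulr_sumr.
  apply: eq_bigr => i _; rewrite mulr_sumr mulr_sumr mulr_sumr; apply: eq_bigr => s _.
  rewrite !lmonoX lmonoM -[_ *+ 'C(b, s)]mulr_natr.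
  have -> : (-1) ^+ b = lmono (mon2 ((-1) ^+ b) 0 0) 0 :> {laurent A}.
    by rewrite /mon2 !expr0 !mulr1 -/(lconst _) !rmorphXn !rmorphN1.
  have -> : 'C(b, s)%:R = lmono (mon2 'C(b, s)%:R 0 0) 0 :> {laurent A}.
    by rewrite /mon2 !expr0 !mulr1 -/(lconst _) !rmorph_nat.
  rewrite /lconst !lmonoM; congr lmono; last by lia.
  rewrite !mon2X !mon2M !expr1n.
  have -> : cst2 (wcoef p f w b) = mon2 (wcoef p f w b) 0 0.
    by rewrite /mon2 !expr0 !mulr1.
  rewrite mon2M !mul0n !addn0 !add0n !mul1n subnK; last by rewrite -ltnS.
  rewrite /mon2; congr (cst2 _ * _).
  by rewrite exprD -exprM -mulr_natr; ring.
rewrite (eq_bigr _ (fun l _ => E l)) exchange_big lcoef_sum; apply: eq_bigr => i _ /=.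
rewrite exchange_big lcoef_sum; apply: eq_bigr => s _ /=.
rewrite lcoef_sum; case: ifP => mE; last by rewrite big1 // => l _; rewrite lmono_coef mE.
rewrite /mon2 mulr_sumr rmorph_sum mulr_suml; apply: eq_bigr => l _.
by rewrite lmono_coef mE.
Qed.

(** The coefficient of x^(w-pb) y^b in the pole t^(-p(p-1)(b-s)): the power of x forces i = 0,
    leaving the expansion of (l^(p-1) + t^(-p(p-1)))^b. *)
Lemma wcoef_bin_exponent b s : (b <= w %/ p)%N -> (0 < s < b)%N ->
  wcoef p f w b * 'C(b, s)%:R * \sum_(l < p) l%:R ^+ (p.-1 * s) = 0.
Proof.
move=> bw /andP[s0 sb]; have p1 := prime_gt1 p_prime.
have [H _] := spec_sumP p_prime p_odd hP pchar_poly2 cst2 'X mu_ends w.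
have e0 : (0 < p * p.-1 * (b - s))%N by rewrite !muln_gt0 subn_gt0; lia.
have := H (- (p * p.-1 * (b - s))%N%:Z); rewrite oppr_lt0 ltz_nat => /(_ e0).
rewrite spec_sum_ends => /(congr1 (fun P : A => P`_(w - p * b)`_b)).
rewrite !coef0 coef_sum coef_sum.
have bw1 : (b < (w %/ p).+1)%N by [].
rewrite (bigD1 (Ordinal bw1)) //= [X in _ + X = _]big1 => [|b' bb]; last first.
  rewrite coef_sum coef_sum big1 // => i' _; rewrite coef_sum coef_sum big1 // => s' _.
  case: ifP => _; rewrite ?coef0 //.
  rewrite mon2_coef; case: ifP => // /andP[_ /eqP bE]; case/eqP: bb; exact: val_inj.
rewrite addr0 coef_sum coef_sum big_ord_recl /= [X in _ + X = _]big1 => [|i _]; last first.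
  rewrite coef_sum coef_sum big1 // => s' _; case: ifP => _; rewrite ?coef0 //.
  rewrite mon2_coef; case: ifP => // /andP[/eqP iE _].
  by have := ltn_ord i; move: iE; rewrite /bump /=; lia.
have sb1 : (s < b.+1)%N by lia.
rewrite addr0 coef_sum coef_sum (bigD1 (Ordinal sb1)) //= [X in _ + X = _]big1 => [|s' ss];
  last first.
  case: ifP => sE; rewrite ?coef0 //; case/eqP: ss; apply: val_inj => /=.
  move: sE; rewrite sub0r eqr_opp eqz_nat eqn_pmul2l ?muln_gt0; last by lia.
  by have := ltn_ord s'; lia.
rewrite sub0r eqxx mon2_coef subn0 !eqxx /= addr0 bin0 mulr1 add0n.
move=> E; apply/eqP; have /eqP := E; rewrite -!mulrA mulrCA mulf_eq0 signr_eq0 /=.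
by rewrite mulrA.
Qed.
End Structure.

Section Structure2.
Variables (p : nat) (p_prime : prime p) (p_odd : odd p) (k : fieldType).
Variables (pk : p \in [pchar k]).
Variables (f : {poly {laurent k}}) (h : 'X_{1..p + p} -> k).
Hypothesis hP : sym_subst h =1 Sigma_p f.
Variable w : nat.

Local Notation A := {poly {poly k}}.
Local Notation wcoef := (wcoef p f w).

(** Write b = e p^v with e prime to p. If e > 1, [wcoef_bin_exponent] at s = p^v has C(b,s) = e and
    power sum -1, both nonzero. So b = p^v. Write w - pb = n p^u with n prime to p. If u <= v, then
    i = p^u is less than pb, C(w-pb,i) = n, and l^(p^u + (p-2) p^v) = l^(p-1) again has sum -1,
    against [wcoef_bin_weight]. So p^(v+1) divides w. *)
Lemma wcoef_support b : (0 < b <= w %/ p)%N -> wcoef b != 0 ->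
  (exists s, b = p ^ s)%N /\ (p * b %| w)%N.
Proof.
move=> /andP[b0 bw] cb; have p0 := prime_gt0 p_prime; have p1 := prime_gt1 p_prime.
have pbw : (p * b <= w)%N by rewrite mulnC -leq_divRL.
have [e pe be] := pfactor_coprime p_prime b0.
set v := logn p b in be.
have nz n : coprime p n -> (n%:R : k) != 0.
  by rewrite prime_coprime // (dvdn_pcharf pk).
have e1 : e = 1%N.
  apply/eqP/negPn/negP => e1; have e2 : (1 < e)%N.
    by case: e pe be e1 b0 => [|[|]] //; rewrite ?mul0n // => _ -> _.
  have vb : (0 < p ^ v < b)%N by rewrite expn_gt0 p0 /= be ltn_Pmull ?expn_gt0 ?p0.
  have := wcoef_bin_exponent p_prime p_odd pk hP bw vb.
  have -> : 'C(b, p ^ v)%:R = e%:R :> k by rewrite [X in 'C(X, _)]be mulnC bin_prime_power.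
  move/eqP.
  rewrite mulf_eq0 mulf_eq0 (negPf cb) (negPf (nz _ pe)) /=.
  rewrite (eq_bigr (fun l : 'I_p => l%:R ^+ p.-1)) => [|l _].
    by rewrite power_sum1 // oppr_eq0 oner_eq0.
  by rewrite mulnC exprM natr_exp_charX.
have bv : b = (p ^ v)%N by rewrite be e1 mul1n.
split; first by exists v.
have [w0|n0] := posnP (w - p * b).
  by have -> : w = (p * b)%N by lia.
have [n pn nE] := pfactor_coprime p_prime n0.
set u := logn p _ in nE.
have [vu|uv] := ltnP v u.
  rewrite -(subnK pbw) dvdn_addl ?dvdnn // nE dvdn_mull // bv -expnS.
  by rewrite dvdn_exp2l.
have iw : (p ^ u <= w - p * b)%N.
  by rewrite nE leq_pmull //; case: (n) nE n0 => // ->.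
have ib : (p ^ u < p * b)%N by rewrite bv -expnS ltn_exp2l // ltnS.
have := wcoef_bin_weight p_prime p_odd pk hP bw iw ib.
have -> : 'C(w - p * b, p ^ u)%:R = n%:R :> k.
  by rewrite [X in 'C(X, _)]nE mulnC bin_prime_power.
move/eqP.
rewrite mulf_eq0 mulf_eq0 (negPf cb) (negPf (nz _ pn)) /=.
rewrite (eq_bigr (fun l : 'I_p => l%:R ^+ p.-1)) => [|l _].
  by rewrite power_sum1 // oppr_eq0 oner_eq0.
rewrite exprD natr_exp_charX // mulnC exprM bv natr_exp_charX // -exprS.
by congr (_ ^+ _); lia.
Qed.

(* The values of the moments at t = 0 for which [delta S_(j+1)] vanishes there for
   j < p - 1 and is an independent variable for j = p - 1. *)
Definition target_moment (j : nat) : A :=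
  if j == p.-1 then 'X%:P else mon2 (- (j.+1%:R)^-1) (p * j.+1) 0.

(* Binomial inversion: [mu_inv i] is the image of (Y - x^p)^i under the linear map
   Y^j |-> [target_moment j]. *)
Definition mu_inv (i : nat) : A :=
  \sum_(j < p) (('X - ('X^p)%:P) ^+ i : {poly A})`_j * target_moment j.

(** For m = 0 this is binomial inversion: sum_i C(j,i) X^(j-i) (Y-X)^i = Y^j with X = x^p. Moments
    of index p or more also occur; since C(pm+j,i) = C(j,i) in k for i < p, they differ only by a
    power of x. *)
Lemma spec_moment0_inv m j : (j < p)%N ->
  spec_moment0 p 'X mu_inv (p * m + j) = 'X^(p * (p * m)) * target_moment j.
Proof.
move=> jp; have pA := pchar_poly2 pk; rewrite /spec_moment0.
pose X : A := 'X^p; have -> : ('X : A) ^+ p = X by [].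
rewrite (eq_bigr (fun i : 'I_p => X ^+ (p * m) * (X ^+ (j - i) *+ 'C(j, i) * mu_inv i))) => [|i _].
  rewrite -mulr_sumr [in RHS]exprM; congr (_ * _).
  rewrite (eq_bigr (fun i : 'I_p => \sum_(j' < p)
      (X ^+ (j - i) *+ 'C(j, i) *: ('X - X%:P) ^+ i)`_j' * target_moment j')) => [|i _].
    have E : \sum_(i < p) X ^+ (j - i) *+ 'C(j, i) *: ('X - X%:P) ^+ i = 'X^j :> {poly A}.
      rewrite -[in RHS](subrK X%:P 'X) [in RHS]addrC [in RHS]exprDn
        (big_ord_widen p (fun i => X%:P ^+ (j - i) * ('X - X%:P) ^+ i *+ 'C(j, i))) //.
      rewrite [RHS]big_mkcond; apply: eq_bigr => i _; rewrite ltnS; case: leqP => [ij|ji].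
        by rewrite -polyC_exp mul_polyC scalerMnl.
      by rewrite bin_small // mulr0n scale0r.
    rewrite exchange_big /=
      (eq_bigr (fun j' : 'I_p => ('X^j : {poly A})`_j' * target_moment j')) => [|j' _].
      rewrite (bigD1 (Ordinal jp)) //= coefXn eqxx mul1r big1 ?addr0 // => j' jj'.
      by rewrite coefXn; case: eqP => [jE|]; rewrite ?mul0r //; case/eqP: jj'; apply: val_inj.
    by rewrite -mulr_suml -coef_sum E.
  by rewrite mulr_sumr; apply: eq_bigr => j' _; rewrite coefZ mulrA.
rewrite -[LHS]mulr_natr (bin_small_char _ _ pA) //.
have [ij|ji] := leqP i j; last by rewrite bin_small // mulr0 mulr0n mul0r mulr0.
by rewrite -addnBA // exprD -mulr_natr; ring.
Qed.

Let pA : p \in [pchar A] := pchar_poly2 pk.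

(** The prescribed moment of index i < p-1 cancels the carry in [delta_sym_spec]; for i = p-1 the
    carry is 0 and the moment is y. *)
Lemma delta_sym_inv (i : 'I_p) :
  mmap intr (spec_pt ('X : A) mu_inv) (delta_sym i) 0 = if i.+1 == p then 'X%:P else 0.
Proof.
have [_ /= [d1 d2]] := delta_sym_spec p_prime p_odd pA ('X : A) mu_inv i.
have s0 : spec_moment0 p 'X mu_inv i = target_moment i.
  by have := spec_moment0_inv 0 (ltn_ord i); rewrite muln0 add0n => ->; rewrite muln0 expr0 mul1r.
case: eqP => [ip|/eqP ip]; first by rewrite d2 // s0 /target_moment -[X in _ == X.-1]ip eqxx.
have ip1 : (i.+1 < p)%N by have := ltn_ord i; move: ip; rewrite neq_ltn; lia.
have i0 : (i.+1%:R : k) != 0.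
  by rewrite -(dvdn_pcharf pk); apply/negP => /dvdn_leq; lia.
apply/eqP; have /eqP := d1 ip1; rewrite s0 /target_moment ifF; last by apply/eqP; lia.
rewrite mon2_nat mon2M add0n addn0 mulrN mulfV // /mon2 rmorphN1 !expr0 !mulr1 mulN1r.
rewrite subrr mulr0 mulf_eq0 => /orP[|/eqP //].
by rewrite fmorph_eq0 (negPf i0).
Qed.

(** For b = p^s and w = npb, q^(w-pb) q'^b is (q^(p(n-1)) q')^b, and raising to the power b is
    additive; so the sum over l is the b-th power of the moment of index n-1. *)
Lemma spec_sum_inv : spec_sum p f (cst2 k) 'X mu_inv w 0 =
  \sum_(b < (w %/ p).+1 | (0 < b)%N && (wcoef b != 0))
     cst2 k (wcoef b) * spec_moment0 p 'X mu_inv (w %/ (p * b)).-1 ^+ b.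
Proof.
have p0 := prime_gt0 p_prime.
rewrite /spec_sum exchange_big lcoef_sum [RHS]big_mkcond; apply: eq_bigr => b _ /=.
rewrite -mulr_sumr lconstMl.
case: posnP => [->|b0] /=.
  (* The term b = 0 drops out: at t = 0 it consists of p equal summands. *)
  rewrite muln0 subn0 lcoef_sum (eq_bigr (fun=> 'X^w)) => [|l _].
    by rewrite sumr_const card_ord -mulr_natr (pcharf0 pA) !mulr0.
  by rewrite expr0 mulr1 (lintX w (spec_q_int _ _)).2 spec_q0.
have [->|cb] := eqVneq (wcoef b) 0; first by rewrite rmorph0 mul0r.
congr (_ * _).
have bw : (0 < b <= w %/ p)%N by rewrite b0 /= -ltnS; apply: ltn_ord.
have [[s bs] /dvdnP[n wn]] := wcoef_support bw cb.
have -> : (w %/ (p * b) = n)%N by rewrite [X in (X %/ _)%N]wn mulnK // muln_gt0 p0.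
have -> : (w - p * b = p * n.-1 * b)%N
  by rewrite [X in (X - _)%N]wn; case: (n) => [|n'] /=; rewrite ?muln0 ?mul0n //; lia.
have [m1 m2] := spec_momentP p_prime p_odd pA ('X : A) mu_inv n.-1.
have [_ mb] := lintX b m1.
rewrite -m2 -mb /spec_moment bs sum_expr_charX ?laurent_pchar //.
by congr (lcoef _ 0); apply: eq_bigr => l _; rewrite exprMn -!exprM.
Qed.

(** At t = 0 only S_p = x^p and delta S_p = y are nonzero, so s_p^u s'_p^v is the only monomial with
    value x^(pu) y^v. *)
Lemma h_mnm_last u v : w = (p * u + p * p * v)%N ->
  h (mnm_last p u v) = (spec_sum p f (cst2 k) 'X mu_inv w 0)`_(p * u)`_v.
Proof.
move=> wE; have p0 := prime_gt0 p_prime.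
have lp : (p.-1 < p)%N by rewrite prednK.
pose i1 := Ordinal lp.
have i1P (i : 'I_p) : (i.+1 == p) = (i == i1) by rewrite -val_eqE /=; lia.
have lastl u' v' i : mnm_last p u' v' (lshift p i) = if i == i1 then u' else 0%N.
  by rewrite mnmE (unsplitK (inl i)) i1P.
have lastr u' v' i : mnm_last p u' v' (rshift p i) = if i == i1 then v' else 0%N.
  by rewrite mnmE (unsplitK (inr i)) i1P.
have wlast : sweight (mnm_last p u v) = w.
  rewrite /sweight (bigD1 i1) //= lastl lastr eqxx prednK // big1 ?addn0 ?wE // => i ii.
  by rewrite lastl lastr (negPf ii) !muln0.
have [_ ->] := spec_sumP p_prime p_odd hP pA (cst2 k) ('X : A) mu_inv w.
have dlast : (mdeg (mnm_last p u v) < w.+1)%N by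
  rewrite ltnS (leq_trans (mdeg_le_sweight _ p0)) ?wlast.
pose F (a : 'X_{1..p + p}) : A :=
  \prod_(i < p) ((if i.+1 == p then 'X ^+ p else 0) ^+ a (lshift p i) *
                  mmap intr (spec_pt ('X : A) mu_inv) (delta_sym i) 0 ^+ a (rshift p i)).
have FE (a : 'X_{1..p + p}) : F a = if a == mnm_last p (a (lshift p i1)) (a (rshift p i1)) then
    mon2 1 (p * a (lshift p i1)) (a (rshift p i1)) else 0.
  case: ifP => [/eqP aE|aE].
    rewrite /F (bigD1 i1) //= big1 => [|i ii].
      by rewrite mulr1 delta_sym_inv i1P eqxx /mon2 rmorph1 mul1r exprM.
    by rewrite aE lastl lastr (negPf ii) !expr0 mulr1.
  apply/eqP/prodf_eq0.
  have /existsP[i ai] :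
    [exists i : 'I_p, (i != i1) && ((a (lshift p i) != 0) || (a (rshift p i) != 0))%N].
    apply: contraFT aE; rewrite negb_exists => /forallP H; apply/eqP/mnmP => j.
     rewrite -[j]splitK.
    case: (fintype.split j) => i /=; have := H i; rewrite ?lastl ?lastr.
      by have [->|_] := eqVneq i i1 => //=; rewrite negb_or !negbK => /andP[/eqP ->].
    by have [->|_] := eqVneq i i1 => //=; rewrite negb_or !negbK => /andP[_ /eqP ->].
  case/andP: ai => ii ai; exists i => //; rewrite delta_sym_inv i1P (negPf ii) !expr0n.
  by case/orP: ai => /negPf ->; rewrite ?mulr0 ?mul0r.
rewrite coef_sum coef_sum (bigD1 (BMultinom dlast)) /=; last by rewrite wlast.
rewrite -/(F _) FE lastl lastr !eqxx big1 ?addr0 => [|a /andP[_ ab]].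
  rewrite coefCM coefCM mon2_coef !eqxx mulr1 //.
rewrite -/(F a) FE; case: ifP => [/eqP aE|_]; last by rewrite mulr0 !coef0.
rewrite coefCM coefCM mon2_coef; case: ifP => [|_]; last by rewrite mulr0.
rewrite eqn_pmul2l // => /andP[/eqP a1 /eqP a2]; case/eqP: ab; apply: val_inj => /=.
by rewrite aE a1 a2.
Qed.

(** With N-1 = pm+j, p divides N exactly when j = p-1, the index whose moment is y. Otherwise j+1 =
    N in k, and it lies in F_p, so the power p^s fixes it. *)
Lemma spec_moment0_inv_exp s N : (0 < N)%N -> spec_moment0 p 'X mu_inv N.-1 ^+ (p ^ s) =
  if (p %| N)%N then mon2 1 (p * (N - p) * p ^ s) (p ^ s)
  else mon2 (- (N%:R)^-1) (p * N * p ^ s) 0.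
Proof.
move=> N0; have p0 := prime_gt0 p_prime; have p1 := prime_gt1 p_prime.
have jp : (N.-1 %% p < p)%N by rewrite ltn_mod.
set m := (N.-1 %/ p)%N; set j := (N.-1 %% p)%N in jp.
have NE : N = (p * m + j).+1 by rewrite mulnC -divn_eq prednK.
have pN : (p %| N)%N = (j == p.-1).
  rewrite NE -addnS dvdn_addr ?dvdn_mulr //; apply/idP/eqP => [/(dvdn_leq (ltn0Sn _))|->];
    first by lia.
  by rewrite prednK.
have -> : N.-1 = (p * m + j)%N by rewrite NE.
rewrite spec_moment0_inv // /target_moment pN.
have -> e : 'X^e = mon2 1 e 0 :> A by rewrite /mon2 rmorph1 mul1r expr0 mulr1.
case: eqP => [jE|jE].
  have -> : ('X%:P : A) = mon2 1 0 1 by rewrite /mon2 rmorph1 mul1r expr0 mul1r expr1.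
  rewrite mon2M mon2X mul1r expr1n addn0 mul1n; congr (mon2 _ (_ * _) _).
  have -> // : (N - p = p * m)%N by rewrite NE jE; lia.
rewrite mon2M mon2X mul1r addn0 mul0n; congr (mon2 _ (_ * _) _); last by rewrite NE; lia.
(* The sign survives because p^s is odd. *)
rewrite exprNn exprVn natr_exp_charX // -signr_odd oddX p_odd orbT expr1 mulN1r.
by rewrite NE -addnS natrD natrM (pcharf0 pk) mul0r add0r.
Qed.

Lemma spec_sum_inv_coef e v : (spec_sum p f (cst2 k) 'X mu_inv w 0)`_e`_v =
  \sum_(b < (w %/ p).+1 | (0 < b)%N && (wcoef b != 0))
     if (p %| w %/ (p * b))%N then
       if (e == w - p * p * b)%N && (v == b :> nat) then wcoef b else 0
     else if (e == w) && (v == 0)%N then - wcoef b / (w %/ (p * b))%:R else 0.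
Proof.
have p0 := prime_gt0 p_prime.
rewrite spec_sum_inv !coef_sum; apply: eq_bigr => b /andP[b0 cb].
have bw : (0 < b <= w %/ p)%N by rewrite b0 /= -ltnS; apply: ltn_ord.
have [[s bs] /dvdnP[n wn]] := wcoef_support bw cb.
have pb0 : (0 < p * b)%N by rewrite muln_gt0 p0.
have wN : (w %/ (p * b) = n)%N by rewrite [X in (X %/ _)%N]wn mulnK.
have n0 : (0 < n)%N.
  have /andP[_] := bw; rewrite leq_divRL // [X in (_ <= X)%N]wn.
  by case: (n) => // ; rewrite mul0n leqn0 muln_eq0 !eqn0Ngt b0 p0.
rewrite wN [X in _ ^+ X]bs spec_moment0_inv_exp // -bs.
case: ifP => pn; rewrite /= coefCM coefCM mon2_coef !(eq_sym _ e) !(eq_sym _ v).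
  have E : (p * (n - p) * b = n * (p * b) - p * p * b)%N.
    by rewrite mulnBr mulnBl; congr (_ - _)%N; lia.
  rewrite E -wn.
  by case: ifP; rewrite ?mulr1 ?mulr0.
have -> : (p * n * b = w)%N by apply: etrans (esym wn); lia.
by case: ifP; rewrite ?mulr0 // mulrN mulNr.
Qed.

(** A positive power of y comes only from the summand b = v, and only when p divides w/(pv). *)
Lemma h_mnm_last_pos u v : w = (p * u + p * p * v)%N -> (0 < v)%N ->
  h (mnm_last p u v) = if (p * p * v %| w)%N then wcoef v else 0.
Proof.
move=> wE v0; have p0 := prime_gt0 p_prime.
rewrite (h_mnm_last wE) spec_sum_inv_coef.
have vw : (v < (w %/ p).+1)%N.
  rewrite ltnS leq_divRL // wE; apply: leq_trans (leq_addl _ _).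
  by rewrite mulnAC -mulnA leq_pmull.
rewrite big_mkcond (bigD1 (Ordinal vw)) //= v0 big1 ?addr0 => [|b bv]; last first.
  case: ifP => // _; rewrite (eqn0Ngt v) v0 andbF; case: ifP => // _.
  by case: ifP => // /andP[_ /eqP vb]; case/eqP: bv; apply: val_inj.
have [->|cv /=] := eqVneq (wcoef v) 0; first by rewrite ?eqxx /= !if_same.
have vb : (0 < v <= w %/ p)%N by rewrite v0 /=; exact: vw.
have [_ pvw] := wcoef_support vb cv.
rewrite dvdn_divRL // -mulnA [(p * (p * v))%N]mulnC [(p * v * p)%N]mulnC.
case: ifP => // _; last by rewrite (eqn0Ngt v) v0 andbF.
by rewrite eqxx andbT ifT // [X in _ == (X - _)%N]wE -mulnA addnK.
Qed.

(** The power y^0 requires b = p^s with w/(pb) prime to p. As p does not divide m, this leaves s =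
    i, and w/(pb) = m is the denominator. *)
Lemma h_mnm_last0 i m : w = (p ^ i.+1 * m)%N -> ~~ (p %| m)%N ->
  h (mnm_last p (p ^ i * m) 0) = - wcoef (p ^ i) / m%:R.
Proof.
move=> wE pm; have p0 := prime_gt0 p_prime.
have m0 : (0 < m)%N by case: (m) pm => //; rewrite dvdn0.
have wE1 : w = (p * (p ^ i * m) + p * p * 0)%N by rewrite muln0 addn0 mulnA -expnS.
have pi0 : (0 < p ^ i)%N by rewrite expn_gt0 p0.
rewrite (h_mnm_last wE1) spec_sum_inv_coef.
have iw : (p ^ i < (w %/ p).+1)%N.
  by rewrite ltnS leq_divRL // wE expnSr leq_pmulr.
rewrite big_mkcond (bigD1 (Ordinal iw)) //= pi0 big1 ?addr0 => [|b bv]; last first.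
  case: ifP => // /andP[b0 cb].
  have bw : (0 < b <= w %/ p)%N by rewrite b0 /= -ltnS; apply: ltn_ord.
  have [[s bs] pbw] := wcoef_support bw cb.
  have -> : (0%N == b :> nat) = false by rewrite eq_sym eqn0Ngt b0.
  rewrite andbF; case: ifP => // /negP pn; case: pn.
  have sw : (p ^ s.+1 %| p ^ i.+1 * m)%N by rewrite -wE expnS -bs.
  have cpm : coprime (p ^ s.+1) m by rewrite coprimeXl // prime_coprime.
  move: sw; rewrite Gauss_dvdl // dvdn_Pexp2l ?prime_gt1 // ltnS => si.
  have si1 : (s < i)%N.
    by rewrite ltn_neqAle si andbT; apply: contraNneq bv => si1; apply/eqP/val_inj;
      rewrite /= bs si1.
  by rewrite dvdn_divRL // [X in (_ %| X)%N]wE bs -!expnS dvdn_mulr // dvdn_exp2l.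
have -> : (w %/ (p * p ^ i) = m)%N by rewrite wE -expnS mulKn // expn_gt0 p0.
rewrite (negPf pm) mulnA -expnS -wE eqxx /=.
by case: eqP => // ->; rewrite oppr0 mul0r.
Qed.
End Structure2.

(** * Reduction modulo p *)

Section LmapMorphism.
Variables (A B : comNzRingType) (g : {rmorphism A -> B}).

Lemma lmap_coef (f : {laurent A}) m : lmap g f m = g (f m).
Proof. by rewrite /=; case: eqP => // ->; rewrite rmorph0. Qed.

Lemma lmap_zmod : zmod_morphism (@lmap A B g).
Proof.
by move=> f h; apply: laurentP => m; rewrite lcoefB !lmap_coef lcoefB rmorphB.
Qed.
HB.instance Definition _ :=
  GRing.isZmodMorphism.Build {laurent A} {laurent B} (@lmap A B g) lmap_zmod.

Lemma lmap_bounded b (f : {laurent A}) : lbounded b f -> lbounded b (lmap g f).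
Proof. by move=> fb m mb; rewrite lmap_coef fb // rmorph0. Qed.

Lemma lmap_monoid : monoid_morphism (@lmap A B g).
Proof.
split=> [|f h]; apply: laurentP => m.
  by rewrite lmap_coef !lmono_coef; case: ifP; rewrite ?rmorph1 ?rmorph0.
have [b fb] := lcoefP f; have [b' hb] := lcoefP h.
rewrite lmap_coef; have [mb|bm] := ltP m (b + b').
  have -> : (f * h) m = 0 by apply: (lmulc_lt fb hb).
  have -> : (lmap g f * lmap g h) m = 0 by apply: (lmulc_lt (lmap_bounded fb) (lmap_bounded hb)).
  exact: rmorph0.
have [n ->] := int_ge_nat bm.
transitivity (g (ltrunc b n f * ltrunc b' n h)`_n).
  by congr (g _); apply: lmulcE.
rewrite (_ : (lmap g f * lmap g h) _ = (ltrunc b n (lmap g f) * ltrunc b' n (lmap g h))`_n).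
  rewrite !coefM rmorph_sum; apply: eq_bigr => i _.
  have in' : (i <= n)%N by rewrite -ltnS.
  by rewrite rmorphM !coef_ltrunc ?leq_subr // !lmap_coef.
by apply: lmulcE; apply: lmap_bounded.
Qed.
HB.instance Definition _ :=
  GRing.isMonoidMorphism.Build {laurent A} {laurent B} (@lmap A B g) lmap_monoid.
End LmapMorphism.

Section LsubMorphism.
Variable A : comUnitRingType.

Lemma lsub_coef (u : A) e (f : {laurent A}) m : lsub u e f m =
  if (e%:Z %| m)%Z then f (m %/ e%:Z)%Z * u ^ (m %/ e%:Z)%Z else 0.
Proof. by []. Qed.

Lemma lsub_zmod (u : A) e : zmod_morphism (lsub u e).
Proof.
move=> f h; apply: laurentP => m; rewrite lcoefB !lsub_coef.
by case: ifP; rewrite ?subr0 // lcoefB mulrBl.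
Qed.
HB.instance Definition _ u e :=
  GRing.isZmodMorphism.Build {laurent A} {laurent A} (lsub u e) (lsub_zmod u e).

Lemma lsub_mono (u a : A) e m : (0 < e)%N ->
  lsub u e (lmono a m) = lmono (a * u ^ m) (e%:Z * m).
Proof.
move=> e0; have e1 : e%:Z != 0 by rewrite eqz_nat -lt0n.
apply: laurentP => i; rewrite lsub_coef.
case: dvdzP => [[j ->]|ne].
  rewrite mulzK // !lmono_coef [_ * m]mulrC (inj_eq (mulIf e1)).
  by case: eqP => [->|]; rewrite ?mul0r.
rewrite lmono_coef ifF //; apply/eqP => iE; apply: ne; exists m.
by rewrite iE mulrC.
Qed.
End LsubMorphism.

Section ComplTheory.
Variables (p : nat) (A : comNzRingType).
Implicit Types x y : compl p A.

(** p x_(e+1) is divisible by p^(e+1), so x_(e+1) is divisible by p^e, and x_e agrees with it modulo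
    p^e. *)
Lemma compl_torsion : (forall a : A, a *+ p = 0 -> a = 0) ->
  forall x, x *+ p = 0 -> x = 0.
Proof.
move=> tA; elim/compl_ind => x; rewrite -raddfMn => /pi_compl_eq0 xp.
apply/pi_compl_eq0 => e.
have [z Ez] := xp e.+1; have /asboolP xc := valP x; have [y Ey] := xc e.
have xz : x e.+1 = z *+ p ^ e.
  apply/eqP; rewrite -subr_eq0; apply/eqP/tA; apply/eqP.
  by rewrite mulrnBl -mulrnA -expnSr subr_eq0 -Ez subr0 cseqMn.
by exists (z - y); rewrite subr0 mulrnBl -xz -Ey /= subKr.
Qed.

Lemma compl_extE_zmod (B : comNzRingType) (h : A -> compl p B) (a : A) :
  zmod_morphism h -> compl_ext h (to_compl p a) = h a.
Proof.
move=> hP; pose h' : {additive A -> compl p B} :=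
  HB.pack h (GRing.isZmodMorphism.Build _ _ h hP).
exact: (compl_extE h' a).
Qed.
End ComplTheory.

Section LhatMaps.
Variables (p : nat) (R : idomainType).

Lemma Lhat_incE (a : {laurent R}) : Lhat_inc (to_compl p a) = to_compl p a%:P.
Proof. by apply: compl_extE_zmod => x y; rewrite polyCB rmorphB. Qed.

Lemma Lhat_rootE n (a : {laurent R}) : Lhat_root n (to_compl p a) = to_compl p (lsub 1 n a).
Proof. by apply: compl_extE_zmod => x y; rewrite raddfB rmorphB. Qed.

Lemma Lphat_rootE n (a : {poly {laurent R}}) :
  Lphat_root n (to_compl p a) = to_compl p (map_poly (lsub 1 n) a).
Proof. by apply: compl_extE_zmod => x y; rewrite raddfB rmorphB. Qed.

Lemma Lphat_torsion : p%:R != 0 :> R -> forall x : Lphat p R, x *+ p = 0 -> x = 0.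
Proof.
move=> p0; apply: compl_torsion => a ap; apply/polyP => i; apply: laurentP => m.
have : (a *+ p)`_i m = 0 by rewrite ap coef0 lcoef0.
rewrite coefMn lcoefMn coef0 lcoef0 => /eqP.
by rewrite -mulr_natr mulf_eq0 (negPf p0) orbF => /eqP.
Qed.

(** A bound depending on [size f] hides additivity, which [compl_ext] needs; padding with zero
    coefficients to a common bound reveals it. *)
Lemma dsubstE (delta : nat -> Lhat p R -> Lphat p R) n (u : R) e (f : {poly {laurent R}}) M :
  (size f <= M)%N -> dsubst delta n u e (to_compl p f)
   = \sum_(j < M) to_compl p (lsub u e f`_j)%:P * delta n (to_compl p (lmono u e%:Z)) ^+ j.
Proof.
have ext (g : {poly {laurent R}}) M' : (size g <= M')%N ->
   \sum_(j < size g) to_compl p (lsub u e g`_j)%:P * delta n (to_compl p (lmono u e%:Z)) ^+ j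
   = \sum_(j < M') to_compl p (lsub u e g`_j)%:P * delta n (to_compl p (lmono u e%:Z)) ^+ j.
  move=> gM; rewrite (big_ord_widen M' (fun j => to_compl p (lsub u e g`_j)%:P *
     delta n (to_compl p (lmono u e%:Z)) ^+ j)) // big_mkcond; apply: eq_bigr => j _.
  by case: ltnP => // gj; rewrite nth_default // raddf0 polyC0 rmorph0 mul0r.
move=> fM; rewrite -ext //; apply: compl_extE_zmod => g h.
pose K := maxn (size g) (size h).
rewrite !(ext _ K) ?leq_maxl ?leq_maxr //; last first.
  by rewrite (leq_trans (size_polyD _ _)) // size_polyN.
rewrite -sumrB; apply: eq_bigr => j _.
by rewrite coefB raddfB polyCB rmorphB mulrBl.
Qed.
End LhatMaps.

Section Reduction.
Local Open Scope quotient_scope.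
Variables (p : nat) (R : idomainType) (k : closedFieldType) (red : {rmorphism R -> k}).
Hypothesis R_ur : is_Zp_ur_hat p red.

Local Notation redp := (map_poly (lmap red) : {poly {laurent R}} -> {poly {laurent k}}).

Lemma pchar_residue : prime p -> p \in [pchar k].
Proof.
move=> pp; apply/andP; split=> //; apply/eqP.
by rewrite -(rmorph_nat red); apply/(ur_red_ker R_ur); exists 1.
Qed.

Lemma redp_p (z : {poly {laurent R}}) : redp (z *+ p) = 0.
Proof.
rewrite raddfMn /=; apply/polyP => i; apply: laurentP => m.
rewrite coefMn lcoefMn coef_map lmap_coef coef0 lcoef0 -raddfMn /=.
by apply/(ur_red_ker R_ur); exists (z`_i m).
Qed.

Lemma reduce_pi (x : cseq p {poly {laurent R}}) :
  reduce red (\pi_(compl p {poly {laurent R}}) x) = redp (x 1%N).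
Proof.
rewrite /reduce; set y := repr _.
have : \pi_(compl p {poly {laurent R}}) (y - x) = 0.
  by rewrite raddfB /= reprK subrr.
move/pi_compl_eq0/(_ 1%N) => [z]; rewrite subr0 expn1 => yx.
have {}yx : y 1%N = x 1%N + z *+ p by rewrite -yx /= addrC subrK.
by rewrite yx raddfD /= redp_p addr0.
Qed.

Lemma reduceD (x y : Lphat p R) : reduce red (x + y) = reduce red x + reduce red y.
Proof.
by elim/compl_ind: x => x; elim/compl_ind: y => y; rewrite -raddfD !reduce_pi raddfD.
Qed.

Lemma reduceM (x y : Lphat p R) : reduce red (x * y) = reduce red x * reduce red y.
Proof.
elim/compl_ind: x => x; elim/compl_ind: y => y.
rewrite [X in reduce _ X](_ : _ = \pi_(compl p {poly {laurent R}}) (x * y));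
  last exact: Defs.pi_mul.
by rewrite !reduce_pi rmorphM.
Qed.

Lemma reduce_to_compl a : reduce red (to_compl p a) = redp a.
Proof. exact: reduce_pi. Qed.

Lemma reduceX (x : Lphat p R) n : reduce red (x ^+ n) = reduce red x ^+ n.
Proof.
elim: n => [|n IH]; last by rewrite !exprS reduceM IH.
rewrite !expr0; have -> : 1 = to_compl p 1 :> Lphat p R by rewrite rmorph1.
by rewrite reduce_to_compl rmorph1.
Qed.

Lemma reduce0 : reduce red (0 : Lphat p R) = 0.
Proof.
have -> : 0 = to_compl p 0 :> Lphat p R by rewrite rmorph0.
by rewrite reduce_to_compl rmorph0.
Qed.

Lemma reduceMn (x : Lphat p R) n : reduce red (x *+ n) = reduce red x *+ n.
Proof. by elim: n => [|n IH]; rewrite ?reduce0 // !mulrS reduceD IH. Qed.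

Lemma reduce_sum (I : Type) (r : seq I) (P : pred I) (F : I -> Lphat p R) :
  reduce red (\sum_(i <- r | P i) F i) = \sum_(i <- r | P i) reduce red (F i).
Proof. exact: (big_morph _ reduceD reduce0). Qed.

Lemma reduce_p (x : Lphat p R) : reduce red (x *+ p) = 0.
Proof.
elim/compl_ind: x => x; rewrite -raddfMn reduce_pi cseqMn; exact: redp_p.
Qed.

(** If b lifts the inverse of [red a], then ab = 1 + pd, whose inverse is the limit of the partial
    sums of a geometric series. *)
Lemma ur_unit a : red a != 0 -> a \is a GRing.unit.
Proof.
move=> a0; have [b ab] := ur_red_surj R_ur (red a)^-1.
have [d dE] : exists d, a * b - 1 = d *+ p.
  by apply/(ur_red_ker R_ur); rewrite rmorphB rmorphM ab mulfV // rmorph1 subrr.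
pose x e : R := \sum_(i < e) (- (d *+ p)) ^+ i.
have xE e : (1 + d *+ p) * x e = 1 - (- (d *+ p)) ^+ e.
  by rewrite -[RHS]opprB subrX1 -mulNr opprB opprK.
have [c cE] : exists c, forall e, pcong p e c (x e).
  apply: (ur_complete R_ur) => e; exists ((- d) ^+ e).
  by rewrite /x big_ord_recr /= addrAC subrr add0r -mulNrn exprMn_n.
have E : (1 + d *+ p) * c = 1.
  apply/eqP; rewrite -subr_eq0; apply/eqP/(ur_sep R_ur) => e.
  have [z zE] := cE e; exists ((1 + d *+ p) * z - (- d) ^+ e).
  rewrite subr0 mulrnBl -mulrnAr -zE mulrBr xE -exprMn_n mulNrn.
  by ring.
apply/unitrPr; exists (b * c); rewrite mulrA -E; congr (_ * _).
by rewrite -dE addrC subrK.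
Qed.
End Reduction.

Lemma exprD_sq (C : comPzRingType) (a b : C) (p n : nat) :
  exists w, (a + b *+ p) ^+ n = a ^+ n + a ^+ n.-1 * b *+ n *+ p + w *+ p *+ p.
Proof.
elim: n => [|n [w IH]]; first by exists 0; rewrite !expr0 mulr0n !mul0rn !addr0.
exists (a * w + a ^+ n.-1 * b * b *+ n + w * b *+ p).
have an : a * a ^+ n.-1 *+ n = a ^+ n *+ n.
  by case: n {IH} => [|n]; rewrite ?mulr0n // -exprS.
rewrite exprS IH /= exprS.
have -> : a ^+ n * b *+ n.+1 = a ^+ n * b + (a ^+ n *+ n) * b by rewrite mulrS mulrnAl.
by rewrite -an; move: (a ^+ n) (a ^+ n.-1) => X Y; ring.
Qed.

Section DeltaModP.
Variables (p : nat) (p_prime : prime p).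
Variables (R : idomainType) (k : closedFieldType) (red : {rmorphism R -> k}).
Hypothesis R_ur : is_Zp_ur_hat p red.
Variables (phi : {rmorphism R -> R}) (delta0 deltan : Lhat p R -> Lphat p R) (n : nat).
Hypotheses (delta0P : is_delta phi delta0) (np : coprime n p).
Hypothesis deltanP : extends_delta n delta0 deltan.

Let n_gt0 : (0 < n)%N.
Proof. by case: n np => //; rewrite /coprime gcd0n => /eqP p1; move: p_prime; rewrite p1. Qed.

Lemma natr_residue_neq0 m : coprime m p -> (m%:R : k) != 0.
Proof. by rewrite -(dvdn_pcharf (pchar_residue R_ur p_prime)) coprime_sym prime_coprime. Qed.

Let torsion := Lphat_torsion (ur_char0 R_ur).

Lemma delta0_q : delta0 (to_compl p (lmono 1 1)) = to_compl p 'X.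
Proof.
have [Phi [PhiP _ Phiq]] := delta0P.
apply/eqP; rewrite -subr_eq0; apply/eqP/torsion; rewrite mulrnBl PhiP Phiq Lhat_incE.
rewrite -rmorphXn -rmorphMn -!rmorphB /= -[X in _ = X](rmorph0 (@to_compl p {poly {laurent R}})).
congr (to_compl p _); rewrite -polyC_exp lmonoX expr1n mul1r.
by rewrite [X in X - _ - _]addrC addrK subrr.
Qed.

(** Logarithmic differentiation: x = u q^(e/n) and y = q satisfy x^n = y^e. Applying [Phi] and
    expanding to first order in p gives n x^(p(n-1)) delta x = e y^(p(e-1)) q' modulo p. *)
Lemma reduce_deltan (u : R) e : (0 < e)%N -> u ^+ n = 1 ->
  reduce red (deltan (to_compl p (lmono u e%:Z)))
    = lmono (e%:R / n%:R * red u ^+ p) ((p * e)%N%:Z - (p * n)%N%:Z) *: 'X.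
Proof.
move=> e0 un; have [[Phi PhiP] ext] := deltanP.
pose x : Lhat p R := to_compl p (lmono u e%:Z).
pose y : Lhat p R := to_compl p (lmono 1 n%:Z).
pose xx : Lphat p R := to_compl p (lmono u e%:Z)%:P.
pose yy : Lphat p R := to_compl p (lmono 1 n%:Z)%:P.
pose d := deltan x; pose q' : Lphat p R := to_compl p 'X.
have xy : x ^+ n = y ^+ e.
  by rewrite /x /y -!rmorphXn !lmonoX un expr1n mulrC.
have dy : deltan y = q'.
  have -> : y = Lhat_root n (to_compl p (lmono 1 1)).
    by rewrite Lhat_rootE lsub_mono // expr1z !mulr1.
  rewrite ext delta0_q Lphat_rootE; congr (to_compl p _).
  apply/polyP => i; rewrite coef_map_id0 ?raddf0 // !coefX.
  case: eqP => _; rewrite ?raddf0 //.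
  have -> : 1 = lmono 1 0 :> {laurent R} by [].
  by rewrite lsub_mono // mulr0 expr0z mulr1.
have Px : Phi x = xx ^+ p + d *+ p.
  by rewrite /d PhiP Lhat_incE addrC subrK.
have Py : Phi y = yy ^+ p + q' *+ p.
  by rewrite -dy PhiP Lhat_incE addrC subrK.
have xxyy : xx ^+ n = yy ^+ e.
  rewrite /xx /yy -!rmorphXn /=; congr (to_compl p _).
  by rewrite !lmonoX un expr1n mulrC.
have : Phi (x ^+ n) = Phi (y ^+ e) by rewrite xy.
rewrite (rmorphXn Phi) (rmorphXn Phi) Px Py.
have [w1 ->] := exprD_sq (xx ^+ p) d p n.
have [w2 ->] := exprD_sq (yy ^+ p) q' p e.
have xyp : (xx ^+ p) ^+ n = (yy ^+ p) ^+ e by rewrite exprAC xxyy exprAC.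
rewrite xyp -!addrA => /addrI E.
(* The terms of order 0 in p have cancelled, and the completion has no p-torsion, so one factor p
   can be removed. *)
have {}E : (xx ^+ p) ^+ n.-1 * d *+ n + w1 *+ p = (yy ^+ p) ^+ e.-1 * q' *+ e + w2 *+ p.
  by apply/eqP; rewrite -subr_eq0; apply/eqP/torsion; rewrite mulrnBl !mulrnDl E subrr.
have {E} := congr1 (reduce red) E.
rewrite !(reduceD R_ur) !(reduce_p R_ur) !addr0 !(reduceMn R_ur) !(reduceM R_ur).
rewrite !(reduceX R_ur) !(reduce_to_compl R_ur).
rewrite map_polyX !map_polyC /= => E.
have n0 := natr_residue_neq0 np.
have xE : lmap red (lmono u e%:Z) = lmono (red u) e%:Z.
  by apply: laurentP => m; rewrite lmap_coef !lmono_coef; case: ifP; rewrite ?rmorph0.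
have yE : lmap red (lmono 1 n%:Z) = lmono 1 n%:Z.
  by apply: laurentP => m; rewrite lmap_coef !lmono_coef; case: ifP; rewrite ?rmorph1 ?rmorph0.
move: E; rewrite xE yE -/d; set db := reduce red d => E.
pose X := lmono (red u) e%:Z; pose Y : {laurent k} := lmono 1 n%:Z.
have {}E : (X ^+ p) ^+ n.-1 *: db *+ n = (Y ^+ p) ^+ e.-1 *: 'X *+ e.
  by rewrite -!mul_polyC !polyC_exp.
have un' : red u ^+ n = 1 by rewrite -rmorphXn un rmorph1.
have XY : X ^+ n = Y ^+ e by rewrite !lmonoX un' expr1n mulrC.
have {}E : (Y ^+ p) ^+ e *: db *+ n = (X ^+ p * (Y ^+ p) ^+ e.-1) *: 'X *+ e.
  have -> : (Y ^+ p) ^+ e = (X ^+ p) ^+ n by rewrite exprAC -XY exprAC.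
  by rewrite -[in RHS]scalerA [in RHS]scalerMnr -E -[in RHS]scalerMnr scalerA -exprS prednK.
have Yu : lmono 1 (- (p * n * e)%N%:Z) * (Y ^+ p) ^+ e = 1.
  rewrite !lmonoX !expr1n lmonoM mulr1; congr lmono; lia.
have nn : lconst n%:R^-1 * n%:R = 1 :> {laurent k}.
  have -> : n%:R = lconst n%:R :> {laurent k} by rewrite (rmorph_nat (@lconst k)).
  by rewrite -rmorphM /= mulVf.
have := congr1 (fun P => (lconst n%:R^-1 * lmono 1 (- (p * n * e)%N%:Z)) *: P) E.
rewrite -[in LHS]scaler_nat !scalerA.
have -> : lconst n%:R^-1 * lmono 1 (- (p * n * e)%N%:Z) * (n%:R * (Y ^+ p) ^+ e) = 1 :> {laurent k}.
  by rewrite mulrACA nn Yu mulr1.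
rewrite scale1r => ->; rewrite -scaler_nat !scalerA; congr (_ *: _).
have -> : e%:R = lconst e%:R :> {laurent k} by rewrite (rmorph_nat (@lconst k)).
rewrite !lmonoX !expr1n /lconst !lmonoM; congr lmono; first by ring.
by case: (e) e0 => // e' _ /=; lia.
Qed.
End DeltaModP.

(** * Hecke operators away from p *)

Section RootSum.
Variables (R : idomainType) (n : nat) (z : R).
Hypotheses (n_gt0 : (0 < n)%N) (zP : n.-primitive_root z).

Lemma prim_root_unit : z \is a GRing.unit.
Proof.
apply/unitrPr; exists (z ^+ n.-1); rewrite -exprS prednK //; exact: prim_expr_order.
Qed.

(** Orthogonality of characters: z^(n/D) is a primitive D-th root of unity. *)
Lemma root_sum D (m : int) : (D %| n)%N ->
  \sum_(B < D) ((z ^+ (n %/ D)) ^ m) ^+ B = if (D%:Z %| m)%Z then D%:R else 0.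
Proof.
move=> Dn; have D0 : (0 < D)%N by apply: dvdn_gt0 Dn.
have nE : n = (n %/ D * D)%N by rewrite divnK.
set v := z ^+ (n %/ D).
have vD : v ^+ D = 1 by rewrite -exprM -nE prim_expr_order.
have vU : v \is a GRing.unit by rewrite unitrX ?prim_root_unit.
have vDz i : v ^ (i * D%:Z) = 1 by rewrite mulrC -exprz_exp -exprnP vD exp1rz.
case: dvdzP => [[i ->]|Dm].
  rewrite vDz (eq_bigr (fun=> 1)) => [|B _]; last by rewrite expr1n.
  by rewrite sumr_const card_ord.
have vm : v ^ m != 1.
  apply: contra_notN Dm => vm1.
  have rE := divz_eq m D%:Z; exists (m %/ D%:Z)%Z; rewrite {1}rE.
  have r0 : (0 <= m %% D%:Z)%Z by rewrite modz_ge0 // eqz_nat -lt0n.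
  have rD : (m %% D%:Z < D%:Z)%Z by rewrite ltz_pmod.
  case rn : (m %% D%:Z)%Z r0 rD => [r|//] _; rewrite ltz_nat => rD.
  have : z ^+ (n %/ D * r) = 1.
    move: vm1; rewrite rE exprzDr // vDz mul1r rn -exprnP /v -exprM.
    by move/eqP.
  move/eqP; rewrite -(prim_order_dvd zP) {1}nE dvdn_pmul2l; last first.
    by rewrite divn_gt0 // dvdn_leq.
  by case: r rn rD => [|r] rn rD; rewrite ?addr0 // gtnNdvd.
apply/eqP; have : (v ^ m - 1) * \sum_(B < D) (v ^ m) ^+ B == 0.
  by rewrite -subrX1 [(v ^ m) ^+ D]exprnP exprz_exp vDz subrr.
by rewrite mulf_eq0 subr_eq0 (negPf vm).
Qed.
End RootSum.

Section HeckeCoef.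
Variables (p N : nat) (p_prime : prime p).
Variables (R : idomainType) (k : closedFieldType) (red : {rmorphism R -> k}).
Hypothesis R_ur : is_Zp_ur_hat p red.
Variables (phi : {rmorphism R -> R}) (zeta : nat -> R).
Hypothesis zetaP : forall n : nat, coprime n p -> n.-primitive_root (zeta n).
Variables (delta0 : Lhat p R -> Lphat p R) (delta0P : is_delta phi delta0).
Variable (delta : nat -> Lhat p R -> Lphat p R).
Hypothesis deltaP : forall n : nat, coprime n p -> extends_delta n delta0 (delta n).

Lemma lift_coefK (x : k) : red (lift_coef red x) = x.
Proof.
rewrite /lift_coef; case: xgetP => [y _ //|no].
by have [a ax] := ur_red_surj R_ur x; case: (no a).
Qed.

Lemma lmap_lift0 : lmap (lift_coef red) 0 = 0.
Proof.
apply: laurentP => m; rewrite lcoef0.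
rewrite -[LHS]/(if (0 : {laurent k}) m == 0 then 0 else lift_coef red ((0 : {laurent k}) m)).
by rewrite lcoef0 eqxx.
Qed.

(** The shift from M to W passes from the coefficient of q'^j to that of (q'/q^p)^j, exponents being
    counted in q^(1/n). *)
Lemma reduce_dsubst n (u : R) e (g : {poly {laurent k}}) j M :
  coprime n p -> (0 < e)%N -> u \is a GRing.unit -> u ^+ n = 1 ->
  (reduce red (dsubst delta n u e (Defs.lift p red g)))`_j M =
    let W := M + (p * n * j)%N%:Z in
    if (e%:Z %| W)%Z then
      (e%:R / n%:R) ^+ j * (g`_j : {laurent k}) ((W %/ e%:Z)%Z - (p * j)%N%:Z)
        * red (u ^ (W %/ e%:Z)%Z)
    else 0.
Proof.
(* The bound must include j, which may exceed the degree of g. *)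
move=> np e0 uU un; pose K := maxn (size (map_poly (lmap (lift_coef red)) g)) j.+1.
rewrite /Defs.lift (dsubstE _ _ _ _ (leq_maxl _ j.+1)) -/K (reduce_sum R_ur).
set c := lmono (e%:R / n%:R * red u ^+ p) ((p * e)%N%:Z - (p * n)%N%:Z).
have jK : (j < K)%N by rewrite leq_maxr.
rewrite (eq_bigr (fun i : 'I_K => (lsub (red u) e g`_i * c ^+ i) *: 'X^i)) => [|i _]; last first.
  rewrite (reduceM R_ur) (reduceX R_ur) (reduce_to_compl R_ur).
  rewrite (reduce_deltan p_prime R_ur delta0P np (deltaP np) e0 un) exprZn -scalerAr -/c
    map_polyC /=.
  rewrite mul_polyC scalerA mulrC; congr ((_ * _) *: _).
  apply: laurentP => m; rewrite lmap_coef !lsub_coef coef_map_id0 ?lmap_lift0 //.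
  case: ifP => _; last by rewrite rmorph0.
  rewrite rmorphM (rmorphXz red) //; congr (_ * _) => /=.
  by case: eqP => [->|_]; rewrite ?rmorph0 // lift_coefK.
have -> : (\sum_(i < K) (lsub (red u) e g`_i * c ^+ i) *: 'X^i)`_j = c ^+ j * lsub (red u) e g`_j.
  rewrite coef_sum (bigD1 (Ordinal jK)) //= big1 ?addr0 => [|i ij]; last first.
    by rewrite coefZ coefXn; case: eqP => [jE|_]; rewrite ?mulr0 //; case/eqP: ij; apply: val_inj.
  by rewrite coefZ coefXn eqxx mulr1 mulrC.
rewrite /c lmonoX lmonoMl lsub_coef.
set W := M + (p * n * j)%N%:Z.
have -> : M - ((p * e)%N%:Z - (p * n)%N%:Z) * j%:Z = W - (p * j)%N%:Z * e%:Z.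
  by rewrite /W; lia.
have e1 : e%:Z != 0 by rewrite eqz_nat -lt0n.
have -> : (e%:Z %| W - (p * j)%N%:Z * e%:Z)%Z = (e%:Z %| W)%Z.
  apply/dvdzP/dvdzP => -[i iE].
    by exists (i + (p * j)%N%:Z); rewrite mulrDl -iE subrK.
  by exists (i - (p * j)%N%:Z); rewrite mulrBl iE.
case: dvdzP => [[i iE]|_]; last by rewrite mulr0.
rewrite iE -mulrBl !mulzK // rmorphXz // exprMn -exprM.
have rU : red u \is a GRing.unit by apply: rmorph_unit.
(* The powers of u from delta and from the substitution combine into one power, fixed by W alone. *)
have -> : red u ^ i = red u ^+ (p * j) * red u ^ (i - (p * j)%N%:Z).
  by rewrite exprnP -exprzDr // addrC subrK.
by move: (_ ^+ j) (_ ^+ (p * j)) (_ ^ (_ - _)) => a b c0; rewrite !mulrA [a * _ * b]mulrAC.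
Qed.

(** The sum over B is a character sum: it selects the W with D dividing W/A^2 and contributes D,
    which turns D^(-kappa) into D^(1-kappa). *)
Lemma hecke_coef kappa n (g : {poly {laurent k}}) j M : coprime n p -> (0 < n)%N ->
  (heckek N red zeta delta kappa n g)`_j M =
    let W := M + (p * n * j)%N%:Z in
    n%:R ^ (kappa - 1) * \sum_(D <- divisors n | coprime (n %/ D) N)
      if ((n %/ D * (n %/ D) * D)%N%:Z %| W)%Z then
        D%:R ^ (1 - kappa) * ((n %/ D)%:R / D%:R) ^+ j *
        (g`_j : {laurent k}) ((W %/ (n %/ D * (n %/ D))%N%:Z)%Z - (p * j)%N%:Z)
      else 0.
Proof.
move=> np n0; rewrite /heckek /hecke.
have unitn m : coprime m p -> (m%:R : R) \is a GRing.unit.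
  by move=> mp; apply: (ur_unit R_ur); rewrite rmorph_nat (natr_residue_neq0 p_prime R_ur).
have redL (a : R) : reduce red (Lcst p a) = (lconst (red a))%:P.
  rewrite /Lcst (reduce_to_compl R_ur) map_polyC /=; congr (_ %:P).
  by apply: laurentP => m; rewrite lmap_coef !lmono_coef; case: ifP; rewrite ?rmorph0.
rewrite (reduceM R_ur) redL rmorphXz ?unitn // rmorph_nat coefCM lconstMl; congr (_ * _).
rewrite (reduce_sum R_ur) coef_sum lcoef_sum big_seq_cond [RHS]big_seq_cond.
apply: eq_bigr => D /andP[Dn _]; have {}Dn : (D %| n)%N by rewrite dvdn_divisors.
have D0 : (0 < D)%N by apply: dvdn_gt0 Dn.
have A0 : (0 < n %/ D)%N by rewrite divn_gt0 // dvdn_leq.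
have Dp : coprime D p by apply: coprime_dvdl np.
set A := (n %/ D)%N in A0 *; have nE : n = (A * D)%N by rewrite divnK.
have Ap : coprime A p by apply: coprime_dvdl np; rewrite nE dvdn_mulr.
have D1 := natr_residue_neq0 p_prime R_ur Dp.
have A1 := natr_residue_neq0 p_prime R_ur Ap.
have zn := prim_expr_order (zetaP np).
have zU := prim_root_unit n0 (zetaP np).
rewrite (reduce_sum R_ur) coef_sum lcoef_sum.
set W := M + (p * n * j)%N%:Z.
rewrite (eq_bigr (fun B : 'I_D => if ((A * A)%N%:Z %| W)%Z then
   D%:R ^ (- kappa) * (A%:R / D%:R) ^+ j *
   (g`_j : {laurent k}) ((W %/ (A * A)%N%:Z)%Z - (p * j)%N%:Z) *
   red (((zeta n ^+ A) ^ (W %/ (A * A)%N%:Z)%Z) ^+ B) else 0)); last first.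
  move=> B _; rewrite (reduceM R_ur) redL coefCM lconstMl rmorphXz ?unitn // rmorph_nat.
  rewrite reduce_dsubst ?muln_gt0 ?A0 ?unitrX //; last first.
    by rewrite -!exprM mulnC exprM zn expr1n.
  rewrite /= -/W; case: ifP => _; last by rewrite mulr0.
  rewrite -!mulrA; congr (_ * _); rewrite !mulrA.
  have -> : (A * A)%:R / n%:R = A%:R / D%:R :> k.
    have -> : n%:R = A%:R * D%:R :> k by rewrite -natrM -nE.
    by rewrite natrM; field; rewrite D1 A1.
  congr (_ * red _).
  by rewrite exprM; move: (zeta n ^+ A) => v; rewrite !exprnP !exprz_exp mulrC.
case: (@dvdzP (A * A)%N%:Z W) => [[i iE]|nd]; last first.
  rewrite big1 // ifF //; apply/negP => /dvdzP[i iE]; case: nd.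
  by exists (i * D%:Z); rewrite iE; lia.
have AA : (A * A)%N%:Z != 0 by rewrite eqz_nat -lt0n muln_gt0 A0.
rewrite -mulr_sumr -rmorph_sum /= root_sum //; last exact: zetaP.
have -> : ((A * A * D)%N%:Z %| W)%Z = (D%:Z %| W %/ (A * A)%N%:Z)%Z.
  by rewrite iE mulzK // [(A * A * D)%N]mulnC (PoszM D) dvdz_mul2r.
case: ifP => _; last by rewrite rmorph0 mulr0.
rewrite rmorph_nat; have -> : D%:R ^ (1 - kappa) = D%:R ^ (- kappa) * D%:R :> k.
  by rewrite addrC expfzDr // expr1z.
by ring.
Qed.
End HeckeCoef.

(** * Coefficient arrays of Hecke eigenvectors *)

Section HeckeArrays.
Variables (p N kappa : nat) (p_prime : prime p) (k : fieldType) (lam : nat -> k).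
Implicit Types (a : int -> k) (m : int).

(** The coefficient formula of T_(kappa+2)(n): with A = n/D, the index D(m/A) is mn/A^2. Plain
    functions on integers allow dilating and twisting by m without repackaging series. *)
Definition hecke_array n a m : k :=
  \sum_(D <- divisors n | coprime (n %/ D) N)
    if ((n %/ D)%N%:Z %| m)%Z then
      (n %/ D)%:R ^+ kappa.+1 * a (D%:Z * (m %/ (n %/ D)%N%:Z)%Z) else 0.

Definition hecke_eigen a :=
  forall n, coprime n p -> forall m, hecke_array n a m = lam n * a m.

Lemma coprime_gt0 n : coprime n p -> (0 < n)%N.
Proof. by case: n => //; rewrite /coprime gcd0n => /eqP p1; move: p_prime; rewrite p1. Qed.

Lemma divisor_facts n D : coprime n p -> D \in divisors n ->
  [/\ (0 < D)%N, (0 < n %/ D)%N, coprime D p, coprime (n %/ D) p & n = (n %/ D * D)%N].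
Proof.
move=> np; have n0 := coprime_gt0 np; rewrite -dvdn_divisors // => Dn.
have D0 : (0 < D)%N by apply: dvdn_gt0 Dn.
split=> //; first by rewrite divn_gt0 // dvdn_leq.
- exact: coprime_dvdl np.
- by apply: coprime_dvdl np; rewrite -{2}(divnK Dn) dvdn_mulr.
- by rewrite divnK.
Qed.

Lemma dvdz_coprime_mul (A : nat) (s : nat) m : coprime A s ->
  (A%:Z %| s%:Z * m)%Z = (A%:Z %| m)%Z.
Proof. by move=> As; rewrite Gauss_dvdzr // /coprimez /gcdz /= . Qed.

Lemma dvdz_prime_mul (D : nat) m : coprime D p -> (p%:Z %| D%:Z * m)%Z = (p%:Z %| m)%Z.
Proof. by rewrite coprime_sym; apply: dvdz_coprime_mul. Qed.

Lemma hecke_array_eq n a b m : coprime n p ->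
  (forall D A i, coprime D p -> coprime A p -> (0 < D)%N -> (0 < A)%N -> n = (A * D)%N ->
     m = i * A%:Z -> a (D%:Z * i) = b (D%:Z * i)) ->
  hecke_array n a m = hecke_array n b m.
Proof.
move=> np ab; rewrite /hecke_array big_seq_cond [RHS]big_seq_cond.
apply: eq_bigr => D /andP[/(divisor_facts np)[D0 A0 Dp Ap nE] _].
case: dvdzP => // -[i iE]; congr (_ * _); rewrite iE mulzK; last by rewrite eqz_nat -lt0n.
exact: ab iE.
Qed.

(** At m = 1 only A = 1 contributes. *)
Lemma hecke_eigen_coef a n : hecke_eigen a -> coprime n p -> a n%:Z = lam n * a 1.
Proof.
move=> aE np; have n0 := coprime_gt0 np; rewrite -aE // /hecke_array.
rewrite (big_rem n) /=; last by rewrite -dvdn_divisors.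
rewrite divnn n0 coprime1n dvd1z expr1n mul1r divz1 mulr1 big_seq_cond big1 ?addr0 // => D.
case/andP; rewrite mem_rem_uniq ?divisors_uniq // inE
  => /andP[Dn /(divisor_facts np)[D0 A0 _ _ nE]] _.
rewrite ifF // dvdz1 /=; apply: contra_neqF Dn => /eqP A1.
by rewrite [RHS]nE A1 mul1n.
Qed.

Lemma hecke_eigen_dilate a s : hecke_eigen a -> hecke_eigen (fun m => a ((p ^ s)%N%:Z * m)).
Proof.
move=> aE n np m; rewrite -aE //; rewrite /hecke_array big_seq_cond [RHS]big_seq_cond.
apply: eq_bigr => D /andP[/(divisor_facts np)[D0 A0 Dp Ap nE] _].
rewrite dvdz_coprime_mul; last by rewrite coprimeXr.
case: dvdzP => // -[i iE]; congr (_ * a _).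
have A1 : (n %/ D)%N%:Z != 0 by rewrite eqz_nat -lt0n.
by rewrite iE (mulrA (p ^ s)%N%:Z i) !mulzK // mulrCA.
Qed.

Definition prime_to_p a m : k := if (p%:Z %| m)%Z then 0 else a m.

Lemma hecke_eigen_prime_to_p a : hecke_eigen a -> hecke_eigen (prime_to_p a).
Proof.
move=> aE n np m; rewrite /prime_to_p; case: ifP => pm; last first.
  rewrite -aE //; apply: hecke_array_eq => // D A i Dp Ap D0 A0 nE mE.
  by rewrite dvdz_prime_mul // -(dvdz_prime_mul _ Ap) mulrC -mE pm.
rewrite mulr0 -[RHS](_ : hecke_array n (fun=> 0) m = 0); last first.
  by rewrite /hecke_array big1 // => D _; rewrite mulr0 if_same.
apply: hecke_array_eq => // D A i Dp Ap D0 A0 nE mE.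
by rewrite dvdz_prime_mul // -(dvdz_prime_mul _ Ap) mulrC -mE pm.
Qed.

Lemma hecke_eigenZ a c : hecke_eigen a -> hecke_eigen (fun m => c * a m).
Proof.
move=> aE n np m; rewrite mulrCA -aE // /hecke_array mulr_sumr; apply: eq_bigr => D _.
by case: ifP; rewrite ?mulr0 // mulrCA.
Qed.

(* The only possible eigenvector with first coefficient 1, read off the eigenvalues. *)
Definition newform m : k :=
  if 0 < m then lam p ^+ logn p `|m|%N * lam (`|m| %/ p ^ logn p `|m|)%N else 0.

Lemma newform_coprime (m : nat) : coprime m p -> newform m%:Z = lam m.
Proof.
move=> mp; rewrite /newform ltz_nat coprime_gt0 //=
  (_ : logn p m = 0%N) ?expn0 ?expr0 ?mul1r ?divn1 //.
by apply: logn_coprime; rewrite coprime_sym.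
Qed.

Lemma newform_mul_pX v m : newform ((p ^ v)%N%:Z * m) = lam p ^+ v * newform m.
Proof.
have p0 := prime_gt0 p_prime; have pv0 : (0 < p ^ v)%N by rewrite expn_gt0 p0.
rewrite /newform pmulr_rgt0 ?ltz_nat //; case: ifP; rewrite ?mulr0 //.
case: m => // m; rewrite ltz_nat => m0; rewrite -PoszM /=.
rewrite lognM // pfactorK // exprD mulrA; congr (_ * lam _).
by rewrite expnD divnMl.
Qed.

Lemma newform_le0 m : m <= 0 -> newform m = 0.
Proof. by move=> m0; rewrite /newform ltNge m0. Qed.

Lemma int_pfactor m : 0 < m ->
  exists v (m' : nat), [/\ coprime m' p, (0 < m')%N & m = (p ^ v)%N%:Z * m'%:Z].
Proof.
case: m => // m; rewrite ltz_nat => m0; have [m' pm mE] := pfactor_coprime p_prime m0.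
exists (logn p m), m'; split; first by rewrite coprime_sym.
  by apply: coprime_gt0; rewrite coprime_sym.
by rewrite -PoszM mulnC -mE.
Qed.

(** Normalised at 1, the prime-to-p part of a agrees with [newform] at indices prime to p. The
    operators at n prime to p do not mix indices of different p-adic valuation, so extending by
    powers of [lam p] preserves the eigenvector property; a need not be an eigenvector of U. *)
Lemma hecke_eigen_newform a : hecke_eigen a -> a 1 != 0 ->
  (forall m, m < 0 -> a m = 0) -> lam 1 = 1 /\ hecke_eigen newform.
Proof.
move=> aE a1 a0.
pose b m := (a 1)^-1 * prime_to_p a m.
have bE : hecke_eigen b by apply/hecke_eigenZ/hecke_eigen_prime_to_p.
have cop (m : nat) : coprime m p = ~~ (p%:Z %| m%:Z)%Z.
  by rewrite coprime_sym prime_coprime.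
have bn (m : nat) : coprime m p -> b m%:Z = newform m%:Z.
  move=> mp; rewrite newform_coprime // /b /prime_to_p ifF; last by apply/negbTE; rewrite -cop.
  by rewrite (hecke_eigen_coef aE mp) mulrCA mulVf // mulr1.
have bnp m : ~~ (p%:Z %| m)%Z -> b m = newform m.
  case: m => m pm; first by apply: bn; rewrite cop.
  by rewrite /b /prime_to_p (negPf pm) (a0 (Negz m)) // mulr0 newform_le0.
split.
  have := hecke_eigen_coef aE (coprime1n p) => /eqP.
  by rewrite -{1}[a 1]mul1r (inj_eq (mulIf a1)) => /eqP.
move=> n np m; have [m0|m0] := lerP m 0.
  rewrite newform_le0 // mulr0 -[RHS](_ : hecke_array n (fun=> 0) m = 0); last first.
    by rewrite /hecke_array big1 // => D _; rewrite mulr0 if_same.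
  apply: hecke_array_eq => // D A i Dp Ap D0 A0 nE mE; apply: newform_le0.
  by rewrite pmulr_rle0 ?ltz_nat //; move: m0; rewrite mE pmulr_lle0 // ltz_nat.
have [v [m' [m'p m'0 ->]]] := int_pfactor m0.
rewrite newform_mul_pX mulrCA -bn // -bE //.
rewrite /hecke_array mulr_sumr big_seq_cond [RHS]big_seq_cond.
apply: eq_bigr => D /andP[/(divisor_facts np)[D0 A0 Dp Ap nE] _].
rewrite dvdz_coprime_mul; last by rewrite coprimeXr.
case: dvdzP => [[i iE]|]; last by rewrite mulr0.
have A1 : (n %/ D)%N%:Z != 0 by rewrite eqz_nat -lt0n.
rewrite iE (mulrA (p ^ v)%N%:Z i) !mulzK // [D%:Z * _]mulrCA newform_mul_pX mulrCA bnp //.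
by rewrite dvdz_prime_mul // -(dvdz_prime_mul _ Ap) mulrC -iE -cop.
Qed.
End HeckeArrays.

Section HeckeEigen.
Variables (p N : nat) (p_prime : prime p).
Variables (R : idomainType) (k : closedFieldType) (red : {rmorphism R -> k}).
Hypothesis R_ur : is_Zp_ur_hat p red.
Variables (phi : {rmorphism R -> R}) (zeta : nat -> R).
Hypothesis zetaP : forall n : nat, coprime n p -> n.-primitive_root (zeta n).
Variables (delta0 : Lhat p R -> Lphat p R) (delta0P : is_delta phi delta0).
Variable (delta : nat -> Lhat p R -> Lphat p R).
Hypothesis deltaP : forall n : nat, coprime n p -> extends_delta n delta0 (delta n).
Variables (kappa : nat) (lam : nat -> k).

(** The index W in q is nW in q^(1/n); this translates the conditions of [hecke_coef] into those of
    [hecke_array]. *)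
Lemma hecke_coef_dvd n A D (W : int) : n = (A * D)%N -> (0 < A)%N -> (0 < D)%N ->
  ((A * A * D)%N%:Z %| n%:Z * W)%Z = (A%:Z %| W)%Z /\
  ((A%:Z %| W)%Z -> (n%:Z * W %/ (A * A)%N%:Z)%Z = D%:Z * (W %/ A%:Z)%Z).
Proof.
move=> nE A0 D0; have n1 : (A * D)%N%:Z != 0 by rewrite eqz_nat -lt0n muln_gt0 A0.
have AA1 : (A * A)%N%:Z != 0 by rewrite eqz_nat -lt0n muln_gt0 A0.
have A1 : A%:Z != 0 by rewrite eqz_nat -lt0n.
split.
  by rewrite nE [(A * A * D)%N]mulnAC (PoszM (A * D) A) dvdz_mul2l.
move=> /dvdzP[i ->]; rewrite mulzK // nE.
have -> : (A * D)%N%:Z * (i * A%:Z) = D%:Z * i * (A * A)%N%:Z by lia.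
by rewrite mulzK.
Qed.

Lemma expfz_divisor (x y : k) (z : int) : y != 0 -> (x * y) ^ z * y ^ (- z) = x ^ z.
Proof. by move=> y0; rewrite expfzMl -mulrA -expfzDr // subrr expr0z mulr1. Qed.

Lemma expfz_divisor_nat (x y : k) (e : nat) : y != 0 ->
  (x * y) ^ e%:Z * y ^ (1 - e%:Z) = x ^+ e * y.
Proof.
by move=> y0; rewrite [1 - _]addrC expfzDr // mulrA expr1z expfz_divisor.
Qed.

Lemma eigen_series_intro (varphi : {laurent k}) :
  is_qseries varphi -> varphi != 0 -> hecke_eigen p N kappa lam varphi ->
  Uop p varphi = lconst (lam p) * varphi ->
  eigen_series N red zeta delta kappa lam varphi.
Proof.
move=> q0 v0 vE vU; split=> // n np; have n0 := coprime_gt0 p_prime np.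
apply/polyP => j; apply: laurentP => M.
rewrite (hecke_coef N p_prime R_ur zetaP delta0P deltaP _ _ _ _ np n0) /=.
rewrite /kroot coef_map_id0 ?raddf0 //.
have C0 (g : {laurent k}) i : (g%:P)`_i.+1 = 0 by rewrite coefC.
case: j => [|j]; last first.
  rewrite !C0 raddf0 lcoef0 big1 ?mulr0 // => D _.
  by rewrite lcoef0 mulr0 if_same.
rewrite !coefC !eqxx.
rewrite muln0 addr0 lsub_coef.
have nM D : D \in divisors n -> coprime (n %/ D) p -> (0 < n %/ D)%N -> n = (n %/ D * D)%N ->
   ~~ (n%:Z %| M)%Z -> ((n %/ D * (n %/ D) * D)%N%:Z %| M)%Z = false.
  move=> _ _ A0 nE; apply: contraNF => /dvdzP[i iE]; apply/dvdzP.
  exists (i * (n %/ D)%N%:Z); rewrite iE -mulrA -PoszM; congr (_ * Posz _).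
  by rewrite [X in _ = (_ * X)%N]nE mulnA.
have [/dvdzP[W ME]|nd] := boolP (n%:Z %| M)%Z; last first.
  rewrite big_seq_cond big1 ?mulr0 // => D /andP[Dn _].
  by have [D0 A0 Dp Ap nE] := divisor_facts p_prime np Dn; rewrite nM.
have n1 : n%:Z != 0 by rewrite eqz_nat -lt0n.
rewrite ME mulzK // exp1rz mulr1 lconstMl -vE // /hecke_array mulr_sumr.
rewrite big_seq_cond [RHS]big_seq_cond; apply: eq_bigr => D /andP[Dn _].
have [D0 A0 Dp Ap nE] := divisor_facts p_prime np Dn.
rewrite [W * n%:Z]mulrC; have [-> h2] := hecke_coef_dvd W nE A0 D0.
case: ifP => AW; last by rewrite mulr0.
rewrite h2 // muln0 subr0 expr0 mulr1 mulrA; congr (_ * _).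
have Dk := natr_residue_neq0 p_prime R_ur Dp.
have -> : n%:R = (n %/ D)%:R * D%:R :> k by rewrite -natrM -nE.
rewrite exprnP -[RHS](expfz_divisor _ _ Dk); congr (_ ^ _ * _ ^ _); lia.
Qed.

Section Coefficients.
Variable f : {poly {laurent k}}.
Hypothesis fE : forall n, coprime n p ->
  lconst n%:R *: heckek N red zeta delta kappa%:Z n f = kroot n (lconst (lam n) *: f).

(* The coefficient of (q'/q^p)^b in [f], as a series in q. *)
Definition warray (b : nat) (W : int) : k := (f`_b : {laurent k}) (W - (p * b)%N%:Z).

Lemma eigen_weight n b W : coprime n p ->
  \sum_(D <- divisors n | coprime (n %/ D) N)
    (if ((n %/ D)%N%:Z %| W)%Z then
      n%:R ^ kappa * D%:R ^ (1 - kappa%:Z) * ((n %/ D)%:R / D%:R) ^+ b *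
        warray b (D%:Z * (W %/ (n %/ D)%N%:Z)%Z) else 0)
  = lam n * warray b W.
Proof.
move=> np; have n0 := coprime_gt0 p_prime np.
have n1 : n%:Z != 0 by rewrite eqz_nat -lt0n.
have nk := natr_residue_neq0 p_prime R_ur np.
(* The exponent of q^(1/n) for which the shifted index in [hecke_coef] is nW. *)
pose M := n%:Z * W - (p * n * b)%N%:Z.
have := congr1 (fun P : {poly {laurent k}} => P`_b M) (fE np).
rewrite /kroot coef_map_id0 ?raddf0 // !coefZ lconstMl lsub_coef.
rewrite (hecke_coef N p_prime R_ur zetaP delta0P deltaP _ _ _ _ np n0); lazy zeta.
have -> : M = (W - (p * b)%N%:Z) * n%:Z by rewrite /M; lia.
rewrite dvdz_mull // mulzK // exp1rz mulr1 lconstMl -/(warray _ _).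
have -> : (W - (p * b)%N%:Z) * n%:Z + (p * n * b)%N%:Z = n%:Z * W by lia.
rewrite mulrA => <-; rewrite mulr_sumr big_seq_cond [RHS]big_seq_cond.
apply: eq_bigr => D /andP[Dn _].
have [D0 A0 Dp Ap nE] := divisor_facts p_prime np Dn.
have [-> h2] := hecke_coef_dvd W nE A0 D0.
case: ifP => AW; last by rewrite mulr0.
rewrite h2 // !mulrA -/(warray _ _); congr (_ * _ * _ * _).
by rewrite -{2}[n%:R]expr1z -expfzDr // addrC subrK.
Qed.

(** For an f that is symmetric at p, [warray (p ^ i)] is supported on multiples of p^(i+1), so the
    dilation loses nothing. *)
Definition pow_array i (m : int) : k := warray (p ^ i) ((p ^ i.+1)%N%:Z * m).

Lemma pow_array_eigen i : hecke_eigen p N kappa lam (pow_array i).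
Proof.
suff : hecke_eigen p N kappa lam (warray (p ^ i)) by apply: hecke_eigen_dilate.
move=> n np W; rewrite -eigen_weight // /hecke_array big_seq_cond [RHS]big_seq_cond.
apply: eq_bigr => D /andP[/(divisor_facts p_prime np)[D0 A0 Dp Ap nE] _].
case: ifP => // _; congr (_ * _).
have Dk := natr_residue_neq0 p_prime R_ur Dp.
have pk := pchar_residue R_ur p_prime.
rewrite exprMn exprVn !(natr_exp_charX pk).
have -> : n%:R = (n %/ D)%:R * D%:R :> k by rewrite -natrM -nE.
by rewrite expfz_divisor_nat // exprSr -mulrA [D%:R * _]mulrC divfK.
Qed.

(** The twist by m undoes the division by n in phi^(-1). The factor is m rather than p^i m, which
    would vanish in k. *)
Definition zero_array i (m : int) : k :=
  prime_to_p p (fun m => m%:~R * warray 0 ((p ^ i)%N%:Z * m)) m.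

(** Since m A^kappa D = A^(kappa+1) (Dm/A), the twist supplies the missing factor A/D. *)
Lemma zero_array_eigen i : hecke_eigen p N kappa lam (zero_array i).
Proof.
apply: hecke_eigen_prime_to_p => // n np m; rewrite mulrCA.
rewrite -eigen_weight // mulr_sumr /hecke_array big_seq_cond [RHS]big_seq_cond.
apply: eq_bigr => D /andP[/(divisor_facts p_prime np)[D0 A0 Dp Ap nE] _].
have Dk := natr_residue_neq0 p_prime R_ur Dp.
rewrite dvdz_coprime_mul; last by rewrite coprimeXr.
case: dvdzP => [[i' iE]|]; last by rewrite mulr0.
have A1 : (n %/ D)%N%:Z != 0 by rewrite eqz_nat -lt0n.
rewrite iE (mulrA (p ^ i)%N%:Z i') !mulzK // [(p ^ i)%N%:Z * (D%:Z * i')]mulrCA !mulrA;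
  congr (_ * _).
have -> : n%:R = (n %/ D)%:R * D%:R :> k by rewrite -natrM -nE.
rewrite expr0 mulr1 -(mulrA _ (_ ^ _)) expfz_divisor_nat // exprSr !intrM.
by move: (_ ^+ kappa) => u; rewrite !pmulrn; ring.
Qed.
End Coefficients.
End HeckeEigen.

(** * The operator at p *)

Section DeltaSymmetricSeries.
Variables (p : nat) (p_prime : prime p) (p_odd : odd p) (k : closedFieldType).
Hypothesis pk : p \in [pchar k].
Variables (f : {poly {laurent k}}) (f_ds : is_dseries f).
Variables (g : {poly {laurent k}}) (gP : is_pU p f g).
Variables (kappa : nat) (lp : k).
Hypothesis pTf : lconst lp *: f = g + lconst (p ^ kappa)%:R *: Vpoly p f.

Let p_gt0 : (0 < p)%N. Proof. exact: prime_gt0. Qed.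

Lemma warray_small b W : W < (p * b)%N%:Z -> warray p f b W = 0.
Proof. by move=> Wb; apply: f_ds; rewrite subr_lt0. Qed.

Lemma warray_wcoef b w : (p * b <= w)%N -> warray p f b w%:Z = wcoef p f w b.
Proof. by move=> bw; rewrite /warray /wcoef subzn. Qed.

Lemma warray_support b W : (0 < b)%N -> warray p f b W != 0 ->
  exists s (m : nat), b = (p ^ s)%N /\ W = (p ^ s.+1)%N%:Z * m%:Z.
Proof.
have [_ [h [_ hP] _]] := gP.
move=> b0 fb; have : (p * b)%N%:Z <= W by rewrite leNgt; apply: contra_neqN fb; apply: warray_small.
case: W fb => // w; rewrite lez_nat => fb bw.
move: fb; rewrite warray_wcoef // => fb.
have [|[s bs] /dvdnP[m wm]] := wcoef_support p_prime p_odd pk hP _ fb.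
  by rewrite b0 leq_divRL // mulnC.
by exists s, m; split=> //; rewrite wm bs -expnS PoszM mulrC.
Qed.

Lemma pT_coef b (a : nat) : exists2 h, sym_subst h =1 Sigma_p f &
  lp * (f`_b : {laurent k}) a%:Z = h (mnm_last p a b)
    + (if b == 0%N then (p ^ kappa)%:R * (Vop p f`_0) a%:Z else 0).
Proof.
have [_ [h [_ hP] gh]] := gP; exists h => //.
have := congr1 (fun P : {poly {laurent k}} => P`_b a%:Z) pTf.
rewrite coefZ lconstMl => ->; rewrite coefD lcoefD gh coefZ lconstMl coefC.
by case: eqP => // _; rewrite lcoef0 mulr0.
Qed.

Lemma pow_array_le0 i m : m <= 0 -> pow_array p f i m = 0.
Proof.
move=> m0; apply: warray_small; apply: (@le_lt_trans _ _ 0).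
  by rewrite pmulr_rle0 // ltz_nat expn_gt0 p_gt0.
by rewrite ltz_nat muln_gt0 expn_gt0 p_gt0.
Qed.

(** Compare coefficients of q^a q'^b, b = p^i > 0, in the eigenvalue equation at p; the V-term has
    no part with q'. *)
Lemma pow_array_mulp i m : pow_array p f i (p%:Z * m) = lp * pow_array p f i m.
Proof.
have [m0|] := lerP m 0.
  by rewrite !pow_array_le0 ?mulr0 // pmulr_rle0 // ltz_nat.
(* After the shift by pb, the exponent a becomes p^(i+1) (m+1), so it belongs to the index m+1. *)
case: m => // -[//|m] _; pose b := (p ^ i)%N; pose a := (p ^ i.+1 * m)%N.
have b0 : (0 < b)%N by rewrite expn_gt0 p_gt0.
have [h hP E] := pT_coef b a.
have -> : pow_array p f i m.+1%:Z = (f`_b : {laurent k}) a%:Z.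
  rewrite /pow_array /warray -/b; congr (_ _); rewrite /a expnS -/b; lia.
rewrite E (gtn_eqF b0) addr0.
pose w := (p * a + p * p * b)%N.
rewrite (h_mnm_last_pos p_prime p_odd pk hP (w := w)) // ifT; last first.
  by rewrite dvdn_addl // /a expnS mulnA mulnA -/b dvdn_mulr.
have bw : (p * b <= w)%N by rewrite /w -mulnA; apply: leq_trans (leq_addl _ _); rewrite leq_pmull.
rewrite -warray_wcoef // /pow_array -/b; congr (warray _ _ _ _).
by rewrite /w /a expnS -/b; lia.
Qed.

(** The coefficient of q^(p^i) in the eigenvalue equation at p, by [h_mnm_last0] with m = 1. This
    links the q'-free part of f to the others. *)
Lemma zero_array_p i : lp * warray p f 0 (p ^ i)%N%:Z = - pow_array p f i 1
  + (if (0 < i)%N then (p ^ kappa)%:R * warray p f 0 (p ^ i.-1)%N%:Z else 0).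
Proof.
have w0 W : warray p f 0 W = (f`_0 : {laurent k}) W by rewrite /warray muln0 subr0.
have [h hP E] := pT_coef 0 (p ^ i); rewrite !w0 E eqxx.
pose w := (p ^ i.+1 * 1)%N.
have p1 : ~~ (p %| 1)%N by rewrite dvdn1 gtn_eqF // prime_gt1.
have := h_mnm_last0 p_prime p_odd pk hP (erefl w) p1.
rewrite muln1 => ->; rewrite divr1; congr (- _ + _).
  by rewrite -warray_wcoef /w ?muln1 -?expnS // /pow_array mulr1.
rewrite lsub_coef; case: i {E w} => [|i] /=.
  rewrite expn0 (_ : (p%:Z %| 1)%Z = false) ?mulr0 //.
  by rewrite dvdz1 /= gtn_eqF // prime_gt1.
rewrite expnS PoszM dvdz_mulr // exp1rz mulr1 mulKz //.
by rewrite eqz_nat -lt0n.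
Qed.
End DeltaSymmetricSeries.

(** * Coefficients of the formal sum *)

Section FormalSum.
Variables (p : nat) (p_prime : prime p) (k : fieldType).
Implicit Types (g : {poly {laurent k}}) (v : {laurent k}) (m : int).

Let p_gt0 : (0 < p)%N. Proof. exact: prime_gt0. Qed.
Let pX_neq0 i : (p ^ i)%N%:Z != 0. Proof. by rewrite eqz_nat -lt0n expn_gt0 p_gt0. Qed.

Lemma Vop_mul v m : Vop p v (p%:Z * m) = v m.
Proof.
have p1 := pX_neq0 1; rewrite expn1 in p1.
by rewrite lsub_coef dvdz_mulr // mulKz // exp1rz mulr1.
Qed.

Lemma Vop_ndvd v m : ~~ (p%:Z %| m)%Z -> Vop p v m = 0.
Proof. by rewrite lsub_coef => /negPf ->. Qed.

Lemma frobk_coef g j : (frobk p g)`_j = if (p %| j)%N then Vop p g`_(j %/ p) else 0.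
Proof.
by rewrite /frobk coef_comp_poly_Xn // coef_map_id0 //; exact: (raddf0 (lsub 1 p)).
Qed.

Lemma iter_frobk_coef i g j m : (iter i (@frobk p k) g)`_j m =
  if (p ^ i %| j)%N && ((p ^ i)%N%:Z %| m)%Z
  then (g`_(j %/ p ^ i) : {laurent k}) (m %/ (p ^ i)%N%:Z)%Z else 0.
Proof.
have p1 := pX_neq0 1; rewrite expn1 in p1.
elim: i j m => [|i IH] j m; first by rewrite expn0 dvd1n dvd1z divn1 divz1.
rewrite iterS frobk_coef; have [pj|pj] := boolP (p %| j)%N; last first.
  rewrite lcoef0 ifF //; apply: contraNF pj => /andP[+ _].
  by apply: dvdn_trans; rewrite expnS dvdn_mulr.
have [/dvdzP[m' ->]|pm] := boolP (p%:Z %| m)%Z; last first.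
  rewrite Vop_ndvd // ifF //; apply: contraNF pm => /andP[_].
  by apply: dvdz_trans; rewrite expnS PoszM dvdz_mulr.
rewrite mulrC Vop_mul IH dvdn_divRL // -expnSr expnS PoszM dvdz_mul2l //.
by rewrite -divnMA divzMpl // ltz_nat.
Qed.

Lemma antiderp_coef v m : antiderp p v m = if (p%:Z %| m)%Z then 0 else v m / m%:~R.
Proof. by []. Qed.

Lemma sharp2_coef (lp pk : k) v j m : (sharp2 p lp pk v)`_j m =
  if j == 0%N then antiderp p v m else
  if j == 1%N then - (lp * Vop p v (m + p%:Z)) else
  if j == p then pk * Vop p (Vop p v) (m + (p * p)%N%:Z) else 0.
Proof.
have p1 : (p == 1%N) = false by rewrite gtn_eqF // prime_gt1.
rewrite /sharp2 /dq exprZn !coefD coefN !coefZ coefC coefX coefXn.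
have E (a : k) (u : {laurent k}) M (b : bool) : (lconst a * u * (lmono 1 (- M) * b%:R)) m
    = if b then a * u (m + M) else 0.
  case: b; last by rewrite !mulr0 lcoef0.
  by rewrite mulr1 mulrC lmonoMl mul1r opprK lconstMl.
have C : (if j == 0%N then antiderp p v else 0) m = if j == 0%N then antiderp p v m else 0.
  by case: ifP; rewrite ?lcoef0.
rewrite lmonoX expr1n mulNr !lcoefD lcoefN !E C -PoszM.
case: j {C} => [|[|j]]; rewrite ?eqxx.
- by rewrite (ltn_eqF p_gt0) oppr0 !addr0.
- by rewrite (eq_sym 1%N p) p1 add0r addr0.
by rewrite oppr0 !add0r.
Qed.
End FormalSum.

Section VopShift.
Variables (p : nat) (p_prime : prime p) (k : fieldType).
Implicit Types (v : {laurent k}) (m : int).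

Let p_neq0 : p%:Z != 0. Proof. by rewrite eqz_nat -lt0n prime_gt0. Qed.

(** V(v)/q^p is V(v/q), hence the shift by 1. *)
Lemma Vop_shift v m : Vop p v (m + p%:Z) =
  if (p%:Z %| m)%Z then v ((m %/ p%:Z)%Z + 1) else 0.
Proof.
have [/dvdzP[m' ->]|nd] := boolP (p%:Z %| m)%Z.
  by rewrite mulzK // -{2}[p%:Z]mul1r -mulrDl mulrC Vop_mul.
apply: Vop_ndvd; apply: contraNN nd => /dvdzP[i iE]; apply/dvdzP; exists (i - 1).
by rewrite mulrBl -iE mul1r addrK.
Qed.

Lemma Vop_shift2 v m : Vop p (Vop p v) (m + (p * p)%N%:Z) =
  if ((p * p)%N%:Z %| m)%Z then v ((m %/ (p * p)%N%:Z)%Z + 1) else 0.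
Proof.
have [/dvdzP[m' ->]|nd] := boolP (p%:Z %| m)%Z; last first.
  rewrite Vop_ndvd ?ifF //.
    by apply: contraNF nd; apply: dvdz_trans; rewrite PoszM dvdz_mulr.
  apply: contraNN nd => /dvdzP[i iE]; apply/dvdzP; exists (i - p%:Z).
  by rewrite mulrBl -iE -PoszM addrK.
by rewrite PoszM -mulrDl mulrC Vop_mul // Vop_shift
  [_ * p%:Z]mulrC dvdz_mul2l // divzMpl // ltz_nat prime_gt0.
Qed.
End VopShift.

Section NewformSeries.
Variables (p : nat) (p_prime : prime p) (k : fieldType) (lam : nat -> k).

Lemma newform_bounded : exists b, lbounded b (newform p lam).
Proof. by exists 0 => m m0; rewrite newform_le0 // ltW. Qed.
Definition newform_series : {laurent k} := Laurent newform_bounded.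

Lemma Uop_newform_series : Uop p newform_series = lconst (lam p) * newform_series.
Proof.
apply: laurentP => m; rewrite lconstMl /= prime_gt0 //.
by have := newform_mul_pX p_prime lam 1 m; rewrite expn1 expr1.
Qed.

Variables (pk : k) (c_ : nat -> k).

(** The coefficient of q^m in V^(i+1)(phi/q) for j = p^i, that is, in V^(i+1)(phi) q^(-pj). *)
Let Phi (j : nat) (m : int) : k :=
  if ((p * j)%N%:Z %| m)%Z then newform p lam ((m %/ (p * j)%N%:Z)%Z + 1) else 0.

Let pX_gt0 i : (0 < p ^ i)%N. Proof. by rewrite expn_gt0 prime_gt0. Qed.
Let pX_neq0 i : (p ^ i)%N%:Z != 0. Proof. by rewrite eqz_nat -lt0n pX_gt0. Qed.

(** q'^j arises from the linear term under F^i with j = p^i, and from the p-th power term under F^i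
    with j = p^(i+1). Both carry the same series in q, which therefore factors out. *)
Lemma sharp2_sum_coef n j m : (0 < j)%N ->
  (\sum_(i < n) lconst (c_ i) *: iter i (@frobk p k) (sharp2 p (lam p) pk newform_series))`_j m
  = Phi j m * \sum_(i < n) c_ i * ((if (j == p ^ i.+1)%N then pk else 0)
                                 - (if (j == p ^ i)%N then lam p else 0)).
Proof.
move=> j0; have p0 := prime_gt0 p_prime.
have p1 : p%:Z != 0 by rewrite eqz_nat -lt0n.
rewrite coef_sum lcoef_sum mulr_sumr; apply: eq_bigr => i _.
rewrite coefZ lconstMl mulrCA; congr (_ * _).
rewrite iter_frobk_coef // sharp2_coef // /Phi.
have [/dvdnP[j' jE]|pj] := boolP (p ^ i %| j)%N; last first.
  have nj e : (i <= e)%N -> (j == p ^ e)%N = false.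
    by move=> ie; apply: contraNF pj => /eqP ->; rewrite dvdn_exp2l.
  by rewrite !nj // subr0 mulr0.
have j'0 : (0 < j')%N by move: j0; rewrite jE muln_gt0 => /andP[].
rewrite {1 2 3}jE mulnK // (gtn_eqF j'0).
have Ej e : (j == p ^ (i + e))%N = (j' == p ^ e)%N.
  by rewrite jE expnD mulnC eqn_pmul2l.
have -> : (j == p ^ i.+1)%N = (j' == p)%N by rewrite -addn1 Ej expn1.
have -> : (j == p ^ i)%N = (j' == 1%N) by rewrite -[in LHS](addn0 i) Ej expn0.
have [j1|j1] := eqVneq j' 1%N.
  have -> : (j' == p) = false by rewrite j1 ltn_eqF // prime_gt1.
  rewrite sub0r mulrN; rewrite j1 mul1n in jE.
  have -> : (p * j = p * p ^ i)%N by rewrite jE.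
  have [/dvdzP[m' ->]|nd] := boolP ((p ^ i)%N%:Z %| m)%Z; last first.
    rewrite ifF ?mul0r ?oppr0 //; apply: contraNF nd.
    by apply: dvdz_trans; rewrite PoszM dvdz_mull.
  rewrite mulzK // PoszM dvdz_mul2r // divzMpr //; last by rewrite ltz_nat.
  by rewrite (Vop_shift p_prime) /= [lam p * _]mulrC.
rewrite subr0; have [j2|j2] := eqVneq j' p; last first.
  by rewrite mulr0; case: ifP.
have -> : (p * j = p * p * p ^ i)%N by rewrite jE j2 mulnA.
have [/dvdzP[m' ->]|nd] := boolP ((p ^ i)%N%:Z %| m)%Z; last first.
  rewrite ifF ?mul0r //; apply: contraNF nd.
  by apply: dvdz_trans; rewrite PoszM dvdz_mull.
rewrite mulzK // (PoszM (p * p)) dvdz_mul2r // divzMpr //; last by rewrite ltz_nat.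
by rewrite (Vop_shift2 p_prime) /= [pk * _]mulrC.
Qed.
End NewformSeries.

(** * Multiplicity one and the expansion of f *)

Section MultiplicityOne.
Variables (p N kappa : nat) (p_prime : prime p) (k : closedFieldType) (lam : nat -> k).
Variable f : {poly {laurent k}}.

Lemma pow_array_newform i m :
  hecke_eigen p N kappa lam (pow_array p f i) ->
  (forall m, m <= 0 -> pow_array p f i m = 0) ->
  (forall m, pow_array p f i (p%:Z * m) = lam p * pow_array p f i m) ->
  pow_array p f i m = pow_array p f i 1 * newform p lam m.
Proof.
move=> aE a0 ap; have [m0|] := lerP m 0; first by rewrite a0 // newform_le0 // mulr0.
move/(int_pfactor p_prime) => [v [m' [m'p m'0 ->]]].
rewrite newform_mul_pX // newform_coprime // mulrCA [_ * lam m']mulrC.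
rewrite -(hecke_eigen_coef p_prime aE m'p).
elim: v => [|v IH]; first by rewrite expn0 expr0 !mul1r.
by rewrite expnS PoszM -mulrA ap IH exprS mulrA.
Qed.

Lemma zero_array_newform v (m : nat) :
  hecke_eigen p N kappa lam (zero_array p f v) -> coprime m p ->
  m%:R * warray p f 0 ((p ^ v)%N%:Z * m%:Z) = lam m * warray p f 0 (p ^ v)%N%:Z.
Proof.
move=> aE mp; have := hecke_eigen_coef p_prime aE mp.
have np (m' : nat) : coprime m' p -> (p%:Z %| m'%:Z)%Z = false.
  by rewrite coprime_sym prime_coprime // => /negbTE.
by rewrite /zero_array /prime_to_p !np ?coprime1n // pmulrn mulr1 mul1r.
Qed.
End MultiplicityOne.

Theorem theorem5p4 (p N : nat) (p_prime : prime p) (p_ge5 : (5 <= p)%N)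
  (N_ge4 : (4 <= N)%N) (N_coprime : coprime N p)
  (R : idomainType) (k : closedFieldType) (red : {rmorphism R -> k})
  (R_ur : is_Zp_ur_hat p red)
  (phi : {rmorphism R -> R}) (phiP : is_frobenius_lift p phi)
  (zeta : nat -> R)
  (zetaP : forall n : nat, coprime n p -> n.-primitive_root (zeta n))
  (delta0 : Lhat p R -> Lphat p R) (delta0P : is_delta phi delta0)
  (delta : nat -> Lhat p R -> Lphat p R)
  (deltaP : forall n : nat, coprime n p -> extends_delta n delta0 (delta n))
  (kappa : nat) (f : {poly {laurent k}}) (lam : nat -> k) :
  is_dseries f -> ~ (exists c : k, f = (lconst c)%:P) ->
  eigen_dseries N red zeta delta kappa lam f ->
  exists (varphi : {laurent k}) (c : k) (c_ : nat -> k),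
    [/\ (exists i0 : nat, forall i : nat, (i0 <= i)%N ->
          (p ^ kappa)%:R * c_ i = lam p * c_ i.+1),
        eigen_series N red zeta delta kappa lam varphi
      & formal_sum
          (fun i => lconst (c_ i) *:
             iter i (@frobk p k) (sharp2 p (lam p) (p ^ kappa)%:R varphi))
          (f - (lconst c)%:P)].
Proof.
move=> f_ds f_nc [_ fE [g gP pTf]].
have p_odd : odd p by case: (even_prime p_prime) p_ge5 => // ->.
have p0 := prime_gt0 p_prime.
have pk := pchar_residue R_ur p_prime.
(* The choice of c_i is forced: phi^(-1) has coefficient 1 at q and only exponents prime to p, so
   q^(p^i) occurs in F^i phi^(-1) alone. *)
pose e_ i := pow_array p f i 1; pose c_ i := warray p f 0 (p ^ i)%N%:Z.
have powE i := pow_array_eigen p_prime R_ur zetaP delta0P deltaP fE i.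
have zeroE i := zero_array_eigen p_prime R_ur zetaP delta0P deltaP fE i.
have pow0 i m (m0 : m <= 0) := pow_array_le0 p_prime f_ds i m0.
have powp i m := pow_array_mulp p_prime p_odd pk f_ds gP pTf i m.
have ce i := zero_array_p p_prime p_odd pk gP pTf i.
have support b W := warray_support p_prime p_odd pk f_ds gP b W.
have powN i m := pow_array_newform p_prime m (powE i) (pow0 i) (powp i).
have zeroN v m := zero_array_newform p_prime (zeroE v) (m := m).
have w0 W : warray p f 0 W = (f`_0 : {laurent k}) W by rewrite /warray muln0 subr0.
have pX0 i : (0 < p ^ i)%N by rewrite expn_gt0 p0.
have f0pos m : 0 < m -> exists v (m' : nat), [/\ coprime m' p, m = (p ^ v)%N%:Z * m'%:Z
    & (f`_0 : {laurent k}) m = c_ v * lam m' / m'%:R].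
  move/(int_pfactor p_prime) => [v [m' [m'p m'0 ->]]]; exists v, m'; split=> //.
  rewrite -w0 [c_ v * _]mulrC -zeroN // mulrAC mulfV ?mul1r //.
  exact: (natr_residue_neq0 p_prime R_ur).
have fpos b m : (0 < b)%N -> (f`_b : {laurent k}) m = warray p f b (m + (p * b)%N%:Z).
  by move=> b0; rewrite /warray addrK.
(* The e_i and c_i determine f up to its constant term, so one of them is nonzero and provides an
   eigenarray with nonzero first coefficient. *)
have [lam1 newE] : lam 1%N = 1 /\ hecke_eigen p N kappa lam (newform p lam).
  case: (pselect (exists i, e_ i != 0)) => [[i ei]|noe].
    by apply: (hecke_eigen_newform p_prime (powE i) ei) => m /ltW; apply: pow0.
  case: (pselect (exists i, c_ i != 0)) => [[i ci]|noc].
    apply: (hecke_eigen_newform p_prime (zeroE i)).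
      by rewrite /zero_array /prime_to_p dvdz1 /= gtn_eqF ?prime_gt1 // mul1r mulr1.
    move=> m m0; rewrite /zero_array /prime_to_p; case: ifP => // _.
    by rewrite w0 f_ds ?mulr0 // pmulr_rlt0 // ltz_nat.
  case: f_nc; exists ((f`_0 : {laurent k}) 0); apply/polyP => j; apply: laurentP => m.
  have e0 i : e_ i = 0 by apply/eqP/negPn/negP => ei; apply: noe; exists i.
  have c0 i : c_ i = 0 by apply/eqP/negPn/negP => ci; apply: noc; exists i.
  rewrite coefC; case: posnP => [->|j0].
    rewrite lmono_coef; case: eqP => [->//|/eqP m0].
    have [m1|m1|m1] := ltgtP m 0; first by rewrite f_ds.
      by have [v [m' [_ _ ->]]] := f0pos _ m1; rewrite c0 !mul0r.
    by rewrite m1 eqxx in m0.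
  rewrite lcoef0 fpos //; apply/eqP/negPn/negP => fj.
  have [s [m' [js WE]]] := support _ _ j0 fj; case/negP: fj.
  by rewrite WE js -/(pow_array p f s m'%:Z) powN -/(e_ s) e0 mul0r.
have newform1 : newform p lam 1 = 1.
  by rewrite (newform_coprime p_prime lam (coprime1n p)).
exists (newform_series p lam), ((f`_0 : {laurent k}) 0), c_; split.
(* p^(i+1) exceeds the degree of f in q', so e_(i+1) = 0 and [zero_array_p] becomes the relation
   claimed. *)
- exists (size f) => i fi.
  have := ce i.+1; rewrite /= => ->; rewrite [X in - X](_ : _ = 0) ?oppr0 ?add0r //.
  rewrite /pow_array /warray nth_default ?lcoef0 //.
  by apply: leq_trans fi _; apply: ltnW; apply: leq_trans (ltn_expl _ (prime_gt1 p_prime));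
    rewrite ltnS.
- apply: (eigen_series_intro p_prime R_ur zetaP delta0P deltaP) => //.
  + by move=> m m0; apply: newform_le0.
  + apply/eqP => /(congr1 (fun v : {laurent k} => v 1)); rewrite lcoef0 /= newform1.
    by move/eqP; rewrite oner_eq0.
  + exact: Uop_newform_series.
move=> j m; rewrite coefB lcoefB coefC; have [->|j0] := posnP j.
  rewrite lmono_coef.
  pose t i := if ((p ^ i)%N%:Z %| m)%Z then
      antiderp p (newform_series p lam) (m %/ (p ^ i)%N%:Z)%Z else 0.
  have sumE n : (\sum_(i < n) lconst (c_ i) *: iter i (@frobk p k)
      (sharp2 p (lam p) (p ^ kappa)%:R (newform_series p lam)))`_0 m = \sum_(i < n) c_ i * t i.
    rewrite coef_sum lcoef_sum; apply: eq_bigr => i _.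
    by rewrite coefZ lconstMl iter_frobk_coef // dvdn0 div0n sharp2_coef.
  have [m0|m0] := lerP m 0.
    exists 0%N => n _; rewrite sumE big1 => [|i _].
      case: eqP => [->|/eqP m1]; first by rewrite subrr.
      by rewrite subr0 f_ds // lt_neqAle m1.
    rewrite /t; case: dvdzP => [[i' iE]|_]; last by rewrite mulr0.
    rewrite iE mulzK ?eqz_nat -?lt0n //; rewrite antiderp_coef /=
      newform_le0 ?mul0r ?if_same ?mulr0 //.
    by move: m0; rewrite iE pmulr_lle0 // ltz_nat.
  have [v [m' [m'p mE f0m]]] := f0pos _ m0.
  (* Only i = v contributes: for i > v, p^i does not divide m, and for i < v the index m/p^i is
     divisible by p, where [antiderp] vanishes. *)
  rewrite (gt_eqF m0) subr0 f0m; exists v.+1 => n vn; rewrite sumE.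
  rewrite (bigD1 (Ordinal vn)) //= big1 ?addr0 => [|i iv].
    rewrite /t mE dvdz_mulr // mulKz ?eqz_nat -?lt0n // antiderp_coef ifF; last first.
      by apply/negbTE; rewrite -prime_coprime // coprime_sym.
    by rewrite /= newform_coprime // pmulrn mulrA.
  rewrite /t; case: dvdzP => [[i' iE]|_]; last by rewrite mulr0.
  rewrite iE mulzK ?eqz_nat -?lt0n // antiderp_coef.
  suff -> : (p%:Z %| i')%Z by rewrite mulr0.
  have pXn i'' : (p ^ i'')%N%:Z != 0 by rewrite eqz_nat -lt0n.
  have [vi|iv'|vi] := ltngtP v i.
  - have : m'%:Z = i' * (p ^ (i - v))%N%:Z.
      apply: (mulfI (pXn v)); rewrite -mE iE mulrCA -(PoszM (p ^ v)%N) -expnD subnKC //.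
      exact: ltnW.
    move=> m'E; have : (p%:Z %| m'%:Z)%Z.
      by rewrite m'E dvdz_mull // dvdzE /= dvdn_exp ?subn_gt0.
    rewrite dvdzE /= => pm'; move: m'p; rewrite coprime_sym prime_coprime //.
    by rewrite pm'.
  - have -> : i' = (p ^ (v - i))%N%:Z * m'%:Z.
      apply: (mulIf (pXn i)); rewrite -iE mE mulrAC -(PoszM (p ^ (v - i))%N) -expnD subnK //.
      exact: ltnW.
    by rewrite dvdz_mulr // dvdzE /= dvdn_exp ?subn_gt0.
  by case/eqP: iv; apply: val_inj.
rewrite lcoef0 subr0 fpos //.
exists j.+1 => n jn; rewrite sharp2_sum_coef //.
case: (pselect (exists s, j = (p ^ s)%N)) => [[s js]|nj]; last first.
  rewrite big1 ?mulr0 => [|i _]; last first.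
    rewrite !ifF ?subr0 ?mulr0 //; apply/eqP => jE; apply: nj.
      by exists i.
    by exists i.+1.
  apply/eqP/negPn/negP => fj; have [s [m' [jE _]]] := support _ _ j0 fj.
  by apply: nj; exists s.
have sn : (s < n)%N by apply: leq_trans jn; rewrite js ltnS ltnW // ltn_expl // prime_gt1.
have inj e : (j == p ^ e)%N = (s == e) by rewrite js eqn_exp2l // prime_gt1.
(* Only i = s-1 and i = s contribute, and [zero_array_p] identifies the result with e_s. *)
have -> : \sum_(i < n) c_ i * ((if (j == p ^ i.+1)%N then (p ^ kappa)%:R else 0)
     - (if (j == p ^ i)%N then lam p else 0)) = e_ s.
  have -> : e_ s = (if (0 < s)%N then (p ^ kappa)%:R * c_ s.-1 else 0) - lam p * c_ s.
    by rewrite ce opprD opprK addrCA subrr addr0.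
  under eq_bigr do rewrite mulrBr; rewrite sumrB; congr (_ - _).
    case: posnP => [s0|s0].
      by rewrite big1 // => i _; rewrite inj s0 mulr0.
    have s1n : (s.-1 < n)%N by lia.
    rewrite (bigD1 (Ordinal s1n)) //= inj prednK // eqxx big1 ?addr0 1?mulrC // => i ii.
    rewrite inj ifF ?mulr0 //; apply/eqP => sE; case/eqP: ii; apply: val_inj => /=.
    by rewrite sE.
  rewrite (bigD1 (Ordinal sn)) //= inj eqxx big1 ?addr0 1?mulrC // => i ii.
  rewrite inj ifF ?mulr0 //; apply/eqP => sE; case/eqP: ii; exact: val_inj.
have pj0 : (p * j)%N%:Z != 0 by rewrite eqz_nat -lt0n muln_gt0 p0.
case: ifP => [/dvdzP[m1 ->]|pjm].
  rewrite mulzK // -{2}[(p * j)%N%:Z]mul1r -mulrDl mulrC [RHS]mulrC -powN.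
  by rewrite /pow_array js -expnS.
rewrite mul0r; apply/eqP/negPn/negP => fj.
have [s' [m' [jE mE]]] := support _ _ j0 fj; case/negP: pjm; apply/dvdzP.
exists (m'%:Z - 1); rewrite mulrBl mul1r mulrC {1}jE -expnS -mE addrK.
by [].
Qed.
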